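(* There is an algorithm which, given a finite rooted tree $T$ with $n=|V_T|$ nodes, nonnegative edge weights $w_e$, and for every node $v$ a probability $\pi_v\in(0,1]$ and a prize $p_v\in\mathbb{R}$, computes in $O(n^2)$ time a set $S^*\subseteq V_T$ with $$G(S^*,0)=\max_{S\subseteq V_T} G(S,0),$$ i.e. an optimal solution of the Probabilistic Profitable Tour Problem on the tree, together with its optimal value.
   Context: Setting. $T$ is a finite tree rooted at $r_T$ (the depot), with node set $V_T$, $n=|V_T|$; every edge $e$ has weight $w_e\ge 0$ (cost of traversing it in both directions). Every node $v$ has a probability $\pi_v\in(0,1]$ and a prize $p_v\in\mathbb{R}$. $d(v)$ is the total weight of the path from $r_T$ to $v$. A random set $\omega\subseteq V_T$ contains each node $v$ independently with probability $\pi_v$. For $S\subseteq V_T$, $P(S)=1-\prod_{s\in S}(1-\pi_s)$ (so $P(\emptyset)=0$). For $Q\subseteq V_T$, $W(Q)$ is the total weight of the edges lying on at least one path from $r_T$ to a node of $Q$ ($W(\emptyset)=0$). The expected profit of $S\subseteq V_T$ with bonus $x\le d(r_T)=0$ is $G(S,x)=\sum_{s\in S}p_s\pi_s-\mathbb{E}[W(S\cap\omega)]+x\,P(S)$; in particular $G(S,0)=\sum_{s\in S}p_s\pi_s-\mathbb{E}[W(S\cap\omega)]$ is the expected revenue minus the expected cost of the cheapest closed tour from $r_T$ visiting $S\cap\omega$. Time is measured in the standard RAM model with unit-cost arithmetic. *)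

(* Defs.v *)
From HB Require Import structures.
From mathcomp Require Import all_boot all_order all_algebra.
From mathcomp Require Import reals.
Set Implicit Arguments. Unset Strict Implicit. Unset Printing Implicit Defensive.
Import Order.TTheory GRing.Theory Num.Theory.
Local Open Scope ring_scope.

(* Rooted trees on the node set 'I_n.+1, rooted at ord0, given by a     *)
(* parent function.  The edge {v, par v} (v <> root) has weight w v.    *)

Definition is_rooted_tree (n : nat) (par : 'I_n.+1 -> 'I_n.+1) : Prop :=
  par ord0 = ord0 /\ forall v : 'I_n.+1, iter n par v = ord0.

Definition anc (n : nat) (par : 'I_n.+1 -> 'I_n.+1) (v u : 'I_n.+1) : bool :=
  [exists k : 'I_n.+1, iter k par v == u].

Section PPTP.
Variables (R : realType) (n : nat) (par : 'I_n.+1 -> 'I_n.+1)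
  (w pi p : 'I_n.+1 -> R).

(* W(Q): total weight of the edges lying on a root-to-q path, q in Q.
   Edge {u, par u} (u <> root) lies on the root-q path iff u is an
   ancestor-or-self of q. *)
Definition Wt (Q : {set 'I_n.+1}) : R :=
  \sum_(u : 'I_n.+1 | (u != ord0) && [exists q in Q, anc par q u]) w u.

Definition PS (S : {set 'I_n.+1}) : R := 1 - \prod_(s in S) (1 - pi s).

Definition prob_omega (om : {set 'I_n.+1}) : R :=
  (\prod_(v in om) pi v) * (\prod_(v in ~: om) (1 - pi v)).

Definition EW (S : {set 'I_n.+1}) : R :=
  \sum_(om : {set 'I_n.+1}) prob_omega om * Wt (S :&: om).

Definition G (S : {set 'I_n.+1}) (x : R) : R :=
  \sum_(s in S) p s * pi s - EW S + x * PS S.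

End PPTP.

(* A real RAM: unbounded nat registers (addresses), unbounded real      *)
(* registers, unit cost per instruction (incl. real +,-,*,/,<=, and     *)
(* indirect addressing).  Nat ops restricted to +, truncated -, zero    *)
(* test (standard, polynomially equivalent to Turing machines).         *)

Inductive instr : Type :=
| NConst (i c : nat)
| NAdd (i j k : nat)
| NSub (i j k : nat)
| NLoad (i j : nat)
| NStore (i j : nat)
| RFromN (r i : nat)
| RAdd (r a b : nat)
| RSub (r a b : nat)
| RMul (r a b : nat)
| RDiv (r a b : nat)
| RLoad (r j : nat)
| RStore (i r : nat)
| RLe (i a b : nat)
| JZ (i t : nat)
| Jmp (t : nat).

Record config (R : Type) := Config {
  pc : nat; nmem : nat -> nat; rmem : nat -> R }.

Definition upd (T : Type) (m : nat -> T) (a : nat) (x : T) : nat -> T :=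
  fun b => if b == a then x else m b.

Section RAM.
Variables (R : realType) (prog : seq instr).

Definition halted (c : config R) : bool := (size prog <= pc c)%N.

Definition step (c : config R) : config R :=
  let: Config k N X := c in
  if (size prog <= k)%N then c else
  match nth (Jmp k) prog k with
  | NConst i v => Config k.+1 (upd N i v) X
  | NAdd i j l => Config k.+1 (upd N i (N j + N l)%N) X
  | NSub i j l => Config k.+1 (upd N i (N j - N l)%N) X
  | NLoad i j => Config k.+1 (upd N i (N (N j))) X
  | NStore i j => Config k.+1 (upd N (N i) (N j)) X
  | RFromN r i => Config k.+1 N (upd X r (N i)%:R)
  | RAdd r a b => Config k.+1 N (upd X r (X a + X b))
  | RSub r a b => Config k.+1 N (upd X r (X a - X b))
  | RMul r a b => Config k.+1 N (upd X r (X a * X b))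
  | RDiv r a b => Config k.+1 N (upd X r (X a / X b))
  | RLoad r j => Config k.+1 N (upd X r (X (N j)))
  | RStore i r => Config k.+1 N (upd X (N i) (X r))
  | RLe i a b => Config k.+1 (upd N i (nat_of_bool (X a <= X b))) X
  | JZ i t => Config (if N i == 0%N then t else k.+1) N X
  | Jmp t => Config t N X
  end.

(* run for (at most) t steps; a halted configuration is a fixpoint *)
Definition exec (t : nat) (c : config R) : config R := iter t step c.

End RAM.

(* Input encoding of an instance with n.+1 nodes (root = node 0):
     N[0] = number of nodes, N[1+v] = par v;
     X[3v] = w v, X[3v+1] = pi v, X[3v+2] = p v;  all else 0.
   Output convention: v in S*  iff  N[n+2+v] <> 0;  optimal value in X[0]. *)
Definition init_config (R : realType) (n : nat) (par : 'I_n.+1 -> 'I_n.+1)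
  (w pi p : 'I_n.+1 -> R) : config R :=
  Config 0
    (fun a => if a == 0%N then n.+1
              else if (a <= n.+1)%N then val (par (inord a.-1)) else 0%N)
    (fun a => if (a < 3 * n.+1)%N then
                let v : 'I_n.+1 := inord (a %/ 3)%N in
                if (a %% 3 == 0)%N then w v
                else if (a %% 3 == 1)%N then pi v else p v
              else 0).

Definition out_set (R : realType) (n : nat) (c : config R) : {set 'I_n.+1} :=
  [set v : 'I_n.+1 | nmem c (n.+2 + v) != 0%N].

Definition out_value (R : realType) (c : config R) : R := rmem c 0.

(* Main.v *)
(* A choice S inside a subtree matters to the rest of the tree only through its
   value and the probability Q(S) that no node of S is active, and it is rated
   by value + y Q(S) for some y >= 0 (minus the bonus, plus edge weights).  So
   a subtree is represented by the upper envelope of the lines y |-> value +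
   y Q, a convex piecewise linear function.  To merge a child with k1 lines
   into its parent with k2 lines, the k1 k2 combined lines are inserted row by
   row into a stack.  The value functions of two rows are rescalings of one
   convex function, so their difference is monotone and a new, steeper row
   overtakes the current envelope at a single point.  This gives an amortised
   cost O(k1 k2), and the surviving cells form a monotone staircase in the
   k1 x k2 grid, so an envelope over m nodes has at most m + 1 lines.  Hence
   the merges cost O(sum_c |T_c| |T_(par c) - T_c|), a sum that counts distinct
   pairs of nodes and is therefore at most n^2.  The optimum is the root's line
   at y = 0; its set is read off from a DAG of unions built by the merges. *)

Require Import Defs.
From HB Require Import structures.
From mathcomp Require Import all_boot all_order all_algebra.
From mathcomp Require Import reals.
From mathcomp Require Import boolp zify ring lra.
Import Order.TTheory GRing.Theory Num.Theory.
Local Open Scope ring_scope.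
Set Implicit Arguments. Unset Strict Implicit. Unset Printing Implicit Defensive.

(** * Upper envelopes of lines *)

(** The crossing of a new row with the stack is sought from [y] = infinity downwards, where the
    steepest row wins. Every comparison discards either the top line of the stack or one column of
    the new row, so a row costs its number of columns plus the number of lines that it removes for
    ever. The breakpoints of a row are those of the parent's envelope divided by the slope of the
    row, so nothing is sorted. The division is delicate: a slope vanishes once a node with [pi]
    equal to 1 is chosen. Slopes increase strictly, so only the first row can be affected, and it
    then contributes a single line. The geometry speaks of functions on [nat], later instantiated by
    arrays in memory. Running times are credits of the program logic, so that the potential of
    stacked lines and the budget of outstanding merges can occur in loop invariants. Input and
    output share the low memory cells with the registers, hence the copying at both ends. *)

Section Chains.
Variable R : realFieldType.
Implicit Types (t a b : nat -> R) (k l m : nat) (y z : R).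

(* Line [l] is [y |-> a l + b l * y]; among the [k] lines it is maximal for [y]
   between [t l] and [t l.+1] (and beyond [t l] if it is the last one). *)
Record chain k t a b : Prop := Chain {
  chain_t0 : (0 < k)%N -> t 0%N = 0;
  chain_b0 : (0 < k)%N -> 0 <= b 0%N;
  chain_tS : forall l, (l.+1 < k)%N -> t l <= t l.+1;
  chain_bS : forall l, (l.+1 < k)%N -> b l < b l.+1;
  chain_cross : forall l, (l.+1 < k)%N ->
    a l + b l * t l.+1 = a l.+1 + b l.+1 * t l.+1 }.

(** Chains are read off memory arrays, which agree with one another only on the entries in use. *)
Lemma chain_ext k t a b t' a' b' : chain k t a b ->
  (forall l, (l < k)%N -> [/\ t' l = t l, a' l = a l & b' l = b l]) ->
  chain k t' a' b'.
Proof.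
case=> t0 b0 tS bS cr E; split.
- by move=> k0; have [-> _ _] := E _ k0; apply: t0.
- by move=> k0; have [_ _ ->] := E _ k0; apply: b0.
- by move=> l lk; have [-> _ _] := E _ lk; have [-> _ _] := E _ (ltnW lk); apply: tS.
- by move=> l lk; have [_ _ ->] := E _ lk; have [_ _ ->] := E _ (ltnW lk); apply: bS.
- by move=> l lk; have [-> -> ->] := E _ lk; have [_ -> ->] := E _ (ltnW lk); apply: cr.
Qed.

Lemma chain_tle k t a b l m : chain k t a b -> (l <= m < k)%N -> t l <= t m.
Proof.
move=> C; elim: m => [|m IH]; first by rewrite leqn0 => /andP[/eqP-> _].
rewrite leq_eqVlt => /andP[/orP[/eqP->//|lm] mk].
by apply: le_trans (chain_tS C mk); apply: IH; rewrite -ltnS lm /= ltnW.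
Qed.

Lemma chain_ble k t a b l m : chain k t a b -> (l <= m < k)%N -> b l <= b m.
Proof.
move=> C; elim: m => [|m IH]; first by rewrite leqn0 => /andP[/eqP-> _].
rewrite leq_eqVlt => /andP[/orP[/eqP->//|lm] mk].
apply: le_trans (ltW (chain_bS C mk)); apply: IH; by rewrite -ltnS lm /= ltnW.
Qed.

Lemma chain_t_ge0 k t a b l : chain k t a b -> (l < k)%N -> 0 <= t l.
Proof.
move=> C lk; rewrite -(chain_t0 C) ?(leq_ltn_trans _ lk) //.
by apply: chain_tle C _; rewrite lk.
Qed.

Lemma chain_b_ge0 k t a b l : chain k t a b -> (l < k)%N -> 0 <= b l.
Proof.
move=> C lk; apply: le_trans (chain_b0 C _) _; first exact: leq_ltn_trans lk.
by apply: chain_ble C _; rewrite lk.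
Qed.

(** Two neighbours compare according to the side of their common point on which [y] lies. The
    breakpoints are sorted, so these comparisons chain from [m] to [l] without a change of
    direction. *)
Lemma chain_active k t a b l m y : chain k t a b -> (l < k)%N -> (m < k)%N ->
  t l <= y -> ((l.+1 < k)%N -> y <= t l.+1) ->
  a m + b m * y <= a l + b l * y.
Proof.
move=> C lk mk tly ytl.
have step q : (q.+1 < k)%N -> t q.+1 <= y -> a q + b q * y <= a q.+1 + b q.+1 * y.
  move=> qk ty; have := chain_cross C qk; have := chain_bS C qk; nra.
have stepd q : (q.+1 < k)%N -> y <= t q.+1 -> a q.+1 + b q.+1 * y <= a q + b q * y.
  move=> qk ty; have := chain_cross C qk; have := chain_bS C qk; nra.
have [ml|lm] := leqP m l.
  elim: l lk tly ytl ml => [|l IH] lk tly ytl.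
    by rewrite leqn0 => /eqP->.
  rewrite leq_eqVlt => /orP[/eqP->//|ml].
  apply: le_trans (step _ lk tly).
  have up q : (q <= l)%N -> a m + b m * y <= a q + b q * y \/ (q < m)%N.
    elim: q => [|q IHq] ql.
      by case: (posnP m) => [->|]; [left|right].
    have [mq|] := leqP m q.+1; last by right.
    left; move: mq; rewrite leq_eqVlt => /orP[/eqP->//|mq].
    case: (IHq (ltnW ql)) => [H|]; last by rewrite ltnNge -ltnS mq.
    apply: le_trans H (step _ _ _); first lia.
    by apply: le_trans tly; apply: chain_tle C _; lia.
  case: (up l (leqnn _)) => //; lia.
elim: m mk lm => [//|m IH] mk lm.
have ym : y <= t m.+1.
  by apply: le_trans (ytl _) _; [lia|apply: chain_tle C _; lia].
apply: le_trans (stepd _ mk ym) _.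
by move: lm; rewrite ltnS leq_eqVlt => /orP[/eqP->//|lm]; apply: IH => //; lia.
Qed.

Lemma chain_locate k t a b j y : chain k t a b -> (j < k)%N -> t j <= y ->
  exists l, [/\ (j <= l < k)%N, t l <= y & (l.+1 < k)%N -> y < t l.+1].
Proof.
move=> C jk tj.
have ex : exists l, (l < k)%N && (t l <= y) by exists j; rewrite jk.
have ub l : (l < k)%N && (t l <= y) -> (l <= k)%N by case/andP => /ltnW.
case: (ex_maxnP ex ub) => l /andP[lk tl] mx; exists l; split => //.
  by rewrite lk mx // jk tj.
move=> lk'; rewrite ltNge; apply/negP => H.
by have := mx l.+1; rewrite lk' H ltnn => /(_ isT).
Qed.

End Chains.

(** * Merging two envelopes: a stack of grid cells *)

Section Stack.
Variables (R : realFieldType) (k2 : nat) (t2 a2 b2 : nat -> R).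
Variables (k1 : nat) (ca b1 : nat -> R).
Hypothesis C2 : chain k2 t2 a2 b2.
Hypothesis b1_ge0 : forall i, (i < k1)%N -> 0 <= b1 i.
Hypothesis b1S : forall i, (i.+1 < k1)%N -> b1 i < b1 i.+1.
Hypothesis b2_last : 0 < b2 k2.-1.

(** [ca] is the child's intercept after the charge for its edge, and the product of slopes is the
    probability that neither part is active. For fixed [i] the maximum over [j] is [ca i] plus the
    parent's envelope at [b1 i * y]. *)
Definition cell i j (y : R) := ca i + a2 j + b1 i * b2 j * y.

Lemma b1_lt i i' : (i < i' < k1)%N -> b1 i < b1 i'.
Proof.
elim: i' => [//|i' IH]; rewrite ltnS leq_eqVlt => /andP[/orP[/eqP->|ii] h].
  exact: b1S.
by apply: lt_trans (b1S h); apply: IH; rewrite ii ltnW.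
Qed.

Definition dominates i y := forall i' j, (i' < i)%N -> (j < k2)%N ->
  exists2 j', (j' < k2)%N & cell i' j y <= cell i j' y.

(* The value functions of two rows are rescalings of the same convex
   function with nonnegative slopes, so their difference is monotone. *)
Lemma row_cross i i' j j' y z : (i' < i < k1)%N -> (j < k2)%N -> (j' < k2)%N ->
  0 <= y <= z ->
  exists x x', [/\ (x < k2)%N, (x' < k2)%N &
    cell i j y + cell i' j' z <= cell i x z + cell i' x' y].
Proof.
move=> /andP[ii ik] jk jk' /andP[y0 yz].
have bb := b1_lt (introT andP (conj ii ik)).
have b0 : 0 <= b1 i' by apply: b1_ge0; lia.
have bj := chain_b_ge0 C2 jk; have bj' := chain_b_ge0 C2 jk'.
(* If [j] is the steeper column, both columns keep their places; otherwise they are exchanged, which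
   gains [(b1 i - b1 i') * (b2 j' * z - b2 j * y)]. *)
rewrite /cell; have [h|h] := leP (b2 j') (b2 j).
  exists j, j'; split => //.
  have p1 : b1 i' * b2 j' <= b1 i * b2 j by apply: ler_pM => //; apply: ltW.
  nra.
exists j', j; split => //.
have p1 : b2 j * y <= b2 j' * z by apply: ler_pM => //; apply: ltW.
nra.
Qed.

Lemma dominates_up i y z : (i < k1)%N -> 0 <= y <= z -> dominates i y -> dominates i z.
Proof.
move=> ik yz D i' j ii jk.
have ik' : (i' < i < k1)%N by rewrite ii.
(* One column that beats the whole of row [i'] at [y] is found opposite the best column of that row;
   [row_cross] then carries the comparison to [z]. *)
suff : exists2 j', (j' < k2)%N & forall q, (q < k2)%N -> cell i' q y <= cell i j' y.
  case=> j' jk' Dj'.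
  have [x [x' [xk xk' h]]] := row_cross ik' jk' jk yz.
  exists x => //; have := Dj' _ xk'; lra.
have k20 : (0 < k2)%N by exact: leq_ltn_trans jk.
have y0 : 0 <= b1 i' * y by apply: mulr_ge0; [apply: b1_ge0; lia | case/andP: yz].
have [|l [/andP[_ lk] tl tl']] := chain_locate C2 k20 (y := b1 i' * y); first by rewrite (chain_t0 C2 k20).
have [j' jk' hj'] := D i' l ii lk.
exists j' => // q qk; apply: le_trans hj'.
have := chain_active C2 lk qk tl (fun h => ltW (tl' h)); rewrite /cell; lra.
Qed.

(* An upper envelope of the cells of the first [i] rows; its line [l] is the
   cell [(I l, J l)].  [stk_size] holds because these cells form a monotone
   staircase, and bounds the number of lines. *)
Record stack m i (t a b : nat -> R) (I J : nat -> nat) : Prop := Stack {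
  stk_chain : chain m t a b;
  stk_I : forall l, (l < m)%N -> (I l < i)%N;
  stk_J : forall l, (l < m)%N -> (J l < k2)%N;
  stk_a : forall l, (l < m)%N -> a l = ca (I l) + a2 (J l);
  stk_b : forall l, (l < m)%N -> b l = b1 (I l) * b2 (J l);
  stk_t : forall l, (l < m)%N -> t2 (J l) <= b1 (I l) * t l;
  stk_size : forall l, (l < m)%N -> (l <= I l + J l)%N;
  stk_pos : (0 < i)%N -> (0 < m)%N;
  stk_last : (0 < i)%N -> 0 < b1 i.-1 -> b m.-1 = b1 i.-1 * b2 k2.-1;
  stk_cover : forall i' j y, (i' < i)%N -> (j < k2)%N -> 0 <= y ->
    exists2 l, (l < m)%N & cell i' j y <= a l + b l * y }.

Section Row.
Variables (M i : nat) (t a b : nat -> R) (I J : nat -> nat).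
Hypothesis S : stack M i t a b I J.
Hypothesis ik : (i < k1)%N.
Let C := stk_chain S.

(** A line is active only from its own start on, so below [t m] the lines from [m] on are
    dispensable. *)
Lemma cover_below m th i' j' y : ((m < M)%N -> th <= t m) ->
  (i' < i)%N -> (j' < k2)%N -> 0 <= y < th ->
  exists2 l, (l < m)%N & cell i' j' y <= a l + b l * y.
Proof.
move=> thm ii jk /andP[y0 yth].
have [l lM h] := stk_cover S ii jk y0.
have M0 : (0 < M)%N by exact: leq_ltn_trans lM.
have [|q [/andP[_ qM] tq tq']] := chain_locate C M0 (y := y); first by rewrite (chain_t0 C).
have [qm|mq] := ltnP q m.
  exists q => //; apply: le_trans h _.
  exact: chain_active C qM lM tq (fun h => ltW (tq' h)).
exfalso; have h1 := thm (leq_ltn_trans mq qM).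
have : t m <= t q by apply: chain_tle C _; rewrite mq.
lra.
Qed.

(* Row [i] overtakes the envelope at [th], entering with column [j], and the
   first [m] lines of the envelope survive. *)
Record push_ok m j (th : R) : Prop := PushOk {
  po_m : (m <= M)%N;
  po_j : (j < k2)%N;
  po_th0 : m = 0%N -> th = 0;
  po_t : (0 < m)%N -> t m.-1 <= th;
  po_cross : (0 < m)%N -> a m.-1 + b m.-1 * th = cell i j th;
  po_slope : (0 < m)%N -> b m.-1 < b1 i * b2 j;
  po_lo : t2 j <= b1 i * th;
  po_hi : (j.+1 < k2)%N -> b1 i * th <= t2 j.+1;
  po_size : (m <= i + j)%N;
  po_next : (m < M)%N -> th <= t m;
  po_dom : dominates i th;
  po_below : forall y j', 0 <= y < th -> (j' < k2)%N ->
     exists2 l, (l < m)%N & cell i j' y <= a l + b l * y }.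

Lemma push_ok_first : i = 0%N -> M = 0%N -> (0 < k2)%N -> push_ok 0 0 0.
Proof.
move=> i0 M0 k20; split; rewrite ?M0 ?mulr0 //.
- by rewrite (chain_t0 C2).
- by move=> h; apply: chain_t_ge0 C2 h.
- by rewrite i0 => i' j.
- by move=> y j' /andP[h1 h2]; have := le_lt_trans h1 h2; rewrite ltxx.
Qed.

Section Push.
Variables (m j : nat) (th : R).
Hypothesis P : push_ok m j th.

Lemma po_th_ge0 : 0 <= th.
Proof.
case: (posnP m) => [/(po_th0 P)->//|m0].
apply: le_trans (po_t P m0); apply: chain_t_ge0 C _.
by have := po_m P; lia.
Qed.

Lemma po_below_rows i' j' y : (i' < i)%N -> (j' < k2)%N -> 0 <= y < th ->
  exists2 l, (l < m)%N & cell i' j' y <= a l + b l * y.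
Proof. by apply: cover_below; apply: po_next P. Qed.

Variables (t' a' b' : nat -> R) (I' J' : nat -> nat).
Hypothesis old : forall l, (l < m)%N ->
  [/\ t' l = t l, a' l = a l, b' l = b l, I' l = I l & J' l = J l].
Hypothesis first : t' m = th.

Definition pushed r := [/\ a' (m + r)%N = ca i + a2 (j + r)%N, b' (m + r)%N = b1 i * b2 (j + r)%N,
   I' (m + r)%N = i & J' (m + r)%N = (j + r)%N].

(** With slope 0 all cells of the row are constant, and the largest is column 0, which is active at
    [y = 0] in the second chain. Later rows have positive slope, so this concerns row 0 alone. *)
Lemma stack_push_flat : b1 i = 0 -> m = 0%N -> i = 0%N -> j = 0%N -> pushed 0 -> stack 1 i.+1 t' a' b' I' J'.
Proof.
move=> bi m0 i0 j0 [ea eb eI eJ].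
move: ea eb eI eJ first; rewrite m0 j0 => ea eb eI eJ e.
have th0 := po_th0 P m0.
have k20 : (0 < k2)%N := leq_ltn_trans (leq0n j) (po_j P).
have z l : (l < 1)%N -> l = 0%N by case: l.
split.
- split => //; [by rewrite e th0|by rewrite eb bi mul0r].
- by move=> l /z->; rewrite eI.
- by move=> l /z->; rewrite eJ.
- by move=> l /z->; rewrite eI eJ ea.
- by move=> l /z->; rewrite eI eJ eb.
- by move=> l /z->; rewrite eI eJ e bi mul0r (chain_t0 C2).
- by move=> l /z->.
- by [].
- by move=> _ /=; rewrite bi ltxx.
move=> i' q y; rewrite i0 ltnS leqn0 => /eqP-> qk y0.
have bi' : b1 0 = 0 by rewrite -bi i0.
exists 0%N => //; rewrite /cell ea eb bi' bi i0 !mul0r !addr0 lerD2l.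
have := chain_active C2 k20 qk (y := 0); rewrite !mulr0 !addr0; apply; first by rewrite (chain_t0 C2).
by move=> h; apply: chain_t_ge0 C2 h.
Qed.

(** To the right of [th] row [i] beats every earlier row, and its own envelope there is the second
    chain from column [j] on, with breakpoints divided by [b1 i]. To the left the first [m] old
    lines suffice. *)
Lemma stack_push : 0 < b1 i ->
  (forall r, (r < k2 - j)%N -> pushed r) ->
  (forall r, (0 < r < k2 - j)%N -> t' (m + r)%N = t2 (j + r)%N / b1 i) ->
  stack (m + (k2 - j)) i.+1 t' a' b' I' J'.
Proof.
move=> bi new newt.
have jk := po_j P.
have mM := po_m P.
have old_or l : (l < m + (k2 - j))%N ->
   (l < m)%N \/ exists2 r, (r < k2 - j)%N & l = (m + r)%N.
  by have [h|h] := ltnP l m; [left|right; exists (l - m)%N; lia].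
have tn r : (r < k2 - j)%N -> t2 (j + r)%N <= b1 i * t' (m + r)%N.
  case: r => [_|r h]; first by rewrite !addn0 first; exact: po_lo P.
  by rewrite newt // mulrC divfK // gt_eqF.
have CH : chain (m + (k2 - j)) t' a' b'.
  have e0 : (m == 0)%N -> [/\ t' 0%N = 0 & b' 0%N = b1 i * b2 j].
    move/eqP=> m0; split.
      by move: first; rewrite m0 (po_th0 P m0).
    by have [|_ + _ _] := new 0%N; rewrite ?m0 ?addn0 //; lia.
  split.
  - move=> _; have [/eqP/e0[]//|m0] := posnP m.
    by have [-> _ _ _ _] := old m0; apply: chain_t0 C _; lia.
  - move=> _; have [/eqP/e0[_ ->]|m0] := posnP m.
      by apply: mulr_ge0; [exact: ltW|exact: chain_b_ge0 C2 jk].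
    by have [_ _ -> _ _] := old m0; apply: chain_b0 C _; lia.
  - move=> l lk; have [h|h] := ltnP l.+1 m.
      have [-> _ _ _ _] := old h; have [-> _ _ _ _] := old (ltnW h).
      by apply: (chain_tS C); lia.
    have [h'|h'] := leqP m l; last first.
      have E : m = l.+1 by lia.
      have [-> _ _ _ _] := old h'; rewrite -E first.
      by have := po_t P; rewrite E /=; apply.
    have [r er] : exists r, l = (m + r)%N by exists (l - m)%N; lia.
    rewrite er -addnS (newt r.+1); last lia.
    rewrite ler_pdivlMr // mulrC.
    case: r er => [|r] er.
      by rewrite addn0 first addn1; apply: po_hi P _; lia.
    rewrite newt; last lia.
    rewrite mulrC divfK ?gt_eqF // !addnS; apply: (chain_tS C2); lia.
  - move=> l lk; have [h|h] := ltnP l.+1 m.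
      have [_ _ -> _ _] := old h; have [_ _ -> _ _] := old (ltnW h).
      by apply: (chain_bS C); lia.
    have [h'|h'] := leqP m l; last first.
      have E : m = l.+1 by lia.
      have [_ _ -> _ _] := old h'.
      have [|_ + _ _] := new 0%N; first lia.
      rewrite addn0 -E => ->; rewrite addn0.
      by have := po_slope P; rewrite E /=; apply.
    have [r er] : exists r, l = (m + r)%N by exists (l - m)%N; lia.
    rewrite er -addnS.
    have [|_ -> _ _] := new r.+1; first lia.
    have [|_ -> _ _] := new r; first lia.
    rewrite ltr_pM2l // addnS; apply: (chain_bS C2); lia.
  - move=> l lk; have [h|h] := ltnP l.+1 m.
      have [-> -> -> _ _] := old h; have [_ -> -> _ _] := old (ltnW h).
      by apply: (chain_cross C); lia.
    have [h'|h'] := leqP m l; last first.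
      have E : m = l.+1 by lia.
      have [_ -> -> _ _] := old h'.
      have [|+ + _ _] := new 0%N; first lia.
      rewrite addn0 -E => -> ->; rewrite first addn0.
      by have := po_cross P; rewrite E /=; apply.
    have [r er] : exists r, l = (m + r)%N by exists (l - m)%N; lia.
    rewrite er -addnS (newt r.+1); last lia.
    have [|-> -> _ _] := new r.+1; first lia.
    have [|-> -> _ _] := new r; first lia.
    have := chain_cross C2 (l := (j + r)%N); rewrite -addnS => /(_ ltac:(lia)) cr.
    have e q : b1 i * b2 q * (t2 (j + r.+1)%N / b1 i) = b2 q * t2 (j + r.+1)%N.
      by field; rewrite gt_eqF.
    by rewrite !e -!addrA cr.
split => //.
- move=> l /old_or[h|[r h ->]]; first by have [_ _ _ -> _] := old h; rewrite ltnS ltnW // (stk_I S) //; lia.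
  by have [_ _ -> _] := new _ h.
- move=> l /old_or[h|[r h ->]]; first by have [_ _ _ _ ->] := old h; rewrite (stk_J S) //; lia.
  have [_ _ _ ->] := new _ h; lia.
- move=> l /old_or[h|[r h ->]]; first by have [_ -> _ -> ->] := old h; rewrite (stk_a S) //; lia.
  by have [-> _ -> ->] := new _ h.
- move=> l /old_or[h|[r h ->]]; first by have [_ _ -> -> ->] := old h; rewrite (stk_b S) //; lia.
  by have [_ -> -> ->] := new _ h.
- move=> l /old_or[h|[r h ->]]; first by have [-> _ _ -> ->] := old h; rewrite (stk_t S) //; lia.
  by have [_ _ -> ->] := new _ h; apply: tn.
- move=> l /old_or[h|[r h ->]]; first by have [_ _ _ -> ->] := old h; rewrite (stk_size S) //; lia.
  have [_ _ -> ->] := new _ h; have := po_size P; lia.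
- by move=> _; lia.
- move=> _ _ /=; have [|_ + _ _] := new (k2 - j).-1; first lia.
  have -> : (j + (k2 - j).-1 = k2.-1)%N by lia.
  by have -> : ((m + (k2 - j)).-1 = m + (k2 - j).-1)%N by lia.
have th_ge0 := po_th_ge0.
have low y : 0 <= y < th -> forall i' j', (i' < i.+1)%N -> (j' < k2)%N ->
    exists2 l, (l < m)%N & cell i' j' y <= a l + b l * y.
  move=> yth i' j'; rewrite ltnS leq_eqVlt => /orP[/eqP->|ii] jk'.
    exact: po_below P _ _ yth jk'.
  exact: po_below_rows.
have high y : th <= y -> forall j', (j' < k2)%N ->
    exists2 r, (r < k2 - j)%N & cell i j' y <= cell i (j + r)%N y.
  move=> thy j' jk'.
  have [|l [/andP[jl lk] tl tl']] := chain_locate C2 jk (y := b1 i * y).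
    by apply: le_trans (po_lo P) _; rewrite ler_pM2l.
  exists (l - j)%N; first lia.
  rewrite subnKC //.
  have := chain_active C2 lk jk' tl (fun h => ltW (tl' h)); rewrite /cell; lra.
move=> i' j' y ii jk' y0; have [yth|thy] := ltP y th.
  have [|l lm h] := low y _ i' j' ii jk'; first by rewrite y0.
  exists l; first lia.
  by have [_ -> -> _ _] := old lm.
have [j1 jk1 h1] : exists2 j1, (j1 < k2)%N & cell i' j' y <= cell i j1 y.
  move: ii; rewrite ltnS leq_eqVlt => /orP[/eqP->|ii]; first by exists j'.
  (* Domination at the crossing extends to all larger [y], so a cell of an earlier row may be
     replaced by one of row [i]. *)
  have D : dominates i y by apply: dominates_up ik _ (po_dom P); rewrite th_ge0.
  exact: D.
have [r rk h2] := high y thy j1 jk1.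
exists (m + r)%N; first lia.
have [-> -> _ _] := new _ rk.
exact: le_trans h1 h2.
Qed.

End Push.

(** * Sweeping downwards for the crossing of a row with the stack *)

Hypothesis i0 : (0 < i)%N.

Lemma row_slope_gt0 : 0 < b1 i.
Proof. by apply: le_lt_trans (@b1_lt 0 i _); [apply: b1_ge0; lia|rewrite i0]. Qed.
Let bi := row_slope_gt0.

(* Invariant of the sweep from [y] = infinity downwards that looks for the
   crossing: row [i] is above the envelope at every breakpoint passed so far,
   the envelope being at its line [m.-1] and the row at column [j]. *)
Record scan m j : Prop := Scan {
  sc_m : (0 < m <= M)%N;
  sc_j : (j < k2)%N;
  sc_m_dom : (m < M)%N -> dominates i (t m);
  sc_m_t : (m < M)%N -> t2 j <= t m * b1 i;
  sc_j_dom : (j.+1 < k2)%N -> dominates i (t2 j.+1 / b1 i);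
  sc_j_t : (j.+1 < k2)%N -> t m.-1 * b1 i <= t2 j.+1 }.

Lemma scan_init : (0 < k2)%N -> scan M k2.-1.
Proof.
move=> k20; have := stk_pos S i0 => M0.
by split; rewrite ?leqnn ?ltnn ?M0 ?prednK ?ltnn //.
Qed.

(** The next point met by the downward sweep, namely the larger of the starts of the stack line and
    of the column; on the interval above it both are active. *)
Definition event m j := if t2 j <= t m.-1 * b1 i then t m.-1 else t2 j / b1 i.

Lemma event_bounds m j : scan m j ->
  [/\ t m.-1 <= event m j, t2 j <= event m j * b1 i,
   (m < M)%N -> event m j <= t m & (j.+1 < k2)%N -> event m j * b1 i <= t2 j.+1].
Proof.
case=> /andP[m0 mM] jk _ mt _ jt; rewrite /event; case: ifPn => h; split => //.
- by move=> lt; have := chain_tS C (l := m.-1); rewrite prednK //; apply.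
- by move: h; rewrite -ltNge => /ltW; rewrite ler_pdivlMr.
- by rewrite divfK ?gt_eqF.
- by move=> lt; rewrite ler_pdivrMr // mt.
- by move=> lt; rewrite divfK ?gt_eqF //; apply: (chain_tS C2).
Qed.

Lemma event_ge0 m j : scan m j -> 0 <= event m j.
Proof.
move=> s; have [h _ _ _] := event_bounds s; apply: le_trans h; apply: chain_t_ge0 C _.
have := sc_m s; lia.
Qed.

Lemma stack_active m y : (0 < m <= M)%N -> t m.-1 <= y -> ((m < M)%N -> y <= t m) ->
  forall i' j', (i' < i)%N -> (j' < k2)%N -> cell i' j' y <= a m.-1 + b m.-1 * y.
Proof.
move=> /andP[m0 mM] ty yt i' j' ii jk.
have mM1 : (m.-1 < M)%N by rewrite prednK.
have [|l lM h] := stk_cover S ii jk (y := y).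
  by apply: le_trans ty; apply: chain_t_ge0 C _.
apply: le_trans h _; apply: chain_active C mM1 lM ty _.
by rewrite prednK.
Qed.

Lemma row_active j y : (j < k2)%N -> t2 j <= y * b1 i -> ((j.+1 < k2)%N -> y * b1 i <= t2 j.+1) ->
  forall j', (j' < k2)%N -> cell i j' y <= cell i j y.
Proof.
move=> jk h1 h2 j' jk'; have := chain_active C2 jk jk' h1 h2; rewrite /cell; lra.
Qed.

(** Both current lines are active at the event, so comparing these two decides about all cells of
    earlier rows. *)
Lemma event_dom m j : scan m j ->
  a m.-1 + b m.-1 * event m j <= cell i j (event m j) -> dominates i (event m j).
Proof.
move=> s h i' j' ii jk'; exists j; first exact: sc_j s.
have [h1 h2 h3 h4] := event_bounds s.
by apply: le_trans (stack_active (sc_m s) h1 h3 ii jk') h.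
Qed.

Lemma scan_pop m j : scan m j -> t2 j <= t m.-1 * b1 i ->
  a m.-1 + b m.-1 * event m j <= cell i j (event m j) -> (1 < m)%N -> scan m.-1 j.
Proof.
move=> s h hc m1; have D := event_dom s hc; move: D; rewrite /event h => D.
case: s => mM jk _ _ jd jt; split => //.
- by lia.
- move=> lt; apply: le_trans (jt lt); rewrite ler_pM2r //.
  have := chain_tS C (l := m.-2); rewrite prednK; last lia.
  by apply; lia.
Qed.

(** The last line starts at 0, so the row wins on the whole half-line and the old stack vanishes. *)
Lemma scan_pop_last j : scan 1 j -> t2 j <= t 0 * b1 i ->
  a 0 + b 0 * event 1 j <= cell i j (event 1 j) -> push_ok 0 j 0.
Proof.
move=> s h hc; have D := event_dom s hc; move: D; rewrite /event h => D.
have M0 : (0 < M)%N by case/andP: (sc_m s).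
have t0 := chain_t0 C M0.
case: s => mM jk _ _ jd jt; split => //.
- by move: h; rewrite t0 mul0r mulr0.
- by move=> h1; rewrite mulr0; apply: chain_t_ge0 C2 h1.
- by rewrite t0.
- by rewrite -t0.
- by move=> y j' /andP[y0 y1]; have := le_lt_trans y0 y1; rewrite ltxx.
Qed.

(** Column 0 starts at 0 and cannot start strictly after a stack line, hence there is a column to
    step back to. *)
Lemma scan_dec m j : scan m j -> ~~ (t2 j <= t m.-1 * b1 i) ->
  a m.-1 + b m.-1 * event m j <= cell i j (event m j) -> (0 < j)%N /\ scan m j.-1.
Proof.
move=> s h hc; have D := event_dom s hc; move: D; rewrite /event (negbTE h) => D.
have M0 := sc_m s.
have tm : 0 <= t m.-1 by apply: chain_t_ge0 C _; lia.
have j0 : (0 < j)%N.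
  rewrite lt0n; apply: contra h => /eqP->; rewrite (chain_t0 C2) ?mulr_ge0 // ?ltW //.
  exact: leq_ltn_trans (sc_j s).
split => //; case: s => mM jk md mt jd jt; split => //.
- lia.
- move=> lt; apply: le_trans (mt lt).
  have := chain_tS C2 (l := j.-1); rewrite prednK //; apply; exact: jk.
- by rewrite prednK.
- by rewrite prednK // => _; move: h; rewrite -ltNge => /ltW.
Qed.

Definition crossing m j := (a m.-1 - (ca i + a2 j)) / (b1 i * b2 j - b m.-1).

(** At the event the row is strictly below the stack, at the upper end of the current interval it is
    not; both are straight in between, so they cross there, the row being steeper. On an unbounded
    interval the slopes have to be compared directly. *)
Lemma scan_stop m j : scan m j ->
  ~~ (a m.-1 + b m.-1 * event m j <= cell i j (event m j)) ->
  push_ok m j (crossing m j).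
Proof.
move=> s; rewrite -ltNge => hc.
have [h1 h2 h3 h4] := event_bounds s; have z0 := event_ge0 s.
have /andP[m0 mM] := sc_m s; have jk := sc_j s.
have mM1 : (m.-1 < M)%N by rewrite prednK.
have I1 := stk_I S mM1; have J1 := stk_J S mM1.
set th := crossing m j; set z := event m j in hc h1 h2 h3 h4 z0.
have at_pt u : z <= u -> ((m < M)%N -> u <= t m) -> ((j.+1 < k2)%N -> u * b1 i <= t2 j.+1) ->
    dominates i u -> a m.-1 + b m.-1 * u <= cell i j u.
  move=> zu u1 u2 D.
  have [j' jk' h] := D _ _ I1 J1.
  have -> : a m.-1 + b m.-1 * u = cell (I m.-1) (J m.-1) u.
    by rewrite (stk_a S mM1) (stk_b S mM1).
  apply: le_trans h _; apply: row_active => //.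
  by apply: le_trans h2 _; rewrite ler_pM2r.
have sl_of u : z <= u -> a m.-1 + b m.-1 * u <= cell i j u -> b m.-1 < b1 i * b2 j.
  move=> zu; rewrite /cell in hc *; move=> hu; rewrite ltNge; apply/negP => hb.
  have : (b1 i * b2 j) * (u - z) <= b m.-1 * (u - z) by rewrite ler_wpM2r // subr_ge0.
  lra.
have limit : (exists u, [/\ z <= u, (m < M)%N -> u <= t m,
      (j.+1 < k2)%N -> u * b1 i <= t2 j.+1 & dominates i u]) \/
    ((M <= m)%N /\ (k2 <= j.+1)%N).
  have [lt1|ge1] := ltnP m M; have [lt2|ge2] := ltnP j.+1 k2; last by right.
  - left; have [h|h] := leP (t m * b1 i) (t2 j.+1).
      by exists (t m); split => //; [apply: h3|apply: sc_m_dom s lt1].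
    exists (t2 j.+1 / b1 i); split => //.
    + by rewrite ler_pdivlMr // h4.
    + by move=> _; rewrite ler_pdivrMr // ltW.
    + by rewrite divfK ?gt_eqF.
    + exact: sc_j_dom s lt2.
  - by left; exists (t m); split => //; [apply: h3|apply: sc_m_dom s lt1].
  left; exists (t2 j.+1 / b1 i); split => //.
  + by rewrite ler_pdivlMr // h4.
  + by rewrite divfK ?gt_eqF.
  + exact: sc_j_dom s lt2.
have slope : b m.-1 < b1 i * b2 j.
  case: limit => [[u [zu u1 u2 D]]|[ge1 ge2]].
    exact: sl_of (at_pt u zu u1 u2 D).
  (* Without an upper end, [j] is the last column, whose slope is positive and maximal, and row [i]
     is steeper than the row of the stack line. *)
  rewrite (stk_b S mM1).
  have bj : b2 (J m.-1) <= b2 j by apply: chain_ble C2 _; rewrite jk andbT; clear -J1 ge2; lia.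
  have bI : b1 (I m.-1) < b1 i by apply: b1_lt; rewrite I1.
  have bI0 : 0 <= b1 (I m.-1) by apply: b1_ge0; apply: ltn_trans ik.
  have bp : 0 < b2 j by have -> : j = k2.-1 by clear -jk ge2; lia.
  apply: le_lt_trans (_ : b1 (I m.-1) * b2 j < _); first by rewrite ler_wpM2l.
  by rewrite ltr_pM2r.
have thE : a m.-1 + b m.-1 * th = cell i j th.
  by rewrite /cell /th /crossing; field; lra.
have zth : z < th.
  have : 0 < (b1 i * b2 j - b m.-1) * (th - z).
    by move: thE hc; rewrite /cell; lra.
  by rewrite pmulr_rgt0 subr_gt0.
have th_le u : cell i j u >= a m.-1 + b m.-1 * u -> th <= u.
  move=> hu.
  have : 0 <= (b1 i * b2 j - b m.-1) * (u - th).
    by move: thE hu; rewrite /cell; lra.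
  by rewrite pmulr_rge0 ?subr_gt0 ?subr_ge0.
have thm : (m < M)%N -> th <= t m.
  case: limit => [[u [zu u1 u2 D]]|[ge1 _]]; last by rewrite ltnNge ge1.
  by move=> lt1; apply: le_trans (u1 lt1); apply: th_le; apply: at_pt.
have thj : (j.+1 < k2)%N -> th * b1 i <= t2 j.+1.
  case: limit => [[u [zu u1 u2 D]]|[_ ge2]]; last by rewrite ltnNge ge2.
  move=> lt1; apply: le_trans (u2 lt1); rewrite ler_pM2r //.
  by apply: th_le; apply: at_pt.
have thlo : t2 j <= th * b1 i by apply: le_trans h2 _; rewrite ler_pM2r // ltW.
have tth : t m.-1 <= th by apply: le_trans h1 (ltW zth).
(* The staircase: were the column of the stack line beyond [j], it would already have started in its
   flatter row at [t m.-1], so column [j.+1] would start in row [i] strictly before [th], against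
   [thj]. *)
have Jj : (J m.-1 <= j)%N.
  rewrite leqNgt; apply/negP => lt.
  have lt2 : (j.+1 < k2)%N by apply: leq_ltn_trans J1.
  have e1 := thj lt2.
  have e2 : t2 j.+1 <= t2 (J m.-1) by apply: chain_tle C2 _; rewrite lt J1.
  have e3 := stk_t S mM1.
  have e4 : b1 (I m.-1) * t m.-1 <= b1 i * t m.-1.
    apply: ler_wpM2r; first exact: chain_t_ge0 C mM1.
    by apply: ltW; apply: b1_lt; rewrite I1.
  have e5 : b1 i * t m.-1 < b1 i * th by rewrite ltr_pM2l //; apply: le_lt_trans zth.
  lra.
split => //.
- by move=> e; rewrite e in m0.
- by rewrite mulrC.
- by rewrite mulrC.
- have := stk_size S mM1; clear -Jj I1 m0; lia.
- move=> i' j' ii jk'; exists j => //; rewrite -thE.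
  exact: stack_active (sc_m s) tth thm _ _ ii jk'.
move=> y j' /andP[y0 yth] jk'.
(* The cell of line [m.-1] equals the row at [th], so the exchange inequality bounds the row at [y]
   by another cell of that older row. *)
have [x [x' [xk xk' h]]] := row_cross (i' := I m.-1) (introT andP (conj I1 ik)) jk' J1
   (introT andP (conj y0 (ltW yth))).
have [|l lm hl] := cover_below thm I1 xk' (y := y); first by rewrite y0.
exists l => //; apply: le_trans hl.
have := row_active jk thlo thj xk.
have : cell (I m.-1) (J m.-1) th = cell i j th.
  by rewrite -thE (stk_a S mM1) (stk_b S mM1).
lra.
Qed.

End Row.
End Stack.

(** * Rooted trees *)

Section Tree.
Variables (n : nat) (par : 'I_n.+1 -> 'I_n.+1).
Hypothesis tree : is_rooted_tree par.
Implicit Types (s u v c : 'I_n.+1).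

Lemma iter_par0 k : iter k par ord0 = ord0.
Proof. by elim: k => //= k ->; case: tree. Qed.

Lemma root_reached v : exists k, iter k par v == ord0.
Proof. by exists n; apply/eqP; case: tree. Qed.

Definition depth v := ex_minn (root_reached v).

Lemma iter_depth v : iter (depth v) par v = ord0.
Proof. by rewrite /depth; case: ex_minnP => k /eqP. Qed.

Lemma depth_min v k : iter k par v = ord0 -> (depth v <= k)%N.
Proof. by rewrite /depth; case: ex_minnP => d _ h e; apply: h; rewrite e. Qed.

Lemma depth_le v : (depth v <= n)%N.
Proof. by apply: depth_min; case: tree. Qed.

Lemma iter_ge_depth v k : (depth v <= k)%N -> iter k par v = ord0.
Proof. by move=> h; rewrite -(subnK h) iterD iter_depth iter_par0. Qed.

Lemma depth_iter k v : depth (iter k par v) = (depth v - k)%N.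
Proof.
have [h|h] := leqP (depth v) k.
  rewrite iter_ge_depth // (eqP (h : depth v - k == 0)%N).
  by apply/eqP; rewrite -leqn0; apply: depth_min.
apply/eqP; rewrite eqn_leq; apply/andP; split.
  by apply: depth_min; rewrite -iterD subnK ?iter_depth // ltnW.
rewrite leq_subLR; apply: depth_min.
by rewrite addnC iterD iter_depth.
Qed.

Lemma depth_gt0 v : (0 < depth v)%N = (v != ord0).
Proof.
apply/idP/idP => [|h].
  by apply: contraTneq => ->; rewrite -leqNgt; apply: depth_min.
rewrite lt0n; apply: contra h => /eqP e.
by have := iter_depth v; rewrite e /= => ->.
Qed.

Lemma depth_par v : depth (par v) = (depth v).-1.
Proof. by rewrite (depth_iter 1) subn1. Qed.

(** The bound on the number of parent steps in [anc] is harmless: from step [n] on every walk is at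
    the root. *)
Lemma ancP v u : reflect (exists k, iter k par v = u) (anc par v u).
Proof.
apply: (iffP existsP) => [[k /eqP h]|[k h]]; first by exists k.
have [hk|hk] := ltnP k n.+1; first by exists (Ordinal hk); rewrite /= h.
exists ord_max; rewrite /= -h (iter_ge_depth (k := k)) ?(iter_ge_depth (k := n)) ?depth_le //.
by apply: leq_trans (depth_le v) (ltnW hk).
Qed.

Lemma anc_iter v u : anc par v u -> iter (depth v - depth u) par v = u.
Proof.
move/ancP => [k <-]; rewrite depth_iter.
have [h|h] := leqP (depth v) k; last by rewrite subKn // ltnW.
by rewrite (eqP (h : depth v - k == 0)%N) subn0 iter_depth iter_ge_depth.
Qed.

Lemma anc_refl v : anc par v v.
Proof. by apply/ancP; exists 0%N. Qed.

Lemma anc_trans v u s : anc par v u -> anc par u s -> anc par v s.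
Proof.
move=> /ancP[k <-] /ancP[l <-]; apply/ancP; exists (l + k)%N; exact: iterD.
Qed.

Lemma anc_par v : anc par v (par v).
Proof. by apply/ancP; exists 1%N. Qed.

Lemma anc_depth v u : anc par v u -> (depth u <= depth v)%N.
Proof. by move=> /ancP[k <-]; rewrite depth_iter leq_subr. Qed.

Lemma anc_cmp s u v : anc par s u -> anc par s v -> (depth u <= depth v)%N -> anc par v u.
Proof.
move=> su sv d; have dv := anc_depth sv; apply/ancP; exists (depth v - depth u)%N.
have [k ek] : exists k, k = (depth v - depth u)%N by exists (depth v - depth u)%N.
rewrite -ek -(anc_iter sv) -iterD.
have -> : (k + (depth s - depth v) = depth s - depth u)%N by lia.
exact: anc_iter.
Qed.

Lemma anc_eq s u v : anc par s u -> anc par s v -> depth u = depth v -> u = v.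
Proof. by move=> /anc_iter su /anc_iter sv e; rewrite -su e sv. Qed.

Lemma anc_strict v u : anc par v u -> v != u -> anc par (par v) u.
Proof.
move=> /ancP[[|k] <-]; first by rewrite eqxx.
by move=> _; apply/ancP; exists k; rewrite iterSr.
Qed.

Definition subtree c : {set 'I_n.+1} := [set s | anc par s c].

(* The nodes represented at [v] once the nodes in [Mg] have been merged into
   their parents, children always before parents. *)
Definition blob (Mg : {set 'I_n.+1}) v : {set 'I_n.+1} :=
  [set s | (s == v) || [exists c in Mg, (par c == v) && anc par s c]].

Lemma blobP (Mg : {set 'I_n.+1}) v s :
  reflect (s = v \/ exists c, [/\ c \in Mg, par c = v & anc par s c]) (s \in blob Mg v).
Proof.
rewrite inE; apply: (iffP orP) => [[/eqP|/existsP[c /and3P[h1 /eqP h2 h3]]]|[->|[c [h1 h2 h3]]]].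
- by left.
- by right; exists c.
- by left.
- by right; apply/existsP; exists c; rewrite h1 h2 eqxx.
Qed.

Lemma blob_anc Mg v s : s \in blob Mg v -> anc par s v.
Proof.
by move=> /blobP[->|[c [_ <- h]]]; [apply: anc_refl|apply: anc_trans h (anc_par _)].
Qed.

Lemma blob_set0 v : blob set0 v = [set v].
Proof.
apply/setP => s; rewrite in_set1; apply/blobP/eqP => [[//|[c []]]|->]; last by left.
by rewrite in_set0.
Qed.

Lemma blob_full : blob [set~ ord0] ord0 = setT.
Proof.
apply/setP => s; rewrite in_setT; apply/blobP.
have [->|s0] := eqVneq s ord0; first by left.
right; have ds : (0 < depth s)%N by rewrite depth_gt0.
exists (iter (depth s).-1 par s); split.
- rewrite !inE -depth_gt0 depth_iter; lia.
- by rewrite -iterS prednK // iter_depth.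
- by apply/ancP; exists (depth s).-1.
Qed.

Section Merge.
Variables (Mg : {set 'I_n.+1}) (c : 'I_n.+1).
Hypotheses (Mg0 : ord0 \notin Mg) (cMg : c \notin Mg) (c0 : c != ord0)
  (children : forall u, u != ord0 -> par u = c -> u \in Mg).

Lemma blob_subtree : blob Mg c = subtree c.
Proof.
apply/setP => s; rewrite [in RHS]inE; apply/idP/idP => [|h]; first exact: blob_anc.
apply/blobP; have [->|sc] := eqVneq s c; first by left.
right; have d : (depth c < depth s)%N.
  rewrite ltn_neqAle (anc_depth h) andbT; apply: contra sc => /eqP e.
  by rewrite (anc_eq (anc_refl s) h).
pose x := iter (depth s - depth c).-1 par s.
have px : par x = c by rewrite /x -iterS prednK ?subn_gt0 // anc_iter.
exists x; split => //; last by apply/ancP; exists (depth s - depth c).-1.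
by apply: children => //; rewrite -depth_gt0 depth_iter; lia.
Qed.

Lemma blob_merge : blob (c |: Mg) (par c) = subtree c :|: blob Mg (par c).
Proof.
apply/setP => s; rewrite in_setU (_ : (s \in subtree c) = anc par s c); last by rewrite inE.
apply/blobP/orP.
  case=> [->|[u [+ e h]]]; first by right; apply/blobP; left.
  rewrite in_setU1 => /orP[/eqP<-|uM]; first by left.
  by right; apply/blobP; right; exists u.
case=> [h|/blobP[->|[u [h1 h2 h3]]]].
- by right; exists c; rewrite !inE eqxx.
- by left.
- by right; exists u; rewrite !inE h1 orbT.
Qed.

Lemma blob_other v : v != par c -> blob (c |: Mg) v = blob Mg v.
Proof.
move=> h; apply/setP => s; apply/blobP/blobP => -[->|[u [h1 h2 h3]]]; try by left.
  right; exists u; split => //; move: h1; rewrite !inE => /orP[/eqP e|//].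
  by rewrite -h2 e eqxx in h.
by right; exists u; rewrite !inE h1 orbT.
Qed.

Lemma nanc_par : ~~ anc par (par c) c.
Proof.
apply/negP => /anc_depth; rewrite depth_par.
have : (0 < depth c)%N by rewrite depth_gt0.
lia.
Qed.

(** A node [u] of the parent's part other than the parent hangs under a child merged before. That
    child and [c] have equal depth, so a common descendant would make them equal. *)
Lemma subtree_blob_disjoint u s : u \in blob Mg (par c) -> s \in subtree c ->
  u != par c -> ~~ anc par s u.
Proof.
move=> /blobP[->|[x [xM px ux]]]; first by rewrite eqxx.
rewrite inE => sc _; apply/negP => su.
have x0 : x != ord0 by apply: contraNneq Mg0 => <-.
suff e : x = c by move: cMg; rewrite -e xM.
apply: anc_eq (anc_trans su ux) sc _.
have := depth_par x; have := depth_par c; rewrite px.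
have : (0 < depth x)%N by rewrite depth_gt0.
have : (0 < depth c)%N by rewrite depth_gt0.
lia.
Qed.

Lemma blob_not_below s : s \in blob Mg (par c) -> ~~ anc par s c.
Proof.
have [->|h] := eqVneq s (par c); first by rewrite nanc_par.
move=> sB; apply/negP => sc.
have := subtree_blob_disjoint sB (s := s); rewrite inE sc anc_refl h.
by move=> /(_ isT isT).
Qed.

Lemma merge_disjoint : [disjoint subtree c & blob Mg (par c)].
Proof.
apply/pred0P => s; apply/negbTE; rewrite inE /= inE; apply/negP => /andP[h /blob_not_below].
by rewrite h.
Qed.

Lemma blob_parent_sub : blob Mg (par c) \subset subtree (par c) :\: subtree c.
Proof.
apply/subsetP => s h; rewrite !inE blob_not_below //; exact: blob_anc h.
Qed.

End Merge.

(* For fixed (x, y) at most one c lies on the path from x to the root with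
   y below the parent of c but not below c. *)
Lemma merge_pairs : (\sum_(c | c != ord0) #|subtree c| * #|subtree (par c) :\: subtree c|
  <= n.+1 ^ 2)%N.
Proof.
pose E c := setX (subtree c) (subtree (par c) :\: subtree c).
rewrite (eq_bigr (fun c => \sum_(xy : 'I_n.+1 * 'I_n.+1) (xy \in E c : nat))%N); last first.
  by move=> c _; rewrite -cardsX -sum1_card big_mkcond.
rewrite exchange_big /=.
apply: (@leq_trans (\sum_(xy : 'I_n.+1 * 'I_n.+1) 1)%N); last first.
  by rewrite sum1_card card_prod card_ord expnS expn1.
apply: leq_sum => -[x y] _.
(* Both candidates are ancestors of [x]. If they differ, the shallower one is an ancestor of the
   parent of the deeper one and hence of [y], which its own pair excludes. *)
have key c c' : c != ord0 -> c' != ord0 -> (x, y) \in E c -> (x, y) \in E c' ->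
    (depth c <= depth c')%N -> c = c'.
  move=> c0 c0'; rewrite !inE /= => /and3P[xc yc ypc] /and3P[xc' yc' ypc'] d.
  apply/eqP/negPn/negP => ne.
  have cc' := anc_cmp xc xc' d.
  have := anc_strict cc'; rewrite eq_sym ne => /(_ isT) h.
  by rewrite (anc_trans ypc' h) in yc.
have [/existsP[c /andP[c0 h]]|/existsPn none] := boolP [exists c, (c != ord0) && ((x, y) \in E c)].
  rewrite (bigD1 c) //= h big1 // => c' /andP[c0' ne].
  case: (boolP (_ \in _)) => // h'; exfalso; case/eqP: ne.
  have [d|d] := leqP (depth c) (depth c'); first by rewrite (key c c').
  by rewrite (key c' c) // ltnW.
rewrite big1 // => c c0; have := none c; rewrite c0 /=.
by case: (_ \in _).
Qed.

End Tree.

(** * Expected profit *)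

Lemma big_disjU (V : Type) (idx : V) (op : Monoid.com_law idx) (T : finType)
    (A B : {set T}) (F : T -> V) : [disjoint A & B] ->
  \big[op/idx]_(x in A :|: B) F x = op (\big[op/idx]_(x in A) F x) (\big[op/idx]_(x in B) F x).
Proof.
by move=> dAB; rewrite -bigU //; apply: eq_bigl => x; rewrite !inE.
Qed.

Section Value.
Variables (R : realType) (n : nat) (par : 'I_n.+1 -> 'I_n.+1) (w pi p : 'I_n.+1 -> R).
Implicit Types (S B D : {set 'I_n.+1}).
Hypothesis pi01 : forall v, 0 < pi v <= 1.
Hypothesis w0 : forall v, 0 <= w v.

Definition avoid S := \prod_(s in S) (1 - pi s).

(* Only the edges above the nodes of [D] are charged. *)
Definition value D S := \sum_(s in S) p s * pi s -
  \sum_(u in D) w u * (1 - avoid [set s in S | anc par s u]).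

Lemma avoid0 : avoid set0 = 1.
Proof. by rewrite /avoid big_set0. Qed.

Lemma avoid_ge0 S : 0 <= avoid S.
Proof. by apply: prodr_ge0 => s _; rewrite subr_ge0; case/andP: (pi01 s). Qed.

Lemma prob_miss A : \sum_(om : {set 'I_n.+1} | A :&: om == set0) prob_omega pi om = avoid A.
Proof.
rewrite /avoid (eq_bigl (fun om : {set 'I_n.+1} => om \subset ~: A)); last first.
  by move=> om; rewrite setI_eq0 disjoint_sym disjoints_subset.
(* When the product is expanded over the active sets, an active node of [A] contributes a factor 0;
   outside [A] the two summands add up to 1. *)
transitivity (\prod_v ((if v \in A then 0 else pi v) + (1 - pi v))); last first.
  rewrite (bigID (mem A)) /= [X in _ * X]big1 ?mulr1.
    by apply: eq_bigr => v ->; rewrite add0r.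
  by move=> v /negbTE->; rewrite addrC subrK.
rewrite bigA_distr [RHS](bigID (fun om : {set 'I_n.+1} => om \subset ~: A)) /= [X in _ + X]big1 ?addr0.
  apply: eq_bigr => om /subsetP sub; rewrite /prob_omega [RHS](bigID (mem om)) /=.
  congr (_ * _); last first.
    by apply: eq_big => v; rewrite ?inE // => /negbTE->.
  apply: eq_bigr => v vom; rewrite vom; have := sub v vom.
  by rewrite inE => /negbTE->.
move=> om /subsetPn[v vom]; rewrite inE negbK => vA.
by rewrite (bigD1 v) //= vom vA mul0r.
Qed.

Lemma prob_total : \sum_(om : {set 'I_n.+1}) prob_omega pi om = 1.
Proof. by have := prob_miss set0; rewrite avoid0 => <-; apply: eq_bigl => om; rewrite set0I eqxx. Qed.

(** Linearity of expectation: the edge above [u] is paid exactly when some chosen node below it is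
    active, which fails with probability [avoid]. *)
Lemma profit_value S : G par w pi p S 0 = value [set~ ord0] S.
Proof.
rewrite /G /value mul0r addr0; congr (_ - _).
rewrite /EW /Wt.
under eq_bigr do rewrite mulr_sumr big_mkcondr.
rewrite exchange_big /=; rewrite [RHS](eq_bigl (fun u => u != ord0)); last first.
  by move=> u; rewrite !inE.
apply: eq_bigr => u _; rewrite -big_mkcond -mulr_suml mulrC; congr (_ * _).
apply/eqP; rewrite eq_sym subr_eq -prob_total -prob_miss; apply/eqP.
rewrite [LHS](bigID (fun om : {set 'I_n.+1} => [exists q in S :&: om, anc par q u])) /=; congr (_ + _).
apply: eq_bigl => om; apply/existsPn/eqP => [h|h q].
  apply/setP => q; rewrite !inE; apply/negP => /andP[/andP[qS qu] qom].
  by have := h q; rewrite !inE qS qu qom.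
rewrite inE; apply/negP => /andP[/andP[qS qom] qu].
by have := in_set0 q; rewrite -h !inE qS qu qom.
Qed.

(* [y] stands for minus the bonus, so [oc_cover] says that for every
   nonpositive bonus some line is at least as good as every subset of [B]. *)
Record opt_chain B D k (t a b : nat -> R) (F : nat -> {set 'I_n.+1}) : Prop := OptChain {
  oc_chain : chain k t a b;
  oc_k : (0 < k <= #|B|.+1)%N;
  oc_last : 0 < b k.-1;
  oc_sub : forall l, (l < k)%N -> F l \subset B;
  oc_a : forall l, (l < k)%N -> a l = value D (F l);
  oc_b : forall l, (l < k)%N -> b l = avoid (F l);
  oc_cover : forall S y, S \subset B -> 0 <= y ->
    exists2 l, (l < k)%N & value D S + avoid S * y <= a l + b l * y }.

Lemma opt_chain_ext B D k t a b F t' a' b' : opt_chain B D k t a b F ->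
  (forall l, (l < k)%N -> [/\ t' l = t l, a' l = a l & b' l = b l]) ->
  opt_chain B D k t' a' b' F.
Proof.
case=> C /andP[k0 kB] last sub va vb cov E; have k1 : (k.-1 < k)%N by rewrite prednK.
split => //; first exact: chain_ext C E.
- by rewrite k0.
- by have [_ _ ->] := E _ k1.
- by move=> l lk; have [_ -> _] := E _ lk; apply: va.
- by move=> l lk; have [_ _ ->] := E _ lk; apply: vb.
move=> S y SB y0; have [l lk h] := cov S y SB y0; exists l => //.
by have [_ -> ->] := E _ lk.
Qed.

Lemma value_set0 D : value D set0 = 0.
Proof.
rewrite /value big_set0 sub0r big1 ?oppr0 // => u _.
rewrite (_ : [set s in _ | _] = set0) ?avoid0 ?subrr ?mulr0 //.
by apply/setP => s; rewrite !inE.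
Qed.

Lemma value_leaf v : value set0 [set v] = p v * pi v.
Proof. by rewrite /value big_set1 big_set0 subr0. Qed.

Lemma avoid_leaf v : avoid [set v] = 1 - pi v.
Proof. by rewrite /avoid big_set1. Qed.

(** Choosing [v] instead of nothing changes the rating by [pi v * (p v - y)], which is never
    positive here. *)
Lemma opt_chain_leaf1 v t a b F : p v <= 0 ->
  t 0%N = 0 -> a 0%N = 0 -> b 0%N = 1 -> F 0%N = set0 ->
  opt_chain [set v] set0 1 t a b F.
Proof.
move=> pv t0 a0 b0 F0; have z l : (l < 1)%N -> l = 0%N by case: l.
split => //=.
- by split => //; rewrite b0.
- by rewrite b0.
- by move=> l /z->; rewrite F0 sub0set.
- by move=> l /z->; rewrite F0 a0 value_set0.
- by move=> l /z->; rewrite F0 b0 avoid0.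
move=> S y; rewrite subset1 => /orP[]/eqP-> y0; exists 0%N => //; rewrite a0 b0.
  rewrite value_leaf avoid_leaf; case/andP: (pi01 v) => h1 h2; nra.
by rewrite value_set0 avoid0.
Qed.

(** The gain [pi v * (p v - y)] from choosing [v] changes sign at [y = p v], the only inner
    breakpoint. *)
Lemma opt_chain_leaf2 v t a b F : 0 < p v ->
  t 0%N = 0 -> a 0%N = p v * pi v -> b 0%N = 1 - pi v -> F 0%N = [set v] ->
  t 1%N = p v -> a 1%N = 0 -> b 1%N = 1 -> F 1%N = set0 ->
  opt_chain [set v] set0 2 t a b F.
Proof.
move=> pv t0 a0 b0 F0 t1 a1 b1 F1; have z l : (l < 2)%N -> l = 0%N \/ l = 1%N.
  by case: l => [|[|]] //; [left|right].
case/andP: (pi01 v) => h1 h2.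
split => //=.
- split => //; first by rewrite b0; lra.
  + by case=> //; rewrite t0 t1 ltW.
  + by case=> //; rewrite b0 b1; lra.
  + by case=> //; rewrite a0 b0 t1 a1 b1; lra.
- by rewrite cards1.
- by rewrite b1.
- by move=> l /z[]->; rewrite ?F0 ?F1 ?sub0set.
- by move=> l /z[]->; rewrite ?F0 ?F1 ?a0 ?a1 ?value_set0 ?value_leaf.
- by move=> l /z[]->; rewrite ?F0 ?F1 ?b0 ?b1 ?avoid0 ?avoid_leaf.
move=> S y; rewrite subset1 => /orP[]/eqP-> y0.
  by exists 0%N => //; rewrite a0 b0 value_leaf avoid_leaf.
by exists 1%N => //; rewrite a1 b1 value_set0 avoid0.
Qed.

(** * Envelope of a child and its parent together *)

Section Merge.
Variables (c : 'I_n.+1) (B1 D1 B2 D2 : {set 'I_n.+1}).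
Hypotheses (dB : [disjoint B1 & B2]) (dD : [disjoint D1 & D2])
  (cD1 : c \notin D1) (cD2 : c \notin D2)
  (n12 : forall s u, s \in B1 -> u \in D2 -> ~~ anc par s u)
  (n21 : forall s u, s \in B2 -> u \in c |: D1 -> ~~ anc par s u)
  (a1c : forall s, s \in B1 -> anc par s c).

Lemma avoidU S1 S2 : S1 \subset B1 -> S2 \subset B2 -> avoid (S1 :|: S2) = avoid S1 * avoid S2.
Proof.
move=> s1 s2; rewrite /avoid big_disjU //.
exact: disjointW s1 s2 dB.
Qed.

(** The edge above [c] is the only new charge; by [n12] and [n21] every other charge sees one of the
    two parts only. *)
Lemma valueU S1 S2 : S1 \subset B1 -> S2 \subset B2 ->
  value (c |: (D1 :|: D2)) (S1 :|: S2) =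
  value D1 S1 + w c * (avoid S1 - 1) + value D2 S2.
Proof.
move=> s1 s2; rewrite /value big_disjU /=; last exact: disjointW s1 s2 dB.
rewrite big_setU1 /=; last by rewrite inE negb_or cD1.
rewrite big_disjU //=.
have -> : [set s in S1 :|: S2 | anc par s c] = S1.
  apply/setP => s; rewrite !inE; apply/andP/idP => [[/orP[//|h] sc]|h].
    by have := n21 (subsetP s2 _ h) (setU11 c D1); rewrite sc.
  by rewrite h a1c // (subsetP s1).
have e1 u : u \in D1 -> [set s in S1 :|: S2 | anc par s u] = [set s in S1 | anc par s u].
  move=> uD; apply/setP => s; rewrite !inE; apply/andP/andP => -[h su]; split => //; last by rewrite h.
  case/orP: h => // h; have := n21 (subsetP s2 _ h) (setU1r c uD); by rewrite su.
have e2 u : u \in D2 -> [set s in S1 :|: S2 | anc par s u] = [set s in S2 | anc par s u].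
  move=> uD; apply/setP => s; rewrite !inE; apply/andP/andP => -[h su]; split => //; last by rewrite h orbT.
  case/orP: h => // h; have := n12 (subsetP s1 _ h) uD; by rewrite su.
have E1 : \sum_(u in D1) w u * (1 - avoid [set s in S1 :|: S2 | anc par s u]) =
    \sum_(u in D1) w u * (1 - avoid [set s in S1 | anc par s u]).
  by apply: eq_bigr => u h; rewrite e1.
have E2 : \sum_(u in D2) w u * (1 - avoid [set s in S1 :|: S2 | anc par s u]) =
    \sum_(u in D2) w u * (1 - avoid [set s in S2 | anc par s u]).
  by apply: eq_bigr => u h; rewrite e2.
rewrite E1 E2.
ring.
Qed.

Lemma opt_chain_merge k1 t1 a1 b1 F1 k2 t2 a2 b2 F2 m t a b I J F :
  opt_chain B1 D1 k1 t1 a1 b1 F1 -> opt_chain B2 D2 k2 t2 a2 b2 F2 ->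
  stack k2 t2 a2 b2 (fun i => a1 i + w c * (b1 i - 1)) b1 m k1 t a b I J ->
  (forall l, (l < m)%N -> F l = F1 (I l) :|: F2 (J l)) ->
  opt_chain (B1 :|: B2) (c |: (D1 :|: D2)) m t a b F.
Proof.
move=> O1 O2 St EF.
have /andP[k10 k1B] := oc_k O1; have /andP[k20 k2B] := oc_k O2.
have m0 := stk_pos St k10.
split.
- exact: stk_chain St.
- rewrite m0 (cardsU B1 B2) (_ : B1 :&: B2 = set0) ?cards0 ?subn0; last by apply/eqP; rewrite setI_eq0.
  have lm : (m.-1 < m)%N by rewrite prednK.
  (* The staircase bounds the top index by [(k1 - 1) + (k2 - 1)], at most the number of nodes of
     both parts. *)
  have := stk_size St lm; have := stk_I St lm; have := stk_J St lm; lia.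
- rewrite (stk_last St k10 (oc_last O1)) mulr_gt0 //; [exact: oc_last O1|exact: oc_last O2].
- move=> l lm; rewrite EF //; apply: setUSS.
    by apply: oc_sub O1 _ _; apply: stk_I St _ lm.
  by apply: oc_sub O2 _ _; apply: stk_J St _ lm.
- move=> l lm; have hI := stk_I St lm; have hJ := stk_J St lm.
  rewrite EF // valueU; [|exact: oc_sub O1 _ hI|exact: oc_sub O2 _ hJ].
  by rewrite (stk_a St lm) (oc_a O1 hI) (oc_b O1 hI) (oc_a O2 hJ).
- move=> l lm; have hI := stk_I St lm; have hJ := stk_J St lm.
  rewrite EF // avoidU; [|exact: oc_sub O1 _ hI|exact: oc_sub O2 _ hJ].
  by rewrite (stk_b St lm) (oc_b O1 hI) (oc_b O2 hJ).
move=> S y SB y0.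
set S1 := S :&: B1; set S2 := S :&: B2.
have s1 : S1 \subset B1 by exact: subsetIr.
have s2 : S2 \subset B2 by exact: subsetIr.
have -> : S = S1 :|: S2 by rewrite -setIUr; apply/esym/setIidPl.
rewrite valueU // avoidU //.
(* With [S2] fixed, [S1] is rated at [w c + y * avoid S2], where some line [i] is at least as good;
   after this replacement [S2] is rated at [b1 i * y]. *)
have y1 : 0 <= w c + y * avoid S2.
  by apply: addr_ge0 => //; apply: mulr_ge0 => //; apply: avoid_ge0.
have [i ik hi] := oc_cover O1 s1 y1.
have y2 : 0 <= b1 i * y.
  by apply: mulr_ge0 => //; rewrite (oc_b O1 ik) avoid_ge0.
have [j jk hj] := oc_cover O2 s2 y2.
have [l lm hl] := stk_cover St ik jk y0.
exists l => //; apply: le_trans hl; rewrite /cell.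
lra.
Qed.

End Merge.

Lemma opt_chain_best B D k t a b F : opt_chain B D k t a b F ->
  forall S, S \subset B -> value D S <= a 0%N.
Proof.
move=> O S SB; have [l lk] := oc_cover O SB (lexx 0).
have /andP[k0 _] := oc_k O.
rewrite !mulr0 !addr0 => h; apply: le_trans h _.
have C := oc_chain O.
have := chain_active C k0 lk (y := 0); rewrite !mulr0 !addr0; apply.
  by rewrite (chain_t0 C).
by move=> h; apply: chain_t_ge0 C h.
Qed.

End Value.

(** * Structured programs with time credits *)

Inductive cmd : Type :=
| Blk of seq instr
| Seq of cmd & cmd
| If of nat & cmd & cmd
| While of nat & cmd.

Fixpoint csize (c : cmd) : nat :=
  match c with
  | Blk l => size l
  | Seq a b => (csize a + csize b)%N
  | If _ a b => (csize a + csize b + 2)%N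
  | While _ a => (csize a + 2)%N
  end.

(** Jump targets are absolute, so the code depends on the offset [o] at which it is placed. *)
Fixpoint compile (o : nat) (c : cmd) : seq instr :=
  match c with
  | Blk l => l
  | Seq a b => compile o a ++ compile (o + csize a)%N b
  | If i a b => JZ i (o + csize a + 2)%N :: compile o.+1 a ++
      Jmp (o + csize a + csize b + 2)%N :: compile (o + csize a + 2)%N b
  | While i a => JZ i (o + csize a + 2)%N :: compile o.+1 a ++ [:: Jmp o]
  end.

Lemma size_compile c o : size (compile o c) = csize c.
Proof.
elim: c o => //= [a IHa b IHb|i a IHa b IHb|i a IHa] o; rewrite size_cat /= ?IHa ?IHb //; lia.
Qed.

Definition nregs := 32%N.

Definition mrg (T : Type) (r h : nat -> T) : nat -> T :=
  fun a => if (a < nregs)%N then r a else h a.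

(* Unlike [upd], [rset] computes on literal register numbers. *)
Definition rset (T : Type) (m : nat -> T) (a : nat) (x : T) : nat -> T :=
  fun b => if eqn b a then x else m b.

Arguments rset T m a x b / : simpl nomatch.

(* Memory split into the registers (addresses below [nregs]) and the heap. *)
Record st (R : Type) := St { rn : nat -> nat; hn : nat -> nat; rx : nat -> R; hx : nat -> R }.

Lemma mrg_reg (T : Type) (r h : nat -> T) a : (a < nregs)%N -> mrg r h a = r a.
Proof. by rewrite /mrg => ->. Qed.

Lemma mrg_heap (T : Type) (r h : nat -> T) a : (nregs <= a)%N -> mrg r h a = h a.
Proof. by rewrite /mrg ltnNge => ->. Qed.

Lemma rsetE (T : Type) (m : nat -> T) a x b : rset m a x b = if b == a then x else m b.
Proof. by rewrite /rset eqnE. Qed.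

Lemma upd_reg (T : Type) (r h : nat -> T) a x : (a < nregs)%N ->
  upd (mrg r h) a x = mrg (rset r a x) h.
Proof.
move=> aK; apply/funext => b; rewrite /upd /mrg rsetE.
by case: eqVneq => // ->; rewrite aK.
Qed.

Lemma upd_heap (T : Type) (r h : nat -> T) a x : (nregs <= a)%N ->
  upd (mrg r h) a x = mrg r (upd h a x).
Proof.
move=> aK; apply/funext => b; rewrite /upd /mrg.
by case: eqVneq => // ->; rewrite ltnNge aK.
Qed.

Section Logic.
Variable R : realType.
Implicit Types (s : st R) (c : cmd) (Q : st R -> nat -> Prop).

(** A store can hit a register through its computed address. This is wanted twice: the empty set
    marks register 9, and the output may cover registers. *)
Definition eff (i : instr) (s : st R) : st R :=
  let: St r h x y := s in
  match i with
  | NConst i v => St (rset r i v) h x y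
  | NAdd i j l => St (rset r i (r j + r l)%N) h x y
  | NSub i j l => St (rset r i (r j - r l)%N) h x y
  | NLoad i j => St (rset r i (mrg r h (r j))) h x y
  | NStore i j => if (r i < nregs)%N then St (rset r (r i) (r j)) h x y
                  else St r (upd h (r i) (r j)) x y
  | RFromN q i => St r h (rset x q (r i)%:R) y
  | RAdd q a b => St r h (rset x q (x a + x b)) y
  | RSub q a b => St r h (rset x q (x a - x b)) y
  | RMul q a b => St r h (rset x q (x a * x b)) y
  | RDiv q a b => St r h (rset x q (x a / x b)) y
  | RLoad q j => St r h (rset x q (mrg x y (r j))) y
  | RStore i q => if (r i < nregs)%N then St r h (rset x (r i) (x q)) y
                  else St r h x (upd y (r i) (x q))
  | RLe i a b => St (rset r i (nat_of_bool (x a <= x b))) h x y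
  | JZ _ _ | Jmp _ => s
  end.

Definition okb (i : instr) : bool :=
  match i with
  | NConst i _ => (i < nregs)%N
  | NAdd i j l | NSub i j l | RAdd i j l | RSub i j l | RMul i j l | RDiv i j l
  | RLe i j l => [&& i < nregs, j < nregs & l < nregs]%N
  | NLoad i j | NStore i j | RFromN i j | RLoad i j | RStore i j =>
      (i < nregs)%N && (j < nregs)%N
  | JZ _ _ | Jmp _ => false
  end.

Definition conf (o : nat) (s : st R) : config R :=
  Config o (mrg (rn s) (hn s)) (mrg (rx s) (hx s)).

Definition runs c s t s' := forall p1 p2,
  exec (p1 ++ compile (size p1) c ++ p2) t (conf (size p1) s) = conf (size p1 + csize c) s'.

(* From [s], [c] ends within [cr] steps in a state satisfying [Q], which may
   also use a lower bound on the number of steps that are left. *)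
Definition wp c s cr Q := exists t s' cr',
  [/\ runs c s t s', (t + cr' <= cr)%N & Q s' cr'].

Lemma iter1 (T : Type) (f : T -> T) x : iter 1 f x = f x.
Proof. by []. Qed.

Lemma nth_mid (p1 p2 : seq instr) i d : nth d (p1 ++ i :: p2) (size p1) = i.
Proof. by rewrite nth_cat ltnn subnn. Qed.

Lemma step_at (p1 p2 : seq instr) i N (X : nat -> R) :
  step (p1 ++ i :: p2) (Config (size p1) N X) =
  let k := size p1 in
  match i with
  | NConst i v => Config k.+1 (upd N i v) X
  | NAdd i j l => Config k.+1 (upd N i (N j + N l)%N) X
  | NSub i j l => Config k.+1 (upd N i (N j - N l)%N) X
  | NLoad i j => Config k.+1 (upd N i (N (N j))) X
  | NStore i j => Config k.+1 (upd N (N i) (N j)) X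
  | RFromN r i => Config k.+1 N (upd X r (N i)%:R)
  | RAdd r a b => Config k.+1 N (upd X r (X a + X b))
  | RSub r a b => Config k.+1 N (upd X r (X a - X b))
  | RMul r a b => Config k.+1 N (upd X r (X a * X b))
  | RDiv r a b => Config k.+1 N (upd X r (X a / X b))
  | RLoad r j => Config k.+1 N (upd X r (X (N j)))
  | RStore i r => Config k.+1 N (upd X (N i) (X r))
  | RLe i a b => Config k.+1 (upd N i (nat_of_bool (X a <= X b))) X
  | JZ i t => Config (if N i == 0%N then t else k.+1) N X
  | Jmp t => Config t N X
  end.
Proof.
rewrite /step size_cat /= addnS ltnNge leq_addr /=.
by rewrite nth_mid.
Qed.

Lemma step_eff p1 p2 i s : okb i ->
  step (p1 ++ i :: p2) (conf (size p1) s) = conf (size p1).+1 (eff i s).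
Proof.
case: s => r h x y; rewrite /conf step_at.
case: i => //= [i v iK|i j l /and3P[iK jK lK]|i j l /and3P[iK jK lK]|i j /andP[iK jK]|
  i j /andP[iK jK]|i j /andP[iK jK]|i j l /and3P[iK jK lK]|i j l /and3P[iK jK lK]|
  i j l /and3P[iK jK lK]|i j l /and3P[iK jK lK]|i j /andP[iK jK]|i j /andP[iK jK]|
  i j l /and3P[iK jK lK]];
  rewrite ?(mrg_reg _ _ jK) ?(mrg_reg _ _ lK) ?(mrg_reg _ _ iK); try by rewrite upd_reg.
- by have [h1|h1] := ltnP (r i) nregs; [rewrite upd_reg|rewrite upd_heap].
- by have [h1|h1] := ltnP (r i) nregs; [rewrite upd_reg|rewrite upd_heap].
Qed.

Lemma wp_conseq c s cr Q Q' : wp c s cr Q -> (forall s' cr', Q s' cr' -> Q' s' cr') -> wp c s cr Q'.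
Proof. by case=> t [s' [cr' [h1 h2 h3]]] QQ; exists t, s', cr'; split=> //; apply: QQ. Qed.

Lemma wp_nil s cr Q : Q s cr -> wp (Blk [::]) s cr Q.
Proof.
by move=> h; exists 0%N, s, cr; split => // p1 p2; rewrite /= addn0.
Qed.

Lemma wp_cons i l s cr Q : okb i -> (0 < cr)%N -> wp (Blk l) (eff i s) cr.-1 Q ->
  wp (Blk (i :: l)) s cr Q.
Proof.
move=> ok cr0 [t [s' [cr' [h1 h2 h3]]]]; exists t.+1, s', cr'; split => //; last lia.
move=> p1 p2; rewrite /exec iterSr [compile _ _]/= cat_cons step_eff //.
have := h1 (rcons p1 i) p2; rewrite /exec /= cat_rcons size_rcons => ->.
by rewrite addSn addnS.
Qed.

Lemma wp_seq a b s cr Q : wp a s cr (fun s' cr' => wp b s' cr' Q) -> wp (Seq a b) s cr Q.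
Proof.
move=> [t [s' [cr' [h1 h2 [t' [s'' [cr'' [h1' h2' h3]]]]]]]].
exists (t' + t)%N, s'', cr''; split => //; last lia.
move=> p1 p2; rewrite /exec iterD /= -catA.
have := h1 p1 (compile (size p1 + csize a) b ++ p2); rewrite /exec => ->.
have := h1' (p1 ++ compile (size p1) a) p2; rewrite /exec -catA size_cat size_compile => ->.
by rewrite addnA.
Qed.

Lemma wp_if i a b s cr Q : (i < nregs)%N -> (2 <= cr)%N ->
  (rn s i != 0%N -> wp a s (cr - 2)%N Q) -> (rn s i = 0%N -> wp b s (cr - 2)%N Q) ->
  wp (If i a b) s cr Q.
Proof.
move=> iK cr2 ha hb; have [e|e] := eqVneq (rn s i) 0%N.
  have [t [s' [cr' [h1 h2 h3]]]] := hb e.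
  exists t.+1, s', cr'; split => //; last lia.
  move=> p1 p2; rewrite /exec iterSr [compile _ _]/= cat_cons step_at [X in iter _ _ X]/= mrg_reg // e eqxx.
  rewrite -cat_cons; set q := JZ _ _ :: _.
  have -> : p1 ++ q ++ p2 = (p1 ++ (JZ i (size p1 + csize a + 2) :: compile (size p1).+1 a ++
      [:: Jmp (size p1 + csize a + csize b + 2)])) ++
      compile (size p1 + csize a + 2) b ++ p2.
    by rewrite /q -!catA /= -!catA.
  have := h1 (p1 ++ (JZ i (size p1 + csize a + 2) :: compile (size p1).+1 a ++
      [:: Jmp (size p1 + csize a + csize b + 2)])) p2.
  rewrite /exec !size_cat /= size_cat size_compile /=.
  have -> : (size p1 + (csize a + 1).+1 = size p1 + csize a + 2)%N by lia.
  by rewrite /conf => ->; congr Config; lia.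
have [t [s' [cr' [h1 h2 h3]]]] := ha e.
exists (1 + (t + 1))%N, s', cr'; split => //; last lia.
move=> p1 p2; rewrite /exec iterD iterD [compile _ _]/= cat_cons [iter 1 _ (conf _ _)]iter1 step_at.
rewrite [X in iter t _ X]/= mrg_reg // (negbTE e).
set prog := p1 ++ _.
have e1 : prog = rcons p1 (JZ i (size p1 + csize a + 2)) ++ compile (size p1).+1 a ++
    (Jmp (size p1 + csize a + csize b + 2) :: compile (size p1 + csize a + 2) b) ++ p2.
  by rewrite /prog cat_rcons /= -catA.
have := h1 (rcons p1 (JZ i (size p1 + csize a + 2)))
   ((Jmp (size p1 + csize a + csize b + 2) :: compile (size p1 + csize a + 2) b) ++ p2).
rewrite /exec size_rcons -e1 /conf => ->.
have e2 : prog = (rcons p1 (JZ i (size p1 + csize a + 2)) ++ compile (size p1).+1 a) ++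
    (Jmp (size p1 + csize a + csize b + 2) :: (compile (size p1 + csize a + 2) b ++ p2)).
  by rewrite e1 -catA.
rewrite e2.
have -> : ((size p1).+1 + csize a)%N = size (rcons p1 (JZ i (size p1 + csize a + 2)) ++ compile (size p1).+1 a).
  by rewrite size_cat size_rcons size_compile.
by rewrite iter1 step_at /conf /=; congr Config; lia.
Qed.

(** Each round uses up credits, for the test and for the jump back, so induction on the credits also
    gives termination. *)
Lemma wp_while i c (Inv Q : st R -> nat -> Prop) s cr : (i < nregs)%N ->
  (forall s cr, Inv s cr -> (0 < cr)%N /\
    (rn s i = 0%N -> Q s cr.-1) /\
    (rn s i != 0%N -> wp c s cr.-1 (fun s' cr' => (0 < cr')%N /\ Inv s' cr'.-1))) ->
  Inv s cr -> wp (While i c) s cr Q.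
Proof.
move=> iK H; elim/ltn_ind: cr s => cr IH s I.
have [cr0 [hz hnz]] := H _ _ I; have [e|e] := eqVneq (rn s i) 0%N.
  exists 1%N, s, cr.-1; split; [|lia|exact: hz].
  move=> p1 p2; rewrite /exec [compile _ _]/= cat_cons [iter 1 _ _]iter1 step_at [LHS]/= mrg_reg // e eqxx.
  by rewrite /conf /=; congr Config; lia.
have [t [s' [cr' [h1 h2 [cr0' I']]]]] := hnz e.
have [|t' [s'' [cr'' [h1' h2' h3']]]] := IH cr'.-1 _ s' I'; first lia.
exists (t' + (1 + (t + 1)))%N, s'', cr''; split => //; last lia.
move=> p1 p2; rewrite /exec iterD iterD iterD [compile _ _]/= cat_cons [iter 1 _ (conf _ _)]iter1 step_at.
rewrite [X in iter t _ X]/= mrg_reg // (negbTE e).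
set prog := p1 ++ _.
have e1 : prog = rcons p1 (JZ i (size p1 + csize c + 2)) ++ compile (size p1).+1 c ++
    (Jmp (size p1) :: p2).
  by rewrite /prog cat_rcons /= -catA.
have := h1 (rcons p1 (JZ i (size p1 + csize c + 2))) (Jmp (size p1) :: p2).
rewrite /exec size_rcons -e1 /conf => ->.
have e2 : prog = (rcons p1 (JZ i (size p1 + csize c + 2)) ++ compile (size p1).+1 c) ++
    (Jmp (size p1) :: p2).
  by rewrite e1 -catA.
rewrite iter1; have -> : step prog (Config ((size p1).+1 + csize c) (mrg (rn s') (hn s')) (mrg (rx s') (hx s'))) =
   conf (size p1) s'.
  rewrite e2.
  have -> : ((size p1).+1 + csize c)%N = size (rcons p1 (JZ i (size p1 + csize c + 2)) ++ compile (size p1).+1 c).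
    by rewrite size_cat size_rcons size_compile.
  by rewrite step_at.
exact: h1' p1 p2.
Qed.

End Logic.

(** * Symbolic execution of straight-line code *)

Section Exec.
Variable R : realType.
Implicit Types (s : st R).

(** A relation rather than a function, so that the final state can be left open and is found while
    the instructions are run. *)
Inductive ex : seq instr -> st R -> st R -> Prop :=
| ex_nil s : ex [::] s s
| ex_cons i l s s' : okb i -> ex l (eff i s) s' -> ex (i :: l) s s'.

(** Once the address is known to lie in the heap, the distinction between registers and heap
    disappears from the symbolic state; likewise in the next three rules. *)
Lemma ex_nload i j l r h x y s' : (i < nregs)%N && (j < nregs)%N -> (nregs <= r j)%N ->
  ex l (@St R (rset r i (h (r j))) h x y) s' -> ex (NLoad i j :: l) (St r h x y) s'.
Proof. by move=> ok a e; apply: ex_cons => //=; rewrite mrg_heap. Qed.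

Lemma ex_nstore i j l r h x y s' : (i < nregs)%N && (j < nregs)%N -> (nregs <= r i)%N ->
  ex l (@St R r (upd h (r i) (r j)) x y) s' -> ex (NStore i j :: l) (St r h x y) s'.
Proof. by move=> ok a e; apply: ex_cons => //=; rewrite ltnNge a. Qed.

Lemma ex_rload i j l r h x y s' : (i < nregs)%N && (j < nregs)%N -> (nregs <= r j)%N ->
  ex l (@St R r h (rset x i (y (r j))) y) s' -> ex (RLoad i j :: l) (St r h x y) s'.
Proof. by move=> ok a e; apply: ex_cons => //=; rewrite mrg_heap. Qed.

Lemma ex_rstore i j l r h x y s' : (i < nregs)%N && (j < nregs)%N -> (nregs <= r i)%N ->
  ex l (@St R r h x (upd y (r i) (x j))) s' -> ex (RStore i j :: l) (St r h x y) s'.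
Proof. by move=> ok a e; apply: ex_cons => //=; rewrite ltnNge a. Qed.

Lemma wp_blk l s s' cr (Q : st R -> nat -> Prop) : (size l <= cr)%N -> ex l s s' ->
  Q s' (cr - size l)%N -> wp (Blk l) s cr Q.
Proof.
move=> h e; elim: e cr h => {l s s'} [s|i l s s' ok _ IH] cr /=.
  by rewrite subn0 => _ ?; apply: wp_nil.
move=> h q; apply: wp_cons => //; first lia.
apply: IH => //; first lia.
by have -> : (cr.-1 - size l = cr - (size l).+1)%N by lia.
Qed.

End Exec.
Arguments upd : simpl never.

Lemma updE (T : Type) (m : nat -> T) a x b : upd m a x b = if b == a then x else m b.
Proof. by []. Qed.

Ltac side := rewrite /=; first [by [] | lia].

Ltac run1 :=
  lazymatch goal with
  | |- ex [::] _ _ => apply: ex_nil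
  | |- ex (NLoad _ _ :: _) _ _ => apply: ex_nload; [by []|side|rewrite /=]
  | |- ex (NStore _ _ :: _) _ _ => apply: ex_nstore; [by []|side|rewrite /=]
  | |- ex (RLoad _ _ :: _) _ _ => apply: ex_rload; [by []|side|rewrite /=]
  | |- ex (RStore _ _ :: _) _ _ => apply: ex_rstore; [by []|side|rewrite /=]
  | |- ex (_ :: _) _ _ => apply: ex_cons; [by []|rewrite /=]
  end.

Ltac run := repeat run1.

Ltac frame := let a := fresh "a" in let h := fresh "h" in
  move=> a h; rewrite ?rsetE ?updE;
  repeat (case: (eqVneq a _) => [?|_]; [exfalso; lia|]).

Ltac frame_at a := rewrite ?rsetE ?updE;
  repeat (case: (eqVneq a _) => [?|_]; [exfalso; lia|]).

(** * Merging two envelopes *)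

(* Main registers: 0 number of nodes, 1 and 2 the constants 1 and 3, 3 end of
   the used heap, 4 parents, 5 depths, 6 starts and 7 (exclusive) ends of the
   entries of the nodes,
   8 the copied real input, 10 current depth, 11 current node (the child c),
   12 its parent, 13 end of the entries of c, 14 to 15 the entries of the
   parent, 16 current entry of c (row), 17 top of the stack, 18 current entry
   of the parent (column).  Real registers: 0 weight above c, 1 and 2 the row's
   intercept and slope, 3 start of the next pushed line, 10 zero.
   An entry is three cells: real t, a, b and natural left, right, unused. *)

Definition push_body : cmd :=
  Seq (Blk [:: RStore 17 3; NAdd 20 18 1; RLoad 5 20; RAdd 5 1 5; NAdd 21 17 1; RStore 21 5;
               NAdd 20 20 1; RLoad 6 20; RMul 6 2 6; NAdd 22 21 1; RStore 22 6;
               NStore 17 16; NStore 21 18; NAdd 17 17 2; NAdd 18 18 2; NSub 19 15 18])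
      (If 19 (Seq (Blk [:: RLe 20 2 10])
                  (If 20 (Blk [:: NConst 19 0]) (Blk [:: RLoad 4 18; RDiv 3 4 2])))
             (Blk [::])).

(** A row of slope 0 leaves the loop after one line, before its slope could become a divisor. *)
Definition push_loop : cmd := Seq (Blk [:: NConst 19 1]) (While 19 push_body).

Section Push.
Variable R : realType.
Implicit Types (s : st R).

(** The longest round takes 25 steps, test and jump back included. *)
Definition push_cost := 26%N.

Lemma push_loop_spec s cr P2 k2 j Sb e1 : (j < k2)%N ->
  (nregs <= P2)%N -> (P2 + 3 * k2 <= Sb)%N ->
  rn s 1 = 1%N -> rn s 2 = 3%N -> rn s 15 = (P2 + 3 * k2)%N ->
  rn s 16 = e1 -> rn s 17 = Sb -> rn s 18 = (P2 + 3 * j)%N -> rx s 10 = 0 ->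
  (push_cost * (k2 - j) + 2 <= cr)%N ->
  wp push_loop s cr (fun s' cr' => exists cnt,
    [/\ (if (0 < rx s 2)%R then cnt == k2 - j else cnt == 1)%N,
      rn s' 17 = (Sb + 3 * cnt)%N /\ (forall a, (a < 17)%N -> rn s' a = rn s a),
      forall a, (a < 3)%N || (a == 10)%N -> rx s' a = rx s a,
      (forall a, (a < Sb)%N -> hn s' a = hn s a /\ hx s' a = hx s a) &
      (forall r, (r < cnt)%N ->
         [/\ hx s' (Sb + 3 * r)%N = (if r == 0%N then rx s 3 else hx s (P2 + 3 * (j + r))%N / rx s 2),
           hx s' (Sb + 3 * r).+1 = rx s 1 + hx s (P2 + 3 * (j + r)).+1,
           hx s' (Sb + 3 * r).+2 = rx s 2 * hx s (P2 + 3 * (j + r)).+2,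
           hn s' (Sb + 3 * r)%N = e1 & hn s' (Sb + 3 * r).+1 = (P2 + 3 * (j + r))%N])
       /\ (cr <= cr' + push_cost * (k2 - j) + 2)%N]).
Proof.
case: s => r0 h0 x0 y0 /= jk P2K P2S r1 r2 r15 r16 r17 r18 x10 crb.
rewrite /push_cost in crb *.
apply: wp_seq; apply: wp_blk; [rewrite /=; lia|by run|].
pose Inv (s' : st R) (cr' : nat) := exists r : nat,
    [/\ (rn s' 19 = 0 -> if (0 < x0 2)%R then r == k2 - j else r == 1)%N,
      (rn s' 19 != 0%N -> [/\ (r < k2 - j)%N, (0 < r)%N -> (0 < x0 2)%R &
          rx s' 3 = if (r == 0%N) then x0 3 else y0 (P2 + 3 * (j + r))%N / x0 2]),
      [/\ rn s' 17 = (Sb + 3 * r)%N, rn s' 18 = (P2 + 3 * (j + r))%N, (forall a, (a < 17)%N -> rn s' a = r0 a) &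
      (forall a, (a < 3)%N || (a == 10)%N -> rx s' a = x0 a)],
      (forall a, (a < Sb)%N -> hn s' a = h0 a /\ hx s' a = y0 a) &
      (forall q, (q < r)%N ->
         [/\ hx s' (Sb + 3 * q)%N = (if q == 0%N then x0 3 else y0 (P2 + 3 * (j + q))%N / x0 2),
           hx s' (Sb + 3 * q).+1 = x0 1 + y0 (P2 + 3 * (j + q)).+1,
           hx s' (Sb + 3 * q).+2 = x0 2 * y0 (P2 + 3 * (j + q)).+2,
           hn s' (Sb + 3 * q)%N = e1 & hn s' (Sb + 3 * q).+1 = (P2 + 3 * (j + q))%N])
       /\ (cr + 26 * (if rn s' 19 == 0%N then 0 else k2 - j - r) <= cr' + 26 * (k2 - j) + 1)%N].
apply: (wp_while (Inv := Inv)) => //; last first.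
  exists 0%N; split => //=; first by move=> _; split => //; lia.
  - by split => //; [rewrite muln0 addn0|rewrite addn0|frame].
  - split; first (by move=> ?; rewrite ltn0); lia.
case=> r h x y cr' [q [/= H0 H1 [R17 R18 fr fx] hp [ent crd]]].
split; first by case: eqVneq crd => _; lia.
split.
  move=> e; exists q; split => //; first exact: H0.
  by split=> //; move: crd; rewrite e eqxx; lia.
move=> nz; have [qk qb x3] := H1 nz.
move: crd; rewrite (negbTE nz) => crd.
have R1 := fr 1%N isT; have R2 := fr 2%N isT; have R15 := fr 15%N isT; have R16 := fr 16%N isT.
rewrite r1 in R1; rewrite r2 in R2; rewrite r15 in R15; rewrite r16 in R16.
have X10 := fx 10%N isT; have X1 := fx 1%N isT; have X2 := fx 2%N isT.
rewrite x10 in X10.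
set g := (P2 + 3 * (j + q))%N in R18 x3 *; set e := (Sb + 3 * q)%N in R17.
have eE : e = (Sb + 3 * q)%N by []. have gE : g = (P2 + 3 * (j + q))%N by [].
have [E1 E2] : y (g + 1)%N = y0 g.+1 /\ y (g + 1 + 1)%N = y0 g.+2.
  rewrite !addnS !addn0; split; apply hp; rewrite /g; lia.
apply: wp_seq; apply: wp_blk; [rewrite /=; lia|by run|].
rewrite [size _]/= !(R1, R2, R15, R16, R17, R18, X1, X2).
have -> : upd y e (x 3%N) (g + 1)%N = y0 g.+1.
  by rewrite updE E1; case: eqVneq => //; lia.
have -> : upd (upd y e (x 3%N)) (e + 1) (x0 1%N + y0 g.+1) (g + 1 + 1)%N = y0 g.+2.
  by rewrite !updE E2; do 2 (case: eqVneq => /= [?|_]; first by exfalso; lia).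
set h' := upd _ _ g; set y' := upd _ (e + 1 + 1)%N _; set x' := rset _ 6 _.
have hp' a : (a < Sb)%N -> h' a = h0 a /\ y' a = y0 a.
  move=> aS; have [<- <-] := hp a aS; rewrite /h' /y' !updE.
  by split; repeat (case: eqVneq => [?|_]; first by exfalso; lia).
have ent' q0 : (q0 < q.+1)%N -> [/\ y' (Sb + 3 * q0)%N =
        (if q0 == 0%N then x0 3 else y0 (P2 + 3 * (j + q0))%N / x0 2),
        y' (Sb + 3 * q0).+1 = x0 1 + y0 (P2 + 3 * (j + q0)).+1,
        y' (Sb + 3 * q0).+2 = x0 2 * y0 (P2 + 3 * (j + q0)).+2,
        h' (Sb + 3 * q0)%N = e1
      & h' (Sb + 3 * q0).+1 = (P2 + 3 * (j + q0))%N].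
  rewrite ltnS leq_eqVlt => /orP[/eqP->|lt].
    rewrite -/e -/g /h' /y' !updE !addnS !addn0.
    split; repeat (case: eqVneq => [?|?]; try (exfalso; lia)) => //.
  have [<- <- <- <- <-] := ent q0 lt; rewrite /h' /y' !updE.
  by split; repeat (case: eqVneq => [?|_]; first by exfalso; lia).
have fx' a : (a < 3)%N || (a == 10)%N -> x' a = x0 a.
  move=> ha; rewrite -fx // /x' !rsetE; repeat (case: eqVneq => [?|_]; first by exfalso; lia); done.
have q0 : ~~ (0 < x0 2%N) -> q = 0%N.
  by move=> h0'; apply/eqP; rewrite -leqn0 leqNgt; apply: contra h0' => /qb.
have gS : (g + 3 = P2 + 3 * (j + q.+1))%N by lia.
apply: wp_if => [//|/=|/=|/=]; first lia.
- move=> lt; apply: wp_seq; apply: wp_blk; [rewrite /=; lia|by run|].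
  rewrite [size _]/= !fx' // x10; apply: wp_if => [//|/=|/=|/=]; first lia.
    case: (boolP (x0 2%N <= 0)) => // b0 _; apply: wp_blk; [rewrite /=; lia|by run|].
    split; first by rewrite /=; lia.
    exists q.+1; split => //=.
    + by move=> _; rewrite ltNge b0 /= q0 // ltNge b0.
    + by split => //; [lia|frame; apply: fr].
    + by split => //; lia.
  case: (boolP (x0 2%N <= 0)) => // b0 _; apply: wp_blk; [rewrite /=; lia|by run|].
  rewrite -ltNge in b0.
  split; first by rewrite /=; lia.
  exists q.+1; split => //=.
  + by move=> e0; exfalso; lia.
  + move=> _; split => //; first lia.
    rewrite fx' // gS; congr (_ / _); apply hp'; lia.
  + split => //; [lia|by frame; apply: fr|move=> a ha].
    by rewrite -fx' // !rsetE; repeat (case: eqVneq => [?|_]; first by exfalso; lia).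
  + by split => //; rewrite ifN //; lia.
move=> e0; apply: wp_blk => //; [exact: ex_nil|split]; first by rewrite /=; lia.
exists q.+1; split => //=.
- move=> _; case: ifPn => b0; first by apply/eqP; lia.
  by rewrite q0.
- by rewrite e0.
- by split => //; [lia|frame; apply: fr].
- by split => //; rewrite e0 /=; lia.
Qed.

End Push.

(** * Code that searches for the crossing *)

Definition event_body : cmd :=
  Seq (Blk [:: NSub 20 17 2; RLoad 7 20; NAdd 21 20 1; RLoad 8 21; NAdd 21 21 1; RLoad 9 21;
               RLoad 4 18; NAdd 21 18 1; RLoad 5 21; RAdd 5 1 5; NAdd 21 21 1; RLoad 6 21;
               RMul 6 2 6; RMul 11 7 2; RLe 22 4 11])
  (Seq (If 22 (Blk [:: RAdd 4 7 10]) (Blk [:: RDiv 4 4 2]))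
  (Seq (Blk [:: RMul 11 9 4; RAdd 11 8 11; RMul 12 6 4; RAdd 12 5 12; RLe 23 11 12])
       (If 23 (If 22 (Blk [:: NSub 17 17 2; NSub 19 17 3]) (Blk [:: NSub 18 18 2]))
              (Blk [:: RSub 11 8 5; RSub 12 6 9; RDiv 3 11 12; NConst 19 0])))).

(** Real register 3 starts at 0, the crossing to be reported if the stack becomes empty. *)
Definition event_loop : cmd := Seq (Blk [:: NConst 19 1; RAdd 3 10 10]) (While 19 event_body).

Section Event.
Variable R : realType.
Implicit Types (s : st R).

Definition event_cost := 34%N.

(** Every round removes a stacked line or steps back a column, and is paid from a potential of 34
    per line and per column. The share of the [m] surviving lines is handed back for later rows. *)
Lemma event_loop_spec s cr L k1 k2 ca b1 i M H P2 a b t a2 b2 t2 I J :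
  chain k2 t2 a2 b2 -> 0 < b2 k2.-1 ->
  (forall i, (i < k1)%N -> 0 <= b1 i) -> (forall i, (i.+1 < k1)%N -> b1 i < b1 i.+1) ->
  stack k2 t2 a2 b2 ca b1 M i t a b I J -> (0 < k2)%N -> (0 < i < k1)%N ->
  (nregs <= P2)%N -> (nregs <= H)%N ->
  (forall l, (l < M)%N -> [/\ hx s (H + 3 * l)%N = t l, hx s (H + 3 * l).+1 = a l & hx s (H + 3 * l).+2 = b l]) ->
  (forall l, (l < k2)%N -> [/\ hx s (P2 + 3 * l)%N = t2 l, hx s (P2 + 3 * l).+1 = a2 l & hx s (P2 + 3 * l).+2 = b2 l]) ->
  rn s 1 = 1%N -> rn s 2 = 3%N -> rn s 3 = H ->
  rn s 17 = (H + 3 * M)%N -> rn s 18 = (P2 + 3 * k2.-1)%N ->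
  rx s 10 = 0 -> rx s 1 = ca i -> rx s 2 = b1 i ->
  (L + event_cost * (M + k2) + 4 <= cr)%N ->
  wp event_loop s cr (fun s' cr' => exists m j th,
    [/\ push_ok k2 t2 a2 b2 ca b1 M i t a b m j th,
      rx s' 3 = th /\ (forall q, (q < 3)%N || (q == 10)%N -> rx s' q = rx s q),
      [/\ rn s' 17 = (H + 3 * m)%N, rn s' 18 = (P2 + 3 * j)%N & forall q, (q < 17)%N -> rn s' q = rn s q],
      hn s' = hn s /\ hx s' = hx s & (L + event_cost * m <= cr')%N]).
Proof.
case: s => r0 h0 x0 y0 /= C2 b2l b1_0 b1S Sk k20 /andP[i0 ik] P2K HK eH eP r1 r2 r3 r17 r18 x10 x1 x2 crb.
rewrite /event_cost in crb *.
apply: wp_seq; apply: wp_blk; [rewrite /=; lia|by run|].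
pose Inv (s' : st R) (cr' : nat) := exists m j : nat,
    [/\ (rn s' 19 = 0%N -> push_ok k2 t2 a2 b2 ca b1 M i t a b m j (rx s' 3)),
      (rn s' 19 != 0%N -> scan k2 t2 a2 b2 ca b1 M i t m j /\ rx s' 3 = 0),
      [/\ rn s' 17 = (H + 3 * m)%N, rn s' 18 = (P2 + 3 * j)%N, (forall a, (a < 17)%N -> rn s' a = r0 a) &
      (forall a, (a < 3)%N || (a == 10)%N -> rx s' a = x0 a)],
      (hn s' = h0 /\ hx s' = y0) &
       (L + 34 * m + (if rn s' 19 == 0%N then 0 else 34 * (j + 1)) + 1 <= cr')%N].
apply: (wp_while (Inv := Inv)) => //; last first.
  exists M, k2.-1; split => //=.
  - by move=> _; split; [apply: scan_init Sk _ _|rewrite x10 addr0].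
  - split => //; first by frame.
    by move=> q hq; rewrite !rsetE; case: eqVneq => // ?; exfalso; lia.
  - lia.
case=> r h x y cr' [m [j [/= H0 H1 [R17 R18 fr fx] [eh ey] crd]]].
rewrite {}eh {}ey {h y}.
split; first lia.
split.
  move=> e; exists m, j, (x 3%N); split => //; first exact: H0.
  by move: crd; rewrite e /=; lia.
move=> nz; have [sc x3] := H1 nz.
move: crd; rewrite (negbTE nz) => crd.
have R1 := fr 1%N isT; have R2 := fr 2%N isT; have R3 := fr 3%N isT.
rewrite r1 in R1; rewrite r2 in R2; rewrite r3 in R3.
have X10 := fx 10%N isT; have X1 := fx 1%N isT; have X2 := fx 2%N isT.
rewrite x10 in X10; rewrite x1 in X1; rewrite x2 in X2.
have /andP[m0 mM] := sc_m sc; have jk := sc_j sc.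
have mM1 : (m.-1 < M)%N by rewrite prednK.
have [T A B] := eH _ mM1; have [T2 A2 B2] := eP _ jk.
have e0E : (H + 3 * m - 3 = H + 3 * m.-1)%N by clear -m0; lia.
apply: wp_seq; apply: wp_blk; [rewrite /=; clear -crd; lia|by run|].
rewrite [size _]/= !(R1, R2, R3, R17, R18, X1, X2, e0E) !addn1 T A B T2 A2 B2.
have bi0 := row_slope_gt0 b1_0 b1S b2l ik i0.
have fr' a' : (a' < 17)%N -> r a' = r0 a' by exact: fr.
have stop x' : x' 3%N = crossing a2 b2 ca b1 i a b m j ->
   (forall q, (q < 3)%N || (q == 10)%N -> x' q = x q) ->
   ~~ (a m.-1 + b m.-1 * event t2 b1 i t m j <= cell a2 b2 ca b1 i j (event t2 b1 i t m j)) ->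
   forall r', (forall a, (a < 19)%N -> r' a = r a) -> r' 19%N = 0%N ->
   forall c, (L + 34 * m + 1 <= c)%N -> Inv (St r' h0 x' y0) c.
  move=> x3' fx' hc r' er r19 c hcr; exists m, j; split => //=.
  - by move=> _; rewrite x3'; apply: (scan_stop C2 b1_0 b1S b2l Sk ik i0 sc).
  - by rewrite r19.
  - split; rewrite ?er // => q hq; [rewrite er; [exact: fr|lia]|by rewrite fx' // fx].
  - by rewrite r19 /=; clear -hcr; lia.
have ev : event t2 b1 i t m j = if t2 j <= t m.-1 * b1 i then t m.-1 else t2 j / b1 i by [].
apply: wp_seq; apply: wp_if => [//|/=||]; first (by clear -crd; lia);
  rewrite /=; case: (boolP (t2 j <= t m.-1 * b1 i)) => // tle _;
  rewrite ?(negbTE tle) ?tle in ev.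
  apply: wp_blk; [rewrite /=; clear -crd; lia|by run|].
  rewrite [size _]/= X10 addr0.
  apply: wp_seq; apply: wp_blk; [rewrite /=; clear -crd; lia|by run|].
  rewrite [size _]/=.
  apply: wp_if => [//|/=||]; first (by clear -crd; lia);
  rewrite /= -ev; case: (boolP (_ <= _)) => // hc _.
    apply: wp_if => [//|/=|/= _|//]; first (by clear -crd; lia).
    apply: wp_blk; [rewrite /=; clear -crd; lia|by run|].
    rewrite [size _]/= R17 R2 R3 e0E.
    split; first by clear -crd; lia.
    exists m.-1, j; split => //=.
    + move=> e0; have {e0} m1 : m = 1%N by clear -e0 m0; lia.
      move: sc tle hc; rewrite m1 x3 => sc tle hc.
      exact: (scan_pop_last C2 b1_0 b1S b2l Sk ik i0 sc) tle hc.
    + move=> e0; split => //; have sp := scan_pop C2 b1_0 b1S b2l Sk ik i0 sc tle hc; apply: sp.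
      by clear -e0 m0; lia.
    + by split => //; [frame; apply: fr|move=> q hq; rewrite -fx //; frame_at q].
    + by case: eqP => _; clear -crd m0; lia.
  apply: wp_blk; [rewrite /=; clear -crd; lia|by run|].
  rewrite [size _]/=; split; first by clear -crd; lia.
  apply: (stop _ _ _ hc) => //=; last by clear -crd; lia.
  - by move=> q hq; frame_at q.
  - by frame.
apply: wp_blk; [rewrite /=; clear -crd; lia|by run|].
rewrite [size _]/= X2.
apply: wp_seq; apply: wp_blk; [rewrite /=; clear -crd; lia|by run|].
rewrite [size _]/=.
apply: wp_if => [//|/=||]; first (by clear -crd; lia);
rewrite /= -ev; case: (boolP (_ <= _)) => // hc _.
  apply: wp_if => [//|/=|//|/= _]; first (by clear -crd; lia).
  apply: wp_blk; [rewrite /=; clear -crd; lia|by run|].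
  rewrite [size _]/= R18 R2.
  split; first by clear -crd; lia.
  have [j0 sc'] := scan_dec C2 b1_0 b1S b2l Sk ik i0 sc tle hc.
  exists m, j.-1; split => //=.
  + by move=> e0; move: nz; rewrite e0.
  + by split => //; [clear -j0; lia|frame; apply: fr|move=> q hq; rewrite -fx //; frame_at q].
  + by case: eqP => _; clear -crd j0; lia.
apply: wp_blk; [rewrite /=; clear -crd; lia|by run|].
rewrite [size _]/=; split; first by clear -crd; lia.
apply: (stop _ _ _ hc) => //=; last by clear -crd; lia.
- by move=> q hq; frame_at q.
- by frame.
Qed.

End Event.

(** * Merging row by row *)

Definition row_values : cmd :=
  Blk [:: NAdd 20 16 1; RLoad 1 20; NAdd 20 20 1; RLoad 2 20; RFromN 5 1; RSub 4 2 5;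
          RMul 4 0 4; RAdd 1 1 4].

Definition next_child_entry : cmd := Blk [:: NAdd 16 16 2; NSub 24 13 16].

(** The first row meets an empty stack, so it is pushed from column 0 with start 0 and without a
    search. *)
Definition rows : cmd :=
  Seq row_values (Seq (Blk [:: NConst 20 0; NAdd 18 14 20; RSub 3 10 10]) (Seq push_loop
  (Seq next_child_entry
  (While 24 (Seq row_values (Seq (Blk [:: NSub 18 15 2]) (Seq event_loop (Seq push_loop
     next_child_entry)))))))).

Section Rows.
Variable R : realType.
Implicit Types (s : st R).

Lemma stack_nil k2 (t2 a2 b2 ca b1 t a b : nat -> R) I J : stack k2 t2 a2 b2 ca b1 0 0 t a b I J.
Proof. by split. Qed.

(** Connects the memory written by [push_loop] with the two geometric cases of a push; positivity of
    later slopes confines the flat case to the first row. *)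
Lemma push_stack k1 k2 (t2 a2 b2 ca b1 : nat -> R) (h h' : nat -> nat) (y y' : nat -> R)
    M i m j th cnt H P1 P2 I J :
  chain k2 t2 a2 b2 -> 0 < b2 k2.-1 ->
  (forall i, (i < k1)%N -> 0 <= b1 i) -> (forall i, (i.+1 < k1)%N -> b1 i < b1 i.+1) ->
  stack k2 t2 a2 b2 ca b1 M i (fun l => y (H + 3 * l)%N) (fun l => y (H + 3 * l).+1)
     (fun l => y (H + 3 * l).+2) I J ->
  (i < k1)%N -> (i = 0%N -> m = 0%N /\ j = 0%N) ->
  push_ok k2 t2 a2 b2 ca b1 M i (fun l => y (H + 3 * l)%N) (fun l => y (H + 3 * l).+1)
     (fun l => y (H + 3 * l).+2) m j th ->
  (forall l, (l < M)%N -> h (H + 3 * l)%N = (P1 + 3 * I l)%N /\ h (H + 3 * l).+1 = (P2 + 3 * J l)%N) ->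
  (if (0 < b1 i)%R then cnt == k2 - j else cnt == 1)%N ->
  (forall a, (a < H + 3 * m)%N -> h' a = h a /\ y' a = y a) ->
  (forall r, (r < cnt)%N ->
         [/\ y' (H + 3 * m + 3 * r)%N = (if r == 0%N then th else t2 (j + r)%N / b1 i),
           y' (H + 3 * m + 3 * r).+1 = ca i + a2 (j + r)%N,
           y' (H + 3 * m + 3 * r).+2 = b1 i * b2 (j + r)%N,
           h' (H + 3 * m + 3 * r)%N = (P1 + 3 * i)%N & h' (H + 3 * m + 3 * r).+1 = (P2 + 3 * (j + r))%N]) ->
  exists I' J', stack k2 t2 a2 b2 ca b1 (m + cnt) i.+1 (fun l => y' (H + 3 * l)%N)
     (fun l => y' (H + 3 * l).+1) (fun l => y' (H + 3 * l).+2) I' J' /\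
  (forall l, (l < m + cnt)%N -> h' (H + 3 * l)%N = (P1 + 3 * I' l)%N /\ h' (H + 3 * l).+1 = (P2 + 3 * J' l)%N).
Proof.
move=> C2 b2l b1_0 b1S Sk ik i00 po hI hcnt hp ent.
have mM := po_m po; have jk := po_j po.
pose I' l := if (l < m)%N then I l else i.
pose J' l := if (l < m)%N then J l else (j + (l - m))%N.
exists I', J'.
have Ir r : I' (m + r)%N = i by rewrite /I' ltnNge leq_addr.
have Jr r : J' (m + r)%N = (j + r)%N by rewrite /J' ltnNge leq_addr /= addKn.
have ar r : (H + 3 * (m + r) = H + 3 * m + 3 * r)%N by rewrite mulnDr addnA.
split; last first.
  move=> l lt; have [lm|ml] := ltnP l m.
    rewrite /I' /J' lm; have [<- <-] := hI l (leq_trans lm mM).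
    by split; apply hp; clear -lm; lia.
  have [r er] : exists r, l = (m + r)%N by exists (l - m)%N; clear -ml; lia.
  rewrite er Ir Jr ar; have [|_ _ _ -> ->] := ent r; last by [].
  by clear -lt er; lia.
have old l : (l < m)%N -> [/\ y' (H + 3 * l)%N = y (H + 3 * l)%N, y' (H + 3 * l).+1 = y (H + 3 * l).+1,
     y' (H + 3 * l).+2 = y (H + 3 * l).+2, I' l = I l & J' l = J l].
  by move=> lm; rewrite /I' /J' lm; split => //; apply hp; clear -lm; lia.
have psh r : (r < cnt)%N -> pushed a2 b2 ca b1 i m j (fun l => y' (H + 3 * l).+1)
     (fun l => y' (H + 3 * l).+2) I' J' r.
  by move=> rc; rewrite /pushed Ir Jr ar; have [_ -> -> _ _] := ent r rc.
have cnt0 : (0 < cnt)%N by move: hcnt; case: ifP => _ /eqP->; rewrite ?subn_gt0.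
have frst : y' (H + 3 * m)%N = th by have := ent 0%N cnt0; rewrite muln0 addn0 => -[].
have b0 := b1_0 i ik.
case: (ltP 0 (b1 i)) hcnt => [bi|bi] /eqP hcnt; last first.
  have bz : b1 i = 0 by apply/eqP; rewrite eq_le bi b0.
  have i0 : i = 0%N.
    apply/eqP; rewrite -leqn0 leqNgt; apply/negP => ip.
    by have := row_slope_gt0 b1_0 b1S b2l ik ip; rewrite bz ltxx.
  have [m0 j0] := i00 i0.
  rewrite hcnt [in (m + 1)%N]m0 add0n.
  apply: (stack_push_flat C2 po frst bz m0 i0 j0); exact: psh.
rewrite hcnt; apply: (stack_push C2 b1_0 b1S b2l Sk ik po old frst bi); rewrite -hcnt //.
move=> r /andP[r0 rc]; rewrite ar; have [-> _ _ _ _] := ent r rc.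
by case: r r0 {rc}.
Qed.

(** Per column of a row, 34 credits pay for the search, 26 for the push, and 34 stay with the pushed
    line for its later removal. The remainder and the extra column pay for the overhead of the
    row. *)
Definition rows_cost k1 k2 := (100 * (k1 * (k2 + 1)) + 4)%N.

Lemma rows_spec s cr L k1 k2 H P1 P2 (a1 b1 t2 a2 b2 : nat -> R) :
  chain k2 t2 a2 b2 -> 0 < b2 k2.-1 ->
  (forall i, (i < k1)%N -> 0 <= b1 i) -> (forall i, (i.+1 < k1)%N -> b1 i < b1 i.+1) ->
  (0 < k1)%N -> (0 < k2)%N ->
  (nregs <= P1)%N -> (nregs <= P2)%N -> (nregs <= H)%N -> (P1 + 3 * k1 <= H)%N -> (P2 + 3 * k2 <= H)%N ->
  (forall l, (l < k1)%N -> hx s (P1 + 3 * l).+1 = a1 l /\ hx s (P1 + 3 * l).+2 = b1 l) ->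
  (forall l, (l < k2)%N -> [/\ hx s (P2 + 3 * l)%N = t2 l, hx s (P2 + 3 * l).+1 = a2 l & hx s (P2 + 3 * l).+2 = b2 l]) ->
  [/\ rn s 1 = 1%N, rn s 2 = 3%N & rn s 3 = H] ->
  [/\ rn s 13 = (P1 + 3 * k1)%N, rn s 14 = P2, rn s 15 = (P2 + 3 * k2)%N, rn s 16 = P1 & rn s 17 = H] ->
  rx s 10 = 0 ->
  (L + rows_cost k1 k2 <= cr)%N ->
  wp rows s cr (fun s' cr' => exists m I J,
    [/\ stack k2 t2 a2 b2 (fun i => a1 i + rx s 0 * (b1 i - 1)) b1 m k1 (fun l => hx s' (H + 3 * l)%N)
       (fun l => hx s' (H + 3 * l).+1) (fun l => hx s' (H + 3 * l).+2) I J,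
      (forall l, (l < m)%N -> hn s' (H + 3 * l)%N = (P1 + 3 * I l)%N /\ hn s' (H + 3 * l).+1 = (P2 + 3 * J l)%N),
      (forall a, (a < H)%N -> hn s' a = hn s a /\ hx s' a = hx s a),
      [/\ rn s' 17 = (H + 3 * m)%N, forall q, (q < 16)%N -> rn s' q = rn s q & rx s' 10 = 0] &
      (L <= cr')%N]).
Proof.
move=> C2 b2l b1_0 b1S k10 k20 P1K P2K HK P1H P2H.
case: s => r0 h0 x0 y0 /= e1 e2 [r1 r2 r3] [r13 r14 r15 r16 r17] x10.
rewrite /rows_cost => crb.
have mul_le i : (i < k1)%N -> (100 * ((k1 - i) * (k2 + 1)) = 100 * ((k1 - i.+1) * (k2 + 1)) + 100 * (k2 + 1))%N.
  by move=> ik; rewrite -mulnDr -mulSnr subnSK.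
set ca := fun i => a1 i + x0 0%N * (b1 i - 1).
apply: wp_seq; apply: wp_blk; [rewrite /=; clear -crb k10; nia|by run|].
rewrite [size _]/= !(r1, r2, r3, r16) !addn1.
have [A1 B1] := e1 0%N k10; rewrite muln0 addn0 in A1 B1; rewrite A1 B1.
apply: wp_seq; apply: wp_blk; [rewrite /=; clear -crb k10; nia|by run|].
rewrite [size _]/= !(r14, addn0, x10, addr0, subrr).
have c0 := mul_le 0%N k10; rewrite subn0 in c0.
apply: wp_seq; apply: wp_conseq.
  apply: (@push_loop_spec _ _ _ P2 k2 0 H P1) => //=; rewrite ?muln0 ?addn0 //.
  by rewrite /push_cost subn0; clear -crb c0; lia.
rewrite /= => -[r h x y] cr1 [cnt [/= hcnt [R17 fr] fx hp [ent crd]]].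
have fr0 q : (q < 17)%N -> r q = r0 q by move=> hq; rewrite fr //; frame_at q.
have [I0 [J0 [Sk0 ptr0]]] : exists I' J', stack k2 t2 a2 b2 ca b1 (0 + cnt) 1 (fun l => y (H + 3 * l)%N)
     (fun l => y (H + 3 * l).+1) (fun l => y (H + 3 * l).+2) I' J' /\
    (forall l, (l < 0 + cnt)%N -> h (H + 3 * l)%N = (P1 + 3 * I' l)%N /\ h (H + 3 * l).+1 = (P2 + 3 * J' l)%N).
  have po0 := push_ok_first ca b1 C2 (M := 0) (i := 0) (fun l => y0 (H + 3 * l)%N)
     (fun l => y0 (H + 3 * l).+1) (fun l => y0 (H + 3 * l).+2) (erefl _) (erefl _) k20.
  apply: (push_stack (h := h0) (M := 0) (j := 0) C2 b2l b1_0 b1S (stack_nil _ _ _ _ _ _ _ _ _ (fun=> 0%N) (fun=> 0%N)) k10 _ po0) => //.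
  - by rewrite muln0 addn0.
  rewrite muln0 addn0 => q qc; have [-> -> -> -> ->] := ent q qc.
  have [|T A B] := e2 q; last by rewrite !add0n T A B addn0.
  by clear -hcnt qc k20; move: hcnt; case: ifP => _ /eqP h; lia.
rewrite add0n in Sk0 ptr0.
have cnt_le : (cnt <= k2)%N.
  by clear -hcnt k20; move: hcnt; case: ifP => _ /eqP->; rewrite ?subn0.
rewrite /push_cost subn0 in crd.
pose Inv (s' : st R) (cr' : nat) := exists i m I J,
  [/\ (0 < i <= k1)%N /\ stack k2 t2 a2 b2 ca b1 m i (fun l => hx s' (H + 3 * l)%N)
       (fun l => hx s' (H + 3 * l).+1) (fun l => hx s' (H + 3 * l).+2) I J,
      (forall l, (l < m)%N -> hn s' (H + 3 * l)%N = (P1 + 3 * I l)%N /\ hn s' (H + 3 * l).+1 = (P2 + 3 * J l)%N),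
      (forall a, (a < H)%N -> hn s' a = h0 a /\ hx s' a = y0 a),
      [/\ rn s' 17 = (H + 3 * m)%N, forall q, (q < 16)%N -> rn s' q = r0 q,
         rn s' 16 = (P1 + 3 * i)%N, rn s' 24 = (3 * (k1 - i))%N & rx s' 10 = 0 /\ rx s' 0 = x0 0] &
      (L + 100 * ((k1 - i) * (k2 + 1)) + 34 * m + 1 <= cr')%N].
apply: wp_seq; apply: wp_blk; [rewrite /=; clear -crb crd c0; lia|by run|].
rewrite [size _]/= !fr0 // !(r2, r13, r16).
apply: (wp_while (Inv := Inv)) => //; last first.
  exists 1%N, cnt, I0, J0; split => //=.
  - split => //; first by move=> q hq; rewrite -fr0; [frame_at q|clear -hq; lia].
    + by clear; lia.
    + by split; rewrite fx.
  - by clear -crb crd c0 cnt_le; lia.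
move=> {r h x y cr1 cnt hcnt R17 fr fx hp ent crd fr0 I0 J0 Sk0 ptr0 cnt_le c0 A1 B1}.
case=> r h x y cr' [i [m [I [J [/= [/andP[i0 ik1] Sk] ptr hp [R17 fr R16 R24 [X10 X0]] crd]]]]].
split; first by apply: leq_trans crd; rewrite addn1.
split.
  move=> e; have ei : i = k1 by clear -e R24 ik1; lia.
  exists m, I, J; split => //; first by rewrite -ei.
  rewrite -ltnS prednK; last by apply: leq_trans crd; rewrite addn1.
  apply: leq_trans crd; rewrite addn1 ltnS -addnA; exact: leq_addr.
move=> nz; have ik : (i < k1)%N by clear -nz R24; lia.
have R1 := fr 1%N isT; have R2 := fr 2%N isT; have R3 := fr 3%N isT.
have R13 := fr 13%N isT; have R15 := fr 15%N isT.
rewrite r1 in R1; rewrite r2 in R2; rewrite r3 in R3; rewrite r13 in R13; rewrite r15 in R15.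
have ci := mul_le i ik.
have [X eX] : exists X, X = ((k1 - i.+1) * (k2 + 1))%N by exists ((k1 - i.+1) * (k2 + 1))%N.
rewrite ci -eX in crd.
have [A1 B1] := e1 i ik.
have A1' : y (P1 + 3 * i).+1 = a1 i by rewrite -A1; apply hp; clear -ik P1H; lia.
have B1' : y (P1 + 3 * i).+2 = b1 i by rewrite -B1; apply hp; clear -ik P1H; lia.
apply: wp_seq; apply: wp_blk; [rewrite /=; clear -crd; lia|by run|].
rewrite [size _]/= !(R1, R2, R3, R16) !addn1 A1' B1' X0 -[a1 i + _]/(ca i).
apply: wp_seq; apply: wp_blk; [rewrite /=; clear -crd; lia|by run|].
rewrite [size _]/= R15 R2.
have -> : (P2 + 3 * k2 - 3 = P2 + 3 * k2.-1)%N by clear -k20; lia.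
have e2' l : (l < k2)%N -> [/\ y (P2 + 3 * l)%N = t2 l, y (P2 + 3 * l).+1 = a2 l & y (P2 + 3 * l).+2 = b2 l].
  by move=> lk; have [<- <- <-] := e2 l lk; split; apply hp; clear -lk P2H; lia.
apply: wp_seq; apply: wp_conseq.
  apply: (@event_loop_spec _ _ _ (L + 100 * X + 62 * k2 + 10) k1 k2 ca b1 i m H P2 _ _ _ _ _ _ I J C2 b2l b1_0 b1S Sk k20) => //=.
  - by rewrite i0.
  - by rewrite /event_cost; clear -crd; lia.
rewrite /= /event_cost => -[r' h' x' y'] cr1 [m' [j [th [/= po [X3' fx'] [R17' R18' fr'] [eh' ey'] crd1]]]].
have fr1 q : (q < 17)%N -> r' q = r q by move=> hq; rewrite fr' //; frame_at q.
rewrite {}eh' {}ey' {h' y'}.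
have jk := po_j po.
apply: wp_seq; apply: wp_conseq.
  apply: (@push_loop_spec _ _ _ P2 k2 j (H + 3 * m') (P1 + 3 * i)) => //=; rewrite ?fr1 //.
  - by clear -P2H; lia.
  - by rewrite fx'.
  - by rewrite /push_cost; clear -crd1; lia.
rewrite /= => -[r2' h2 x2 y2] cr2 [cnt [/= hcnt [R17'' fr2] fx2 hp2 [ent crd2]]].
rewrite /push_cost in crd2.
have bE : x' 2%N = b1 i by rewrite fx'.
have cE : x' 1%N = ca i by rewrite fx'.
rewrite bE cE X3' in hcnt ent.
have cnt_le : (cnt <= k2)%N.
  by clear -hcnt jk k20; move: hcnt; case: ifP => _ /eqP->; lia.
have [I' [J' [Sk' ptr']]] : exists I' J', stack k2 t2 a2 b2 ca b1 (m' + cnt) i.+1 (fun l => y2 (H + 3 * l)%N)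
     (fun l => y2 (H + 3 * l).+1) (fun l => y2 (H + 3 * l).+2) I' J' /\
    (forall l, (l < m' + cnt)%N -> h2 (H + 3 * l)%N = (P1 + 3 * I' l)%N /\ h2 (H + 3 * l).+1 = (P2 + 3 * J' l)%N).
  apply: (push_stack (h := h) C2 b2l b1_0 b1S Sk ik _ po ptr hcnt hp2) => //.
    by move=> z; move: i0; rewrite z.
  move=> q qc; have [-> -> -> -> ->] := ent q qc.
  have [|T A B] := e2' (j + q)%N; last by rewrite T A B.
  by clear -hcnt qc jk; move: hcnt; case: ifP => _ /eqP h; lia.
apply: wp_blk; [rewrite /=; clear -crd1 crd2; lia|by run|].
have fr3 q : (q < 17)%N -> r2' q = r q by move=> hq; rewrite fr2 // fr1.
rewrite [size _]/= !fr3 // !(R16, R2, R13).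
split; first by clear -crd1 crd2; lia.
exists i.+1, (m' + cnt)%N, I', J'; split => //=.
- by move=> q qH; have [<- <-] := hp q qH; apply: hp2; clear -qH; lia.
- split => //.
  + by rewrite R17''; clear; lia.
  + by move=> q hq; rewrite -fr // -fr3; [frame_at q|clear -hq; lia].
  + by clear; lia.
  + by clear; lia.
  + by split; rewrite fx2 // fx'.
- by rewrite -eX; clear -crd1 crd2 cnt_le jk; lia.
Qed.

End Rows.

(** * The complete program *)

(** The merged envelope goes to the end of the heap and the parent's table entries are redirected to
    it. The old envelopes stay, since the sets of the new lines are pointers into them. *)
Definition merge_into_parent : cmd :=
  Seq (Blk [:: NAdd 20 4 11; NLoad 12 20; NAdd 20 6 11; NLoad 16 20; NAdd 20 7 11; NLoad 13 20;
               NAdd 20 6 12; NLoad 14 20; NAdd 20 7 12; NLoad 15 20;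
               NAdd 20 8 11; NAdd 20 20 11; NAdd 20 20 11; RLoad 0 20;
               NConst 20 0; NAdd 17 3 20])
  (Seq rows
  (Blk [:: NAdd 20 6 12; NStore 20 3; NAdd 20 7 12; NStore 20 17; NConst 20 0; NAdd 3 17 20])).

(** * Memory layout and the merge of one node *)

Section Layout.
Variable n : nat.

(** High enough to clear the registers, the original input and the flags. *)
Definition inputs := (4 * n.+1 + 64)%N.
Definition depths := (inputs + 3 * n.+1)%N.
Definition firsts := (inputs + 4 * n.+1)%N.
Definition lasts := (inputs + 5 * n.+1)%N.
Definition entries := (inputs + 6 * n.+1)%N.
(** This is [32 + 2 * (n.+2 + v)]: twice the output address of [v], shifted past the registers. *)
Definition flag (v : nat) := (2 * n.+1 + 34 + 2 * v)%N.

(* An entry with a zero first field is a leaf, whose second field is the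
   address to mark; entries for the empty set mark register 9. *)
Inductive dag (h : nat -> nat) (H : nat) : nat -> {set 'I_n.+1} -> nat -> Prop :=
| dag_nil e : (entries <= e)%N -> (e.+1 < H)%N -> h e = 0%N -> h e.+1 = 9%N -> dag h H e set0 1
| dag_leaf e (v : 'I_n.+1) : (entries <= e)%N -> (e.+1 < H)%N -> h e = 0%N -> h e.+1 = flag v ->
    dag h H e [set v] 1
| dag_node e A B i j : (entries <= e)%N -> (e.+1 < H)%N ->
    dag h H (h e) A i -> dag h H (h e.+1) B j -> dag h H e (A :|: B) (i + j).

Lemma dag_ge h H e A i : dag h H e A i -> (entries <= e)%N.
Proof. by case. Qed.

Lemma dag_pos h H e A i : dag h H e A i -> (0 < i)%N.
Proof. by elim=> // *; rewrite addn_gt0; apply/orP; left. Qed.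

Lemma dag_frame h h' H H' e A i : dag h H e A i -> (H <= H')%N ->
  (forall a, (entries <= a < H)%N -> h' a = h a) -> dag h' H' e A i.
Proof.
move=> D HH fr; elim: D => {e A i}.
- move=> e lo hi e1 e2; apply: dag_nil => //; first exact: leq_trans hi HH.
    by rewrite fr // lo (ltn_trans _ hi).
  by rewrite fr // hi andbT (leq_trans lo).
- move=> e v lo hi e1 e2; apply: dag_leaf => //; first exact: leq_trans hi HH.
    by rewrite fr // lo (ltn_trans _ hi).
  by rewrite fr // hi andbT (leq_trans lo).
move=> e A B i j lo hi _ d1 _ d2; apply: dag_node => //; first exact: leq_trans hi HH.
  by rewrite fr // lo (ltn_trans _ hi).
by rewrite fr // hi andbT (leq_trans lo).
Qed.

End Layout.

Section MergeSpec.
Variables (R : realType) (n : nat) (par : 'I_n.+1 -> 'I_n.+1) (w pi p : 'I_n.+1 -> R).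
Hypothesis tree : is_rooted_tree par.
Hypothesis pi01 : forall v, 0 < pi v <= 1.
Hypothesis w0 : forall v, 0 <= w v.
Implicit Types (s : st R) (Mg : {set 'I_n.+1}).

(** [q] counts the leaves of the union expression of a set. Its bound keeps the final traversal
    linear although entries of the DAG are shared. *)
Definition node_ok s H Mg (v : 'I_n.+1) := exists P k F,
  [/\ hn s (firsts n + v)%N = P, hn s (lasts n + v)%N = (P + 3 * k)%N,
     (entries n <= P)%N /\ (P + 3 * k <= H)%N,
     opt_chain par w pi p (blob par Mg v) (blob par Mg v :\ v) k
       (fun l => hx s (P + 3 * l)%N) (fun l => hx s (P + 3 * l).+1) (fun l => hx s (P + 3 * l).+2) F &
     forall l, (l < k)%N -> exists2 q, (q <= #|blob par Mg v|)%N & dag (hn s) H (P + 3 * l)%N (F l) q].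

(** The parent table leaves out the root: its natural cell is register 1, which is overwritten as
    scratch space before it can be saved. *)
Record consts s H : Prop := Consts {
  cs_0 : rn s 0 = n.+1;
  cs_1 : rn s 1 = 1%N;
  cs_2 : rn s 2 = 3%N;
  cs_3 : rn s 3 = H;
  cs_4 : rn s 4 = (inputs n).+1;
  cs_5 : rn s 5 = depths n;
  cs_6 : rn s 6 = firsts n;
  cs_7 : rn s 7 = lasts n;
  cs_8 : rn s 8 = inputs n;
  cs_10 : rx s 10 = 0;
  cs_H : (entries n <= H)%N;
  cs_par : forall c : 'I_n.+1, c != ord0 -> hn s ((inputs n).+1 + c)%N = par c;
  cs_w : forall v : 'I_n.+1, hx s (inputs n + 3 * v)%N = w v;
  cs_pi : forall v : 'I_n.+1, hx s (inputs n + 3 * v).+1 = pi v;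
  cs_p : forall v : 'I_n.+1, hx s (inputs n + 3 * v).+2 = p v }.

Record merged s H Mg : Prop := Merged {
  mg_consts : consts s H;
  mg_depth : forall v : 'I_n.+1, hn s (depths n + v)%N = depth tree v;
  mg_flag : forall v : 'I_n.+1, hn s (flag n v) = 0%N;
  mg_node : forall v, v \notin Mg -> node_ok s H Mg v }.

Lemma node_ok_frame s s' H H' Mg Mg' v : node_ok s H Mg v -> (H <= H')%N ->
  blob par Mg' v = blob par Mg v ->
  hn s' (firsts n + v)%N = hn s (firsts n + v)%N -> hn s' (lasts n + v)%N = hn s (lasts n + v)%N ->
  (forall a, (entries n <= a < H)%N -> hn s' a = hn s a /\ hx s' a = hx s a) ->
  node_ok s' H' Mg' v.
Proof.
move=> [P [k [F [eP eE [lo hi] oc dg]]]] HH eB f1 f2 fr.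
exists P, k, F; rewrite eB f1 f2; split => //.
- by split => //; apply: leq_trans hi HH.
- apply: opt_chain_ext oc _ => l lk; split; apply fr; clear -lk lo hi; lia.
move=> l lk; have [q qB d] := dg l lk; exists q => //.
by apply: dag_frame d HH _ => a ha; apply fr.
Qed.

Lemma opt_chain_blob Mg c k1 (t1 a1 b1 : nat -> R) F1 k2 t2 a2 b2 F2 m t a b I J F :
  ord0 \notin Mg -> c \notin Mg -> c != ord0 -> (forall u, u != ord0 -> par u = c -> u \in Mg) ->
  opt_chain par w pi p (blob par Mg c) (blob par Mg c :\ c) k1 t1 a1 b1 F1 ->
  opt_chain par w pi p (blob par Mg (par c)) (blob par Mg (par c) :\ par c) k2 t2 a2 b2 F2 ->
  stack k2 t2 a2 b2 (fun i => a1 i + w c * (b1 i - 1)) b1 m k1 t a b I J ->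
  (forall l, (l < m)%N -> F l = F1 (I l) :|: F2 (J l)) ->
  opt_chain par w pi p (blob par (c |: Mg) (par c)) (blob par (c |: Mg) (par c) :\ par c) m t a b F.
Proof.
move=> Mg0 cM c0 ch; rewrite (blob_subtree tree Mg0 cM c0 ch) (blob_merge par Mg c).
move=> o1 o2 sk EF.
have dis := merge_disjoint tree Mg0 cM c0.
have npc := nanc_par tree Mg0 cM c0.
have cB : c \notin blob par Mg (par c).
  apply/negP => h; have := blob_not_below tree Mg0 cM c0 h.
  by rewrite anc_refl.
have pT : par c \notin subtree par c by rewrite inE.
have cpc : c != par c by apply: contraNneq npc => <-; apply: anc_refl.
have -> : (subtree par c :|: blob par Mg (par c)) :\ par c =
    c |: ((subtree par c :\ c) :|: (blob par Mg (par c) :\ par c)).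
  apply/setP => s; rewrite !inE; have [->|sc] := eqVneq s c; first by rewrite anc_refl; move: cpc; case: eqP.
  have [->|//] := eqVneq s (par c).
  by rewrite (negbTE npc).
apply: (opt_chain_merge pi01 w0 _ _ _ _ _ _ _ o1 o2 sk EF) => //.
- by apply: disjointW dis; apply: subD1set.
- by rewrite !inE eqxx.
- by rewrite in_setD1 (negbTE cB) andbF.
- move=> s u sB; rewrite in_setD1 => /andP[up uB].
  exact (subtree_blob_disjoint tree Mg0 cM c0 uB sB up).
- move=> s u sB uT; apply/negP => su.
  have uc : anc par u c.
    by move: uT; rewrite !inE => /orP[/eqP->|/andP[_ //]]; apply: anc_refl.
  have := blob_not_below tree Mg0 cM c0 sB; by rewrite (anc_trans tree su uc).
- by move=> s; rewrite inE.
Qed.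

Definition merge_bound c := (660 * (#|subtree par c| * #|subtree par (par c) :\: subtree par c|))%N.

Lemma merge_spec s cr L H Mg (c : 'I_n.+1) :
  merged s H Mg -> ord0 \notin Mg -> c \notin Mg -> c != ord0 ->
  (forall u, u != ord0 -> par u = c -> u \in Mg) -> par c \notin Mg ->
  rn s 11 = c -> (L + merge_bound c <= cr)%N ->
  wp merge_into_parent s cr (fun s' cr' => exists H',
    [/\ merged s' H' (c |: Mg), rn s' 10 = rn s 10 /\ rn s' 11 = c & (L <= cr')%N]).
Proof.
case: s => r0 h0 x0 y0 mgd Mg0 cM c0 ch pcM /= r11 crb.
have [cs dep flg nod] := mgd.
have [P1 [k1 [F1 [eP1 eE1 [lo1 hi1] o1 d1]]]] := nod c cM.
have [P2 [k2 [F2 [eP2 eE2 [lo2 hi2] o2 d2]]]] := nod (par c) pcM.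
have := cs => -[/= e0 e1 e2 e3 e4 e5 e6 e7 e8 x10 eH epar ew epi ep].
rewrite /= in eP1 eE1 o1 d1 eP2 eE2 o2 d2 dep flg.
have cn := ltn_ord c; have pn := ltn_ord (par c).
have K0 : (nregs <= inputs n)%N by rewrite /nregs /inputs; clear; lia.
have ef : firsts n = (inputs n + 4 * n.+1)%N by [].
have el : lasts n = (inputs n + 5 * n.+1)%N by [].
have ee : entries n = (inputs n + 6 * n.+1)%N by [].
have k10 : (0 < k1)%N by case/andP: (oc_k o1).
have k20 : (0 < k2)%N by case/andP: (oc_k o2).
have bud : (100 * (k1 * (k2 + 1)) + 40 <= merge_bound c)%N.
  have k1B : (k1 <= #|blob par Mg c|.+1)%N by case/andP: (oc_k o1).
  have k2B : (k2 <= #|blob par Mg (par c)|.+1)%N by case/andP: (oc_k o2).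
  have T0 : (0 < #|subtree par c|)%N.
    by apply/card_gt0P; exists c; rewrite inE anc_refl.
  have B0 : (0 < #|blob par Mg (par c)|)%N.
    by apply/card_gt0P; exists (par c); apply/blobP; left.
  have BB := subset_leq_card (blob_parent_sub tree Mg0 cM c0).
  rewrite (blob_subtree tree Mg0 cM c0 ch) in k1B; rewrite /merge_bound.
  (* The child has at most twice as many lines as nodes, and the parent's number of lines plus one
     is at most three times its number of nodes: 600 per pair of nodes, and 40 for the overhead. *)
  move: (#|subtree par c|) (#|blob par Mg (par c)|) (#|_|) k1B k2B T0 B0 BB => x y z; clear; nia.
apply: wp_seq; apply: wp_blk; [rewrite /=; clear -crb bud; lia| |].
  by run1; run1; rewrite e4 r11 (epar _ c0); run.
rewrite [size _]/= !(r11, e6, e7, e8, e3, eP1, eE1, eP2, eE2, addn0).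
have -> : (inputs n + c + c + c = inputs n + 3 * c)%N by clear; lia.
rewrite ew.
have f2 : (nregs <= entries n)%N by clear -K0 ee; lia.
apply: wp_seq; apply: wp_conseq.
  apply: (@rows_spec R _ _ (L + 16) k1 k2 H P1 P2 (fun l => y0 (P1 + 3 * l).+1)
      (fun l => y0 (P1 + 3 * l).+2) (fun l => y0 (P2 + 3 * l)%N) (fun l => y0 (P2 + 3 * l).+1)
      (fun l => y0 (P2 + 3 * l).+2)) => //=.
  - exact: oc_chain o2.
  - exact: oc_last o2.
  - by move=> i ik; apply: chain_b_ge0 (oc_chain o1) ik.
  - by move=> i ik; apply: (chain_bS (oc_chain o1)) ik.
  - exact: leq_trans f2 lo1.
  - exact: leq_trans f2 lo2.
  - exact: leq_trans f2 eH.
  - by rewrite /rows_cost; clear -crb bud; lia.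
rewrite /= => -[r h x y] cr' [m [I [J [/= sk ptr fr [R17 frr X10] crd]]]].
have frr' q : (q < 12)%N -> r q = r0 q by move=> hq; rewrite frr; [frame_at q|clear -hq; lia].
have R12 : r 12%N = par c by rewrite frr.
have uc : (nat_of_ord (par c) < n.+1)%N by [].
have [R6 R7 R3] : [/\ r 6%N = firsts n, r 7%N = lasts n & r 3%N = H].
  by split; rewrite frr'.
apply: wp_blk; [rewrite /=; clear -crd; lia|by run|].
rewrite [size _]/= !(R12, R6, R7, R3, R17, addn0).
set h' := upd _ _ _.
have hfr a : (a != firsts n + par c)%N -> (a != lasts n + par c)%N -> h' a = h a.
  by move=> q1 q2; rewrite /h' !updE (negbTE q1) (negbTE q2).
have h'1 : h' (firsts n + par c)%N = H.
  by rewrite /h' !updE eqxx; case: eqP => // q; exfalso; clear -q ef el uc; lia.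
have h'2 : h' (lasts n + par c)%N = (H + 3 * m)%N by rewrite /h' !updE eqxx.
have m0 := stk_pos sk k10.
exists (H + 3 * m)%N; split; last by clear -crd; lia.
  split; last first.
  - move=> v; rewrite in_setU1 negb_or => /andP[vc vM]; have vn := ltn_ord v.
    have [->|vp] := eqVneq v (par c); last first.
      apply: (node_ok_frame (nod v vM)) => /=.
      + exact: leq_addr.
      + exact: blob_other.
      + rewrite hfr; [|by rewrite eqn_add2l|clear -ef el pn vn; lia].
        by case: (fr (firsts n + v)%N) => //; clear -ef ee eH vn; lia.
      + rewrite hfr; [|clear -ef el pn vn; lia|by rewrite eqn_add2l].
        by case: (fr (lasts n + v)%N) => //; clear -el ee eH vn; lia.
      + move=> q /andP[q1 q2]; rewrite hfr; [|clear -ef ee pn q1; lia|clear -el ee pn q1; lia].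
        exact: fr.
    have dE e (A : {set 'I_n.+1}) i : dag h0 H e A i -> dag h' (H + 3 * m) e A i.
      move=> d; apply: (dag_frame d); first exact: leq_addr.
      move=> q /andP[q1 q2]; rewrite hfr; [|clear -ef ee pn q1; lia|clear -el ee pn q1; lia].
      by case: (fr q q2).
    exists H, m, (fun l => F1 (I l) :|: F2 (J l)); split => //.
    + by apply: (opt_chain_blob Mg0 cM c0 ch o1 o2 sk).
    + move=> l lm /=; have [q1 q1B q1d] := d1 _ (stk_I sk lm).
      have [q2 q2B q2d] := d2 _ (stk_J sk lm).
      have [p1 p2] := ptr l lm.
      exists (q1 + q2)%N.
        rewrite (blob_merge par Mg c) -(blob_subtree tree Mg0 cM c0 ch) cardsU disjoint_setI0; last first.
          by rewrite (blob_subtree tree Mg0 cM c0 ch); apply: merge_disjoint.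
        by rewrite cards0 subn0; apply: leq_add.
      apply: dag_node.
      * by clear -eH; lia.
      * by clear -lm; lia.
      * by rewrite hfr ?p1; [exact: dE|clear -eH ef ee pn; lia|clear -eH el ee pn; lia].
      * by rewrite hfr ?p2; [exact: dE|clear -eH ef ee pn; lia|clear -eH el ee pn; lia].
  - move=> v /=; have vn := ltn_ord v.
    have fE : flag n v = (2 * n.+1 + 34 + 2 * v)%N by [].
    have iE : inputs n = (4 * n.+1 + 64)%N by [].
    rewrite hfr; [|clear -ef fE iE vn; lia|clear -el fE iE vn; lia].
    by case: (fr (flag n v)) => [|-> //]; clear -fE iE ee eH vn; lia.
  - move=> v /=; have vn := ltn_ord v.
    have dE : depths n = (inputs n + 3 * n.+1)%N by [].
    rewrite hfr; [|clear -ef dE vn; lia|clear -el dE vn; lia].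
    by case: (fr (depths n + v)%N) => [|-> //]; clear -dE ee eH vn; lia.
  split; rewrite /= ?frr' //.
  - by apply: leq_trans eH _; apply: leq_addr.
  - move=> v v0; have vn := ltn_ord v; rewrite hfr; [|clear -ef vn; lia|clear -el vn; lia].
    by case: (fr ((inputs n).+1 + v)%N) => [|-> _]; [clear -ee eH vn; lia|exact: epar].
  - move=> v; have vn := ltn_ord v.
    by case: (fr (inputs n + 3 * v)%N) => [|_ -> //]; clear -ee eH vn; lia.
  - move=> v; have vn := ltn_ord v.
    by case: (fr (inputs n + 3 * v).+1) => [|_ -> //]; clear -ee eH vn; lia.
  - move=> v; have vn := ltn_ord v.
    by case: (fr (inputs n + 3 * v).+2) => [|_ -> //]; clear -ee eH vn; lia.
by rewrite /= !frr'.
Qed.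

End MergeSpec.

(** * Order of the merges *)

Definition merge_level : cmd :=
  Seq (Blk [:: NConst 11 1; NSub 25 0 11])
  (While 25 (Seq (Blk [:: NAdd 20 5 11; NLoad 21 20; NSub 22 21 10; NSub 23 10 21; NAdd 22 22 23])
            (Seq (If 22 (Blk [::]) merge_into_parent) (Blk [:: NAdd 11 11 1; NSub 25 0 11])))).

(** Scanning all nodes once per depth puts children before parents in quadratic time, without
    sorting. Each scan starts at node 1, as node 0 is the root. *)
Definition merge_all : cmd :=
  Seq (Blk [:: NSub 10 0 1]) (While 10 (Seq merge_level (Blk [:: NSub 10 10 1]))).

Section MergeAll.
Variables (R : realType) (n : nat) (par : 'I_n.+1 -> 'I_n.+1) (w pi p : 'I_n.+1 -> R).
Hypothesis tree : is_rooted_tree par.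
Hypothesis pi01 : forall v, 0 < pi v <= 1.
Hypothesis w0 : forall v, 0 <= w v.
Implicit Types (s : st R) (Mg : {set 'I_n.+1}).

Definition done_set (d v : nat) : {set 'I_n.+1} :=
  [set u : 'I_n.+1 | (u != ord0) && ((d < depth tree u)%N || ((depth tree u == d) && (u < v)%N))].

(** The budget that the loop invariants reserve for the merges still to come; at the start it is
    bounded through [merge_pairs]. *)
Definition pending Mg := (\sum_(c | (c != ord0) && (c \notin Mg)) merge_bound par c)%N.

Lemma pending_merge Mg c : c != ord0 -> c \notin Mg ->
  pending Mg = (merge_bound par c + pending (c |: Mg))%N.
Proof.
move=> c0 cM; rewrite /pending (bigD1 c) ?c0 //=; congr (_ + _)%N.
apply: eq_bigl => u; rewrite in_setU1 negb_or -andbA; congr (_ && _).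
by rewrite andbC.
Qed.

Lemma done_set_step d (v : 'I_n.+1) : v != ord0 ->
  done_set d v.+1 = if depth tree v == d then v |: done_set d v else done_set d v.
Proof.
move=> v0; case: ifP => h; apply/setP => u; rewrite !inE [(u < v.+1)%N]ltnS [(u <= v)%N]leq_eqVlt.
  have [->|uv] := eqVneq u v; first by rewrite v0 h /= ?eqxx ?orbT.
  by rewrite (_ : (u == v :> nat) = false) //; apply/negbTE.
have [->|uv] := eqVneq u v; first by rewrite h.
by rewrite (_ : (u == v :> nat) = false) //; apply/negbTE.
Qed.

Lemma done_set_next d : done_set d.+1 n.+1 = done_set d 1.
Proof.
apply/setP => u; rewrite !inE ltn_ord andbT.
have [->//|u0] := eqVneq u ord0; rewrite /=.
rewrite (_ : (u < 1)%N = false) ?andbF ?orbF; first by rewrite eq_sym orbC -leq_eqVlt.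
by rewrite ltnS leqn0; apply/negbTE.
Qed.

Lemma done_set_init : done_set n 1 = set0.
Proof.
apply/setP => u; rewrite !inE; apply/negP => /andP[u0].
rewrite ltnNge (depth_le tree u) /= ltnS leqn0 => /andP[_ h].
by case/negP: u0; apply/eqP/val_inj/eqP.
Qed.

Lemma done_set_final : done_set 0 1 = [set~ ord0].
Proof.
apply/setP => u; rewrite !inE; have [->//|u0] := eqVneq u ord0.
by rewrite (depth_gt0 tree) u0.
Qed.

Lemma merge_level_spec s cr L H d : (0 < d)%N ->
  merged w pi p tree s H (done_set d 1) -> rn s 10 = d ->
  (L + pending (done_set d 1) + 20 * n.+1 + 10 <= cr)%N ->
  wp merge_level s cr (fun s' cr' => exists H',
    [/\ merged w pi p tree s' H' (done_set d n.+1), rn s' 10 = d &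
       (L + pending (done_set d n.+1) <= cr')%N]).
Proof.
case: s => r0 h0 x0 y0 d0 mgd /= r10 crb.
apply: wp_seq; apply: wp_blk; [rewrite /=; clear -crb; lia|by run|].
have r00 := cs_0 (mg_consts mgd); rewrite /= in r00.
rewrite [size _]/= r00.
pose Inv (s' : st R) (cr' : nat) := exists (v H' : nat),
  [/\ (0 < v <= n.+1)%N, merged w pi p tree s' H' (done_set d v),
     rn s' 10 = d /\ rn s' 11 = v, rn s' 25 = (n.+1 - v)%N &
     (L + pending (done_set d v) + 20 * (n.+1 - v) + 1 <= cr')%N].
apply: (wp_while (Inv := Inv)) => //; last first.
  exists 1%N, H; split => //=; last by clear -crb; lia.
  case: mgd => -[/= c0 c1 c2 c3 c4 c5 c6 c7 c8 c10 cH cp cw cpi cpp] md mf mn.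
  by split.
case=> r h x y cr' [v [H' [/= /andP[v0 vn] mg [R10 R11] R25 crd]]].
split; first by clear -crd; lia.
split.
  move=> e; have vE : v = n.+1 by clear -e R25 vn; lia.
  by exists H'; rewrite vE in mg crd; split => //; clear -crd; lia.
move=> nz; have vlt : (v < n.+1)%N by clear -nz R25; lia.
pose c : 'I_n.+1 := Ordinal vlt.
have c0 : c != ord0 by rewrite -val_eqE /= -lt0n.
have R5 := cs_5 (mg_consts mg); have R00 := cs_0 (mg_consts mg).
have dc := mg_depth mg c; rewrite /= in R5 R00 dc.
have R1 := cs_1 (mg_consts mg); rewrite /= in R1.
have vS : (n.+1 - v = (n.+1 - v.+1).+1)%N by clear -vlt; lia.
have depE : depths n = (4 * n.+1 + 64 + 3 * n.+1)%N by [].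
have nE : nregs = 32%N by [].
apply: wp_seq; apply: wp_blk; [rewrite /=; clear -crd vS; lia| |].
  run1; apply: ex_nload => //=; last by run.
  by rewrite R5; clear -depE nE; lia.
rewrite [size _]/= !(R5, R10, R11) dc.
have st_ok Mg r' h' x' y' H'' : merged w pi p tree (St r' h' x' y') H'' Mg ->
   forall r2, (forall q, (q < 10)%N -> r2 q = r' q) -> merged w pi p tree (St r2 h' x' y') H'' Mg.
  case=> -[/= c1' c2' c3' c4' c5' c6' c7' c8' c9' c10' cH cp cw cpi cpp] md mf mn r2 e.
  by split => //; split => //=; rewrite e.
have crd' := crd.
have stp := done_set_step d c0; rewrite /= in stp.
apply: wp_seq; apply: wp_if => [//|/=|/= dne|/= deq]; first by clear -crd vS; lia.
  apply: wp_blk; [by []|exact: ex_nil|].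
  apply: wp_blk; [rewrite /=; clear -crd vS; lia|by run|].
  rewrite [size _]/= /= R00 R11 R1 addn1.
  have ned : (depth tree c == d) = false by apply/eqP => ed; move: dne; rewrite ed subnn.
  rewrite ned in stp.
  split; first by clear -crd vS; lia.
  exists v.+1, H'; rewrite stp; split => //=.
  - by apply: st_ok mg _ _; frame.
  - by clear -crd vS; lia.
have ed : depth tree c = d by clear -deq; lia.
rewrite ed eqxx in stp.
have cM : c \notin done_set d v by rewrite !inE ed ltnn eqxx /= ltnn andbF.
rewrite (pending_merge c0 cM) -stp in crd.
apply: wp_conseq.
  apply: (@merge_spec R n par w pi p tree pi01 w0 _ _ (L + pending (done_set d v.+1) + 20 * (n.+1 - v.+1) + 10) H' (done_set d v) c).
  - by apply: st_ok mg _ _; frame.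
  - by rewrite !inE eqxx.
  - exact: cM.
  - exact: c0.
  (* Children have depth [d.+1] and are done; the parent has depth [d.-1] and is not. *)
  - move=> u u0 pu; rewrite !inE u0; apply/orP; left.
    have := depth_par tree u; rewrite pu ed => ->.
    by have := depth_gt0 tree u; rewrite u0; case: (depth tree u).
  - rewrite !inE; have := depth_par tree c; rewrite ed => ->.
    by rewrite negb_and; apply/orP; right; clear -d0; lia.
  - by [].
  - by clear -crd vS; lia.
rewrite /= => -[r2 h2 x2 y2] cr2 [H2 [/= mg2 [R10' R11'] crd2]].
rewrite -stp in mg2.
have R00' := cs_0 (mg_consts mg2); have R1' := cs_1 (mg_consts mg2); rewrite /= in R00' R1'.
apply: wp_blk; [rewrite /=; clear -crd2; lia|by run|].
rewrite [size _]/= /= R00' R11' R1' addn1.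
split; first by clear -crd2; lia.
exists v.+1, H2; split => //=.
- by apply: st_ok mg2 _ _; frame.
- by rewrite R10' R10.
- by clear -crd2; lia.
Qed.

Lemma merge_all_spec s cr L H :
  merged w pi p tree s H set0 ->
  (L + 660 * n.+1 ^ 2 + (20 * n.+1 + 20) * n.+1 + 10 <= cr)%N ->
  wp merge_all s cr (fun s' cr' => exists H',
    merged w pi p tree s' H' [set~ ord0] /\ (L <= cr')%N).
Proof.
case: s => r0 h0 x0 y0; rewrite -done_set_init => mgd crb.
have r00 := cs_0 (mg_consts mgd); have r1 := cs_1 (mg_consts mgd); rewrite /= in r00 r1.
apply: wp_seq; apply: wp_blk; [rewrite /=; clear -crb; lia|by run|].
rewrite [size _]/= r00 r1 subn1 /=.
have st_ok Mg r' h' x' y' H'' : merged w pi p tree (St r' h' x' y') H'' Mg ->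
   forall r2, (forall q, (q < 10)%N -> r2 q = r' q) -> merged w pi p tree (St r2 h' x' y') H'' Mg.
  case=> -[/= c1' c2' c3' c4' c5' c6' c7' c8' c9' c10' cH cp cw cpi cpp] md mf mn r2 e.
  by split => //; split => //=; rewrite e.
have pend0 : (pending (done_set n 1) <= 660 * n.+1 ^ 2)%N.
  rewrite done_set_init /pending /merge_bound -big_distrr /= leq_mul2l.
  apply: leq_trans (merge_pairs tree); rewrite (eq_bigl (fun c => c != ord0)) //.
  by move=> u; rewrite in_set0 andbT.
pose Inv (s' : st R) (cr' : nat) := exists (d H' : nat),
  [/\ merged w pi p tree s' H' (done_set d 1),
     rn s' 10 = d &
     (L + pending (done_set d 1) + (20 * n.+1 + 20) * d + 1 <= cr')%N].
apply: (wp_while (Inv := Inv)) => //; last first.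
  exists n, H; split => //=; first by apply: st_ok mgd _ _; frame.
  by clear -crb pend0; nia.
case=> r h x y cr' [d [H' [/= mg R10 crd]]].
split; first by clear -crd; lia.
split.
  move=> e; rewrite R10 in e; rewrite e done_set_final in mg; exists H'; split => //.
  by clear -crd; lia.
rewrite R10 => nz; have d0 : (0 < d)%N by rewrite lt0n.
have [d' ed] : exists d', d = d'.+1 by exists d.-1; rewrite prednK.
apply: wp_seq; apply: wp_conseq.
  apply: (@merge_level_spec _ _ (L + (20 * n.+1 + 20) * d' + 8) H' d) => //.
  by clear -crd ed; nia.
rewrite /= => -[r2 h2 x2 y2] cr2 [H2 [mg2 /= R10' crd2]].
have R1' := cs_1 (mg_consts mg2); rewrite /= in R1'.
apply: wp_blk; [rewrite /=; clear -crd2; lia|by run|].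
rewrite [size _]/= /= R10' R1' ed subn1 /=.
rewrite ed done_set_next in mg2 crd2.
split; first by clear -crd2; lia.
exists d', H2; split => //=; first by apply: st_ok mg2 _ _; frame.
- by clear; lia.
- by clear -crd2; lia.
Qed.

End MergeAll.

(** * Moving the input out of the registers *)

Definition save_register (a : nat) : seq instr :=
  [:: NConst 1 (64 + a); NAdd 1 1 0; NAdd 1 1 0; NAdd 1 1 0; NAdd 1 1 0; NStore 1 a; RStore 1 a].

Definition save_registers : seq instr := flatten [seq save_register a | a <- iota 0 32].

Definition set_constants : seq instr :=
  [:: NConst 1 1; NConst 2 3; NConst 8 64; NAdd 8 8 0; NAdd 8 8 0; NAdd 8 8 0; NAdd 8 8 0;
      NAdd 4 8 1; NAdd 21 0 0; NAdd 21 21 0; NAdd 5 8 21; NAdd 6 5 0; NAdd 7 6 0; NAdd 3 7 0;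
      RSub 10 10 10; NConst 16 32; NSub 25 21 16].

(* The input overlaps the registers, so it is first copied upwards; the
   first 32 cells are saved by straight-line code that only uses register 1. *)
Definition relocate_input : cmd :=
  Seq (Blk save_registers) (Seq (Blk set_constants)
  (While 25 (Blk [:: NLoad 20 16; NAdd 22 8 16; NStore 22 20; RLoad 4 16; RStore 22 4;
     NAdd 16 16 1; NSub 25 21 16]))).

Section Relocate.
Variable R : realType.
Implicit Types (s : st R).

Lemma ex_cat l1 l2 s s1 s2 : ex l1 s s1 -> ex l2 s1 s2 -> ex (l1 ++ l2) s s2.
Proof. by move=> e; elim: e s2 => //= i l s' s'' ok e IH s2 h; apply: ex_cons ok (IH _ h). Qed.

(** Register 0 still holds the number of nodes, so every target address is rebuilt in register 1
    alone. The original content of natural cell 1 is lost thereby, whence [2 <= a]; all real cells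
    are kept. *)
Lemma save_registers_spec (M : nat) k a0 r h x y : (a0 + k <= 32)%N -> r 0%N = M ->
  exists r' h' y', [/\ ex (flatten [seq save_register a | a <- iota a0 k]) (@St R r h x y) (St r' h' x y'),
    forall q, q != 1%N -> r' q = r q,
    forall a, (2 <= a)%N -> h' (4 * M + 64 + a)%N = (if (a0 <= a < a0 + k)%N then r a else h (4 * M + 64 + a)%N),
    forall a, y' (4 * M + 64 + a)%N = (if (a0 <= a < a0 + k)%N then x a else y (4 * M + 64 + a)%N) &
    forall b, (b < 4 * M + 64)%N -> h' b = h b /\ y' b = y b].
Proof.
elim: k a0 r h y => [|k IH] a0 r h y ak r0.
  exists r, h, y; split => //=; first exact: ex_nil.
    by move=> a _; case: ifP => //; clear; lia.
  by move=> a; case: ifP => //; clear; lia.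
have aK : (a0 < nregs)%N by rewrite /nregs; clear -ak; lia.
set r1 := rset r 1 (4 * M + 64 + a0)%N.
have [||r' [h' [y' [e1 e2 e3 e4 e5]]]] := IH a0.+1 r1 (upd h (4 * M + 64 + a0)%N (r1 a0)) (upd y (4 * M + 64 + a0)%N (x a0)).
- by clear -ak; lia.
- by [].
exists r', h', y'; split.
- rewrite /=; apply: (ex_cat (l1 := save_register a0)); last exact: e1.
  have E : (64 + a0 + M + M + M + M = 4 * M + 64 + a0)%N by clear; lia.
  apply: ex_cons => //; apply: ex_cons => //; apply: ex_cons => //; apply: ex_cons => //; apply: ex_cons => //.
  rewrite /= !r0 E.
  have rE : rset (rset (rset (rset (rset r 1 (64 + a0)%N) 1 (64 + a0 + M)%N) 1 (64 + a0 + M + M)%N) 1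
     (64 + a0 + M + M + M)%N) 1 (4 * M + 64 + a0)%N = r1.
    by apply/funext => q; rewrite /r1 !rsetE; case: eqVneq.
  rewrite rE; apply: ex_nstore; first by rewrite aK.
    by rewrite /r1 /=; clear; rewrite /nregs; lia.
  rewrite /=; apply: ex_rstore; first by rewrite aK.
    by rewrite /r1 /=; clear; rewrite /nregs; lia.
  exact: ex_nil.
- by move=> q q1; rewrite e2 // /r1 rsetE (negbTE q1).
- move=> a a2; rewrite e3 // updE eqn_add2l.
  have -> : r1 a = r a by rewrite /r1 rsetE; case: eqP => // q; exfalso; clear -q a2; lia.
  have [aE|ne] := eqVneq a a0.
    rewrite aE ltnn leqnn addnS ltnS leq_addr /= /r1 rsetE.
    by case: eqP => // q; exfalso; clear -q a2 aE; lia.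
  have -> : (a0 <= a < a0 + k.+1)%N = (a0 < a < a0.+1 + k)%N by clear -ne; lia.
  by [].
- move=> a; rewrite e4 updE eqn_add2l.
  have [->|ne] := eqVneq a a0.
    by rewrite ltnn leqnn addnS ltnS leq_addr.
  by have -> : (a0 <= a < a0 + k.+1)%N = (a0 < a < a0.+1 + k)%N by clear -ne; lia.
move=> b hb; have [-> ->] := e5 b hb; rewrite !updE.
by case: eqP => // q; exfalso; clear -q hb; lia.
Qed.

Lemma relocate_input_spec (N0 : nat -> nat) (X0 : nat -> R) cr L n :
  N0 0%N = n.+1 -> (L + 60 * n.+1 + 300 <= cr)%N ->
  wp relocate_input (St N0 N0 X0 X0) cr (fun s' cr' =>
    [/\ [/\ rn s' 0 = n.+1, rn s' 1 = 1%N, rn s' 2 = 3%N & rn s' 3 = entries n],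
       [/\ rn s' 4 = (inputs n).+1, rn s' 5 = depths n, rn s' 6 = firsts n, rn s' 7 = lasts n & rn s' 8 = inputs n],
       rx s' 10 = 0,
       (forall a, (2 <= a < 3 * n.+1)%N -> hn s' (inputs n + a)%N = N0 a) /\
       (forall a, (a < 3 * n.+1)%N -> hx s' (inputs n + a)%N = X0 a) & (L <= cr')%N]).
Proof.
move=> N00 crb.
have [|r1 [h1 [y1 [e1 e2 e3 e4 e5]]]] := @save_registers_spec n.+1 32 0 N0 N0 X0 X0 _ N00 => //.
apply: wp_seq; apply: wp_blk; [|exact: e1|].
  by have -> : size save_registers = 224%N by []; clear -crb; lia.
have -> : size save_registers = 224%N by [].
have r10 : r1 0%N = n.+1 by rewrite e2.
apply: wp_seq; apply: wp_blk; [rewrite /=; clear -crb; lia|by rewrite /set_constants; run|].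
rewrite [size _]/= !r10 subrr.
have iE : inputs n = (4 * n.+1 + 64)%N by [].
have dE : depths n = (inputs n + 3 * n.+1)%N by [].
have fE : firsts n = (inputs n + 4 * n.+1)%N by [].
have lE : lasts n = (inputs n + 5 * n.+1)%N by [].
have eE : entries n = (inputs n + 6 * n.+1)%N by [].
have -> : (64 + n.+1 + n.+1 + n.+1 + n.+1 = inputs n)%N by clear -iE; lia.
have -> : (n.+1 + n.+1 + n.+1 = 3 * n.+1)%N by clear; lia.
pose Inv (s' : st R) (cr' : nat) := exists a : nat,
   [/\ [/\ [/\ rn s' 0 = n.+1, rn s' 1 = 1%N, rn s' 2 = 3%N & rn s' 3 = entries n],
       [/\ rn s' 4 = (inputs n).+1, rn s' 5 = depths n, rn s' 6 = firsts n, rn s' 7 = lasts n & rn s' 8 = inputs n]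
       & rx s' 10 = 0],
     [/\ rn s' 16 = a, rn s' 21 = (3 * n.+1)%N, rn s' 25 = (3 * n.+1 - a)%N & (32 <= a)%N],
     forall b, (b < inputs n)%N -> hn s' b = N0 b /\ hx s' b = X0 b,
     (forall b, (2 <= b < 3 * n.+1)%N -> (b < a)%N -> hn s' (inputs n + b)%N = N0 b) /\
     (forall b, (b < 3 * n.+1)%N -> (b < a)%N -> hx s' (inputs n + b)%N = X0 b) &
     (L + 20 * (3 * n.+1 - a) + 1 <= cr')%N].
apply: (wp_while (Inv := Inv)) => //; last first.
  exists 32%N; split => //=.
  - by split => //; split => //; clear -iE dE fE lE eE; lia.
  - split.
      by move=> b /andP[b2 _] b32; rewrite iE e3 // add0n b32.
    by move=> b _ b32; rewrite iE e4 add0n b32.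
  - by clear -crb; lia.
case=> r h x y cr' [a [/= [[R0 R1 R2 R3] [R4 R5 R6 R7 R8] X10] [R16 R21 R25 a32] lo [cN cX] crd]].
split; first by clear -crd; lia.
split.
  move=> e; have ge : (3 * n.+1 <= a)%N by clear -e R25; lia.
  split => //; last by clear -crd; lia.
  split => b hb; first by apply: cN => //; clear -hb ge; lia.
  by apply: cX => //; clear -hb ge; lia.
move=> nz; have alt : (a < 3 * n.+1)%N by clear -nz R25; lia.
have nE : nregs = 32%N by [].
apply: wp_blk; [rewrite /=; clear -crd alt; lia|run|].
rewrite [size _]/= !(R16, R8, R1, R21) addn1.
(* The source lies below [inputs n], where the loop never writes, so it still holds the original
   input. *)
have [ha ya] := lo a (ltac:(clear -alt iE; lia)).
rewrite ha ya.
split; first by clear -crd alt; lia.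
exists a.+1; split => //=.
- by split => //; clear -a32; lia.
- move=> b hb; rewrite !updE; case: eqP => [q|_]; first by exfalso; clear -q hb; lia.
  exact: lo.
- split => b hb ba; rewrite updE eqn_add2l; case: eqVneq => [->//|ne].
    by apply: cN => //; clear -ba ne; lia.
  by apply: cX => //; clear -ba ne; lia.
- by clear -crd alt; lia.
Qed.

End Relocate.

(** * Initial envelopes of single nodes *)

Definition node_depth : cmd :=
  Seq (Blk [:: NConst 20 0; NAdd 21 11 20])
      (While 21 (Blk [:: NAdd 22 4 21; NLoad 21 22; NAdd 20 20 1])).

Definition leaf_entry : cmd :=
  Blk [:: RStore 3 3; RMul 6 5 4; NAdd 22 3 1; RStore 22 6; RFromN 6 1; RSub 6 6 4;
          NAdd 22 22 1; RStore 22 6; NStore 3 21; NAdd 22 3 1; NStore 22 13;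
          NAdd 3 3 2; RAdd 3 5 10].

(** Shared by both kinds of nodes: its start is real register 3, which is the prize if a leaf entry
    precedes it and 0 otherwise. *)
Definition empty_entry : cmd :=
  Blk [:: RStore 3 3; NAdd 22 3 1; RStore 22 10; RFromN 6 1; NAdd 22 22 1; RStore 22 6;
          NStore 3 21; NAdd 22 3 1; NConst 23 9; NStore 22 23; NAdd 3 3 2;
          NAdd 22 7 11; NStore 22 3; NAdd 12 12 2; NAdd 13 13 1; NAdd 13 13 1;
          NAdd 11 11 1; NSub 25 0 11].

Definition init_node : cmd :=
  Seq node_depth
  (Seq (Blk [:: NAdd 22 5 11; NStore 22 20; NConst 22 0; NStore 13 22; NAdd 22 6 11; NStore 22 3;
                NAdd 22 12 1; RLoad 4 22; NAdd 22 22 1; RLoad 5 22; RAdd 3 10 10; RLe 23 5 10;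
                NConst 21 0])
  (Seq (If 23 (Blk [::]) leaf_entry) empty_entry)).

Definition init_all : cmd :=
  Seq (Blk [:: NConst 11 0; NAdd 12 8 11; NConst 13 34; NAdd 13 13 0; NAdd 13 13 0; NAdd 25 0 11])
      (While 25 init_node).

Section Init.
Variables (R : realType) (n : nat) (par : 'I_n.+1 -> 'I_n.+1) (w pi p : 'I_n.+1 -> R).
Hypothesis tree : is_rooted_tree par.
Hypothesis pi01 : forall v, 0 < pi v <= 1.
Implicit Types (s : st R).

Lemma node_depth_spec s cr L H (v : 'I_n.+1) : consts par w pi p s H -> rn s 11 = v ->
  (L + 5 * n.+1 + 10 <= cr)%N ->
  wp node_depth s cr (fun s' cr' => [/\ rn s' 20 = depth tree v,
    forall q, (q < 20)%N -> rn s' q = rn s q, hn s' = hn s, rx s' = rx s /\ hx s' = hx s & (L <= cr')%N]).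
Proof.
case: s => r0 h0 x0 y0 cs /= r11 crb.
have [/= e0 e1 e2 e3 e4 e5 e6 e7 e8 x10 eH epar ew epi ep] := cs.
apply: wp_seq; apply: wp_blk; [rewrite /=; clear -crb; lia|by run|].
rewrite [size _]/= r11 addn0.
pose Inv (s' : st R) (cr' : nat) := exists k : nat,
  [/\ (k <= depth tree v)%N, rn s' 20 = k /\ rn s' 21 = iter k par v,
    forall q, (q < 20)%N -> rn s' q = r0 q, [/\ hn s' = h0, rx s' = x0 & hx s' = y0] &
    (L + 5 * (depth tree v - k) + 1 <= cr')%N].
have dn := depth_le tree v.
apply: (wp_while (Inv := Inv)) => //; last first.
  by exists 0%N; split => //=; [frame|clear -crb dn; lia].
case=> r h x y cr' [k [/= kd [R20 R21] fr [-> -> ->] crd]].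
split; first by clear -crd; lia.
split.
  move=> e; split => //; last by clear -crd; lia.
  apply/eqP; rewrite eqn_leq R20 kd /=; apply: (depth_min tree).
  by apply: val_inj; rewrite /= -e R21.
move=> nz; have kd' : (k < depth tree v)%N.
  rewrite ltn_neqAle kd andbT; apply: contra nz => /eqP ek.
  by rewrite R21 ek (iter_depth tree).
have nz0 : iter k par v != ord0 by apply: contra nz => /eqP ek; rewrite R21 ek.
have R4 : r 4%N = (inputs n).+1 by rewrite fr.
have R1 : r 1%N = 1%N by rewrite fr.
have iE : inputs n = (4 * n.+1 + 64)%N by [].
have nE : nregs = 32%N by [].
apply: wp_blk; [rewrite /=; clear -crd kd'; lia|by run|].
rewrite [size _]/= R4 R1 R20 R21 (epar _ nz0) addn1.
split; first by clear -crd kd'; lia.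
exists k.+1; split => //=; first by frame; apply: fr.
by clear -crd kd'; lia.
Qed.

Lemma empty_entry_spec r h x y cr H (v : nat) : (v < n.+1)%N ->
  [/\ r 0%N = n.+1, r 1%N = 1%N, r 2%N = 3%N, r 3%N = H & r 7%N = lasts n] ->
  [/\ r 11%N = v, r 12%N = (inputs n + 3 * v)%N, r 13%N = flag n v & r 21%N = 0%N] ->
  (entries n <= H)%N -> x 10%N = 0 :> R -> (20 <= cr)%N ->
  wp empty_entry (St r h x y) cr (fun s' cr' =>
   [/\ [/\ rn s' 11 = v.+1, rn s' 12 = (inputs n + 3 * v.+1)%N, rn s' 13 = flag n v.+1, rn s' 25 = (n.+1 - v.+1)%N
         & rn s' 3 = (H + 3)%N],
     (forall q, (q < 10)%N -> q != 3%N -> rn s' q = r q) /\ rx s' 10 = 0,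
     (forall b, (b < H)%N -> b != (lasts n + v)%N -> hn s' b = h b) /\ (forall b, (b < H)%N -> hx s' b = y b),
     [/\ hn s' (lasts n + v)%N = (H + 3)%N, hn s' H = 0%N, hn s' H.+1 = 9%N, hx s' H = x 3%N & hx s' H.+1 = 0 /\ hx s' H.+2 = 1]
     & (cr <= cr' + 20)%N]).
Proof.
move=> vn [r0 r1 r2 r3 r7] [r11 r12 r13 r21] eH x10 crb.
have iE : inputs n = (4 * n.+1 + 64)%N by [].
have lE : lasts n = (inputs n + 5 * n.+1)%N by [].
have eE : entries n = (inputs n + 6 * n.+1)%N by [].
have fE q : flag n q = (2 * n.+1 + 34 + 2 * q)%N by [].
have nE : nregs = 32%N by [].
apply: wp_blk; [rewrite /=; clear -crb; lia|by run|].
rewrite [size _]/= !(r0, r1, r2, r3, r7, r11, r12, r13, r21, x10) !addn1.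
split.
- by rewrite /=; split => //; [clear; lia|rewrite !fE; clear; lia].
- by split; [move=> q q1 q2; rewrite /=; frame_at q|].
- rewrite /=; split.
    move=> b bH bl; rewrite !updE (negbTE bl).
    by do 2 (case: eqP => [q|_]; first by exfalso; clear -q bH; lia).
  move=> b bH; rewrite !updE.
  by do 3 (case: eqP => [q|_]; first by exfalso; clear -q bH; lia).
- have ne0 : (H == lasts n + v)%N = false by clear -eH eE lE vn; lia.
  have ne1 : (H.+1 == lasts n + v)%N = false by clear -eH eE lE vn; lia.
  have n01 : (H == H.+1) = false by clear; lia.
  have n02 : (H == H.+2) = false by clear; lia.
  have n12 : (H.+1 == H.+2) = false by clear; lia.
  have n10 : (H.+1 == H) = false by clear; lia.
  by rewrite /= !updE !eqxx ne0 ne1 n01 n02 n12.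
- by rewrite /=; clear; lia.
Qed.

Lemma init_all_spec s cr L :
  consts par w pi p s (entries n) -> (L + (5 * n.+1 + 80) * n.+1 + 10 <= cr)%N ->
  wp init_all s cr (fun s' cr' => exists H', merged w pi p tree s' H' set0 /\ (L <= cr')%N).
Proof.
case: s => r0 h0 x0 y0 cs crb.
have iE : inputs n = (4 * n.+1 + 64)%N by [].
have dE : depths n = (inputs n + 3 * n.+1)%N by [].
have fE : firsts n = (inputs n + 4 * n.+1)%N by [].
have lE : lasts n = (inputs n + 5 * n.+1)%N by [].
have eE : entries n = (inputs n + 6 * n.+1)%N by [].
have flE q : flag n q = (2 * n.+1 + 34 + 2 * q)%N by [].
have nE : nregs = 32%N by [].
have r00 := cs_0 cs; have r8 := cs_8 cs; rewrite /= in r00 r8.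
apply: wp_seq; apply: wp_blk; [rewrite /=; clear -crb; lia|by run|].
rewrite [size _]/= r00 r8 !addn0.
pose Inv (s' : st R) (cr' : nat) := exists v H' : nat,
  [/\ (v <= n.+1)%N, consts par w pi p s' H',
     [/\ rn s' 11 = v, rn s' 12 = (inputs n + 3 * v)%N, rn s' 13 = flag n v & rn s' 25 = (n.+1 - v)%N],
     forall u : 'I_n.+1, (u < v)%N -> [/\ hn s' (depths n + u)%N = depth tree u, hn s' (flag n u) = 0%N & node_ok par w pi p s' H' set0 u] &
     (L + (5 * n.+1 + 80) * (n.+1 - v) + 1 <= cr')%N].
apply: (wp_while (Inv := Inv)) => //; last first.
  exists 0%N, (entries n); split => //=.
  - case: cs => /= c0 c1 c2 c3 c4 c5 c6 c7 c8 c10 cH cp cw cpi cpp; by split.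
  - by split => //; rewrite ?flE; clear; lia.
  - by clear -crb; lia.
move=> {r00 r8 cs r0 h0 x0 y0 crb cr}.
case=> r h x y cr' [v [H' [/= vn cs [R11 R12 R13 R25] nod crd]]].
split; first by clear -crd; lia.
split.
  move=> e; exists H'; have vE : v = n.+1 by clear -e R25 vn; lia.
  split; last by clear -crd; lia.
  split => // u => [||_]; by case: (nod u) => //; rewrite vE.
move=> nz; have vlt : (v < n.+1)%N by clear -nz R25; lia.
pose c : 'I_n.+1 := Ordinal vlt.
have bud : (L + (5 * n.+1 + 80) * (n.+1 - v.+1) + 5 * n.+1 + 80 <= cr'.-1)%N.
  have E : (n.+1 - v = (n.+1 - v.+1).+1)%N by clear -vlt; lia.
  by move: crd; rewrite E mulnS; move: ((5 * n.+1 + 80) * _)%N => X; clear; lia.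
have [L' eL] : exists L', L' = (L + (5 * n.+1 + 80) * (n.+1 - v.+1))%N by exists (L + (5 * n.+1 + 80) * (n.+1 - v.+1))%N.
rewrite -eL in bud; move=> {crd}.
have cs' := cs.
have [/= e0 e1 e2 e3 e4 e5 e6 e7 e8 x10 eH epar ew epi ep] := cs'.
have flv := flE v.
(* Both branches end in [empty_entry]; [k] is the number of entries already written for the node, 1
   for a positive prize and 0 otherwise. *)
have finish r2 h2 x2 y2 cr2 k : (k <= 1)%N ->
   (forall q, (q < 10)%N -> q != 3%N -> r2 q = r q) ->
   [/\ r2 3%N = (H' + 3 * k)%N, r2 11%N = v, r2 12%N = (inputs n + 3 * v)%N, r2 13%N = flag n v & r2 21%N = 0%N] ->
   x2 10%N = 0 ->
   (forall b, (b < H')%N -> b != (depths n + v)%N -> b != flag n v -> b != (firsts n + v)%N -> h2 b = h b) ->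
   [/\ h2 (depths n + v)%N = depth tree c, h2 (flag n v) = 0%N & h2 (firsts n + v)%N = H'] ->
   (forall b, (b < H')%N -> y2 b = y b) ->
   (k = 0%N -> p c <= 0 /\ x2 3%N = 0) ->
   (k = 1%N -> [/\ 0 < p c, x2 3%N = p c,
     y2 H' = 0, y2 H'.+1 = p c * pi c & y2 H'.+2 = 1 - pi c] /\ (h2 H' = 0%N /\ h2 H'.+1 = flag n v)) ->
   (L' + 30 <= cr2)%N ->
   wp empty_entry (St r2 h2 x2 y2) cr2 (fun s' cr' => (0 < cr')%N /\ Inv s' cr'.-1).
  move=> k1 f1 [g3 g11 g12 g13 g21] gx f2 [m1 m2 m3] f3 K0 K1 c2.
  apply: wp_conseq.
    apply: (@empty_entry_spec _ _ _ _ _ (H' + 3 * k) v) => //.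
    - by split => //; rewrite f1.
    - by clear -eH; lia.
    - by clear -c2; lia.
  rewrite /= => -[r4 h4 x4 y4] cr4 [/= [q11 q12 q13 q25 q3] [fr4 x410] [fh fy] [n1 n2 n3 n4 [n5 n6]] c4].
  have hfr b : (b < H')%N -> b != (depths n + v)%N -> b != flag n v -> b != (firsts n + v)%N ->
      b != (lasts n + v)%N -> h4 b = h b.
    by move=> bH z1 z2 z3 z4; rewrite fh ?f2 //; clear -bH; lia.
  have yfr b : (b < H')%N -> y4 b = y b.
    by move=> bH; rewrite fy ?f3 //; clear -bH; lia.
  split; first by clear -c2 c4; lia.
  exists v.+1, (H' + 3 * k + 3)%N; split => //=; last by rewrite -eL; clear -c2 c4; lia.
    split => //=; try by rewrite fr4 ?f1.
    - by clear -eH; lia.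
    - move=> u u0; have un := ltn_ord u.
      by rewrite hfr ?epar //; clear -un iE dE fE lE eE eH flv vlt; lia.
    - move=> u; have un := ltn_ord u.
      by rewrite yfr ?ew //; clear -un iE eE eH; lia.
    - move=> u; have un := ltn_ord u.
      by rewrite yfr ?epi //; clear -un iE eE eH; lia.
    - move=> u; have un := ltn_ord u.
      by rewrite yfr ?ep //; clear -un iE eE eH; lia.
  have at_v b : b = (depths n + v)%N \/ b = flag n v \/ b = (firsts n + v)%N -> h4 b = h2 b.
    by move=> hb; apply: fh; clear -hb iE dE fE lE eE eH flv vlt; lia.
  move=> u; rewrite ltnS leq_eqVlt => /orP[/eqP uv|uv]; last first.
    have un := ltn_ord u; have flu := flE u; have [z1 z2 z3] := nod u uv.
    split.
    - by rewrite hfr //; clear -uv un iE dE fE lE eE eH flv flu vlt; lia.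
    - by rewrite hfr //; clear -uv un iE dE fE lE eE eH flv flu vlt; lia.
    apply: (node_ok_frame z3) => //=.
    - by clear; lia.
    - by rewrite hfr //; clear -uv un iE dE fE lE eE eH flv flu vlt; lia.
    - by rewrite hfr //; clear -uv un iE dE fE lE eE eH flv flu vlt; lia.
    - move=> b /andP[b1 b2]; split; last exact: yfr.
      by rewrite hfr //; clear -b1 iE dE fE lE eE eH flv vlt; lia.
  have -> : u = c by apply: val_inj.
  split; [by rewrite at_v //; left|by rewrite at_v //; right; left|].
  exists H', k.+1, (fun l => if (l == 0%N) && (k == 1%N) then [set c] else set0).
  rewrite blob_set0 setDv /=; split.
  - by rewrite at_v //; right; right.
  - by rewrite n1; clear; lia.
  - by split => //; clear; lia.
  - have [k0|kn] := eqVneq k 0%N.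
      have [pc x23] := K0 k0; move: n4 n5 n6; rewrite k0 muln0 addn0 => n4 n5 n6.
      by apply: opt_chain_leaf1; rewrite ?muln0 ?addn0 ?n4 ?x23.
    have kE : k = 1%N by clear -kn k1; lia.
    have [[pc x23 y0' y1' y2'] _] := K1 kE; move: n4 n5 n6; rewrite kE => n4 n5 n6.
    have lo b : (b < H' + 3 * 1)%N -> y4 b = y2 b by move=> hb; apply: fy; rewrite kE.
    have e1' : (H' < H' + 3 * 1)%N by clear; lia.
    have e2' : (H'.+1 < H' + 3 * 1)%N by clear; lia.
    have e3' : (H'.+2 < H' + 3 * 1)%N by clear; lia.
    by apply: opt_chain_leaf2; rewrite ?muln0 ?addn0 ?n4 ?n5 ?n6 ?lo.
  move=> l lk; exists 1%N; first by rewrite cards1.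
  have [le|lne] := eqVneq l k.
    rewrite le; have -> : (k == 0%N) && (k == 1%N) = false by clear; lia.
    by apply: dag_nil => //; clear -eH; lia.
  have kE : k = 1%N by clear -lne lk k1; lia.
  have l0 : l = 0%N by clear -lne lk kE; lia.
  have [_ [m5 m6]] := K1 kE.
  rewrite l0 kE muln0 addn0 /=; apply: dag_leaf.
  - exact: eH.
  - by clear; lia.
  - by rewrite fh ?kE //; [clear; lia|clear -iE lE eE eH vlt; lia].
  - by rewrite fh ?kE ?m6 //; [clear; lia|clear -iE lE eE eH vlt; lia].
apply: wp_seq; apply: wp_conseq.
  apply: (@node_depth_spec _ _ (L' + 60) H' c cs) => //.
  by clear -bud; lia.
case=> r1 h1 x1 y1 cr1 [/= g20 fr1 -> [-> ->] c1].
have [R0 R1 R2 R3] : [/\ r1 0%N = n.+1, r1 1%N = 1%N, r1 2%N = 3%N & r1 3%N = H'] by split; rewrite fr1.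
have [R5 R6 R11' R12' R13'] : [/\ r1 5%N = depths n, r1 6%N = firsts n, r1 11%N = v,
   r1 12%N = (inputs n + 3 * v)%N & r1 13%N = flag n v] by split; rewrite fr1.
apply: wp_seq; apply: wp_blk; [rewrite /=; clear -c1; lia| |].
  by run.
rewrite [size _]/= !(R1, R3, R5, R6, R11', R12', R13', g20, x10, addr0) !addn1 (epi c) (ep c).
set h2 := upd _ _ H'.
have [hm1 hm2 hm3] : [/\ h2 (depths n + v)%N = depth tree c, h2 (flag n v) = 0%N & h2 (firsts n + v)%N = H'].
  rewrite /h2 !updE !eqxx.
  have -> : (depths n + v == firsts n + v)%N = false by clear -dE fE; lia.
  have -> : (depths n + v == flag n v)%N = false by clear -dE iE flv vlt; lia.
  by have -> : (flag n v == firsts n + v)%N = false by clear -fE iE flv vlt; lia.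
have hfr2 b : b != (depths n + v)%N -> b != flag n v -> b != (firsts n + v)%N -> h2 b = h b.
  by move=> z1 z2 z3; rewrite /h2 !updE (negbTE z1) (negbTE z2) (negbTE z3).
apply: wp_seq; apply: wp_if => [//|/=||]; first by clear -c1; lia.
  rewrite /=; case: (boolP (p c <= 0)) => // pc _.
  apply: wp_blk; [by []|exact: ex_nil|].
  apply: (finish _ _ _ _ _ 0%N) => //=.
  - by move=> q q1 q3; rewrite -fr1; [frame_at q|clear -q1; lia].
  - by rewrite muln0 addn0.
  - by move=> b _; apply: hfr2.
  - by clear -c1; lia.
rewrite /=; case: (boolP (p c <= 0)) => // pc _; rewrite -ltNge in pc.
apply: wp_blk; [rewrite /=; clear -c1; lia|by run|].
rewrite [size _]/= !(R1, R2, R3, R13', x10, addr0) !addn1.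
have H01 : (H' == H'.+1) = false by clear; lia.
have H02 : (H' == H'.+2) = false by clear; lia.
have H12 : (H'.+1 == H'.+2) = false by clear; lia.
have H10 : (H'.+1 == H') = false by clear; lia.
have H20 : (H'.+2 == H') = false by clear; lia.
have H21 : (H'.+2 == H'.+1) = false by clear; lia.
apply: (finish _ _ _ _ _ 1%N) => //=.
- by move=> q q1 q3; rewrite -fr1; [frame_at q|clear -q1; lia].
- move=> b bH z1 z2 z3; rewrite -hfr2 // !updE.
  by do 2 (case: eqP => [q|_]; first by exfalso; clear -q bH; lia).
- split; rewrite !updE.
  + by do 2 (case: eqP => [q|_]; first by exfalso; clear -q iE dE fE eE eH vlt; lia).
  + by do 2 (case: eqP => [q|_]; first by exfalso; clear -q iE flv eE eH vlt; lia).
  + by do 2 (case: eqP => [q|_]; first by exfalso; clear -q iE dE fE eE eH vlt; lia).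
- move=> b bH; rewrite !updE.
  by do 3 (case: eqP => [q|_]; first by exfalso; clear -q bH; lia).
- by move=> _; rewrite !updE !eqxx H01 H02 H12 /=.
- by clear -c1; lia.
Qed.

End Init.

(** * Reading off the optimal set *)

Definition mark_solution : cmd :=
  Seq (Blk [:: NLoad 20 6; NAdd 21 20 1; RLoad 0 21; NStore 3 20; NAdd 17 3 1; NConst 19 1])
  (While 19
    (Seq (Blk [:: NSub 17 17 1; NLoad 20 17; NLoad 21 20; NAdd 22 20 1; NLoad 22 22])
    (Seq (If 21 (Blk [:: NStore 17 21; NAdd 17 17 1; NStore 17 22; NAdd 17 17 1])
                (Blk [:: NConst 23 1; NStore 22 23]))
         (Blk [:: NSub 19 17 3])))).

(* The output cells may overlap the registers, so this last loop only uses
   registers 0 and 1, which are below the output.  With stride 2 the source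
   of every output cell lies above all cells already written. *)
Definition write_output : cmd :=
  Seq (Blk [:: NAdd 0 0 0; NConst 1 1])
  (While 1 (Blk [:: NConst 1 32; NAdd 1 1 0; NAdd 1 1 0; NLoad 1 1; NStore 0 1;
                    NConst 1 1; NSub 0 0 1; NSub 1 0 1])).

Section Output.
Variables (R : realType) (n : nat).
Implicit Types (s : st R).

Fixpoint worklist (h : nat -> nat) H (l : seq (nat * {set 'I_n.+1} * nat)) : Prop :=
  if l is (e, A, q) :: l' then [/\ h (H + size l')%N = e, dag h H e A q & worklist h H l'] else True.

Definition worklist_set (l : seq (nat * {set 'I_n.+1} * nat)) := \bigcup_(z <- l) z.1.2.

(** A binary tree with [q] leaves has [2 * q - 1] vertices, each visited once. *)
Definition worklist_cost (l : seq (nat * {set 'I_n.+1} * nat)) := (\sum_(z <- l) (2 * z.2 - 1))%N.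

Lemma worklist_frame h h' H l : worklist h H l ->
  (forall a, (entries n <= a < H + size l)%N -> h' a = h a) -> (entries n <= H)%N -> worklist h' H l.
Proof.
elim: l => [|[[e A] q] l IH] //= [h1 h2 h3] fr eH; split.
- by rewrite fr //; clear -eH; lia.
- by apply: dag_frame h2 (leqnn _) _ => a ha; apply: fr; clear -ha; lia.
by apply: IH => // a ha; apply: fr; clear -ha; lia.
Qed.

Lemma mark_solution_spec r0 h0 x0 y0 cr L H P (A : {set 'I_n.+1}) q :
  [/\ r0 1%N = 1%N, r0 3%N = H & r0 6%N = firsts n] ->
  h0 (firsts n) = P -> (entries n <= H)%N -> (P.+1 < H)%N ->
  dag h0 H P A q -> (forall v : 'I_n.+1, h0 (flag n v) = 0%N) ->
  (L + 40 * q + 20 <= cr)%N ->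
  wp mark_solution (@St R r0 h0 x0 y0) cr (fun s' cr' =>
    [/\ rn s' 0 = r0 0%N, rx s' 0 = y0 P.+1,
       forall v : 'I_n.+1, (hn s' (flag n v) != 0%N) = (v \in A) & (L <= cr')%N]).
Proof.
move=> [r1 r3 r6] hP eH PH dg fl crb.
have iE : inputs n = (4 * n.+1 + 64)%N by [].
have fE : firsts n = (inputs n + 4 * n.+1)%N by [].
have eE : entries n = (inputs n + 6 * n.+1)%N by [].
have flE v : flag n v = (2 * n.+1 + 34 + 2 * v)%N by [].
have nE : nregs = 32%N by [].
have eP := dag_ge dg.
have q0 := dag_pos dg.
apply: wp_seq; apply: wp_blk; [rewrite /=; clear -crb; lia| |].
  by run1; rewrite r6 hP; run.
rewrite [size _]/= !(r1, r3) addn1.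
pose Inv (s' : st R) (cr' : nat) := exists l,
  [/\ [/\ rn s' 1 = 1%N, rn s' 3 = H, rn s' 0 = r0 0%N & rx s' 0 = y0 P.+1],
      rn s' 17 = (H + size l)%N /\ ((rn s' 19 == 0%N) = (size l == 0%N)), worklist (hn s') H l,
     forall v : 'I_n.+1, (hn s' (flag n v) != 0%N) || (v \in worklist_set l) = (v \in A) /\
        ((hn s' (flag n v) != 0%N) -> v \in A)  &
     (L + 20 * worklist_cost l + 1 <= cr')%N].
apply: (wp_while (Inv := Inv)) => //; last first.
  exists [:: (P, A, q)]; split => //=.
  - rewrite addn0 updE eqxx; split => //.
    by apply: dag_frame dg (leqnn _) _ => a ha; rewrite updE; case: eqP => // ea; exfalso; clear -ha ea; lia.
  - move=> v; have vn := ltn_ord v; have flv := flE v; rewrite updE.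
    case: (flag n v =P H) => [ea|_]; first by exfalso; clear -ea flv eE iE eH vn; lia.
    by rewrite fl /worklist_set big_seq1.
  - by rewrite /worklist_cost big_seq1 /=; clear -crb; lia.
case=> r h x y cr' [l [/= [R1 R3 R0 X0] [R17 R19] wl fA crd]].
split; first by clear -crd; lia.
split.
  move=> e; move: R19; rewrite e eqxx => /esym/eqP/size0nil l0; split => //.
    by move=> v; have [<- _] := fA v; rewrite l0 /worklist_set big_nil in_set0 orbF.
  by clear -crd; lia.
move=> nz; rewrite (negbTE nz) in R19.
case: l R17 R19 wl fA crd => [//|[[e B] i] l] /= R17 _ [he de wl] fA crd.
have R17' : (H + (size l).+1 - 1 = H + size l)%N by clear; lia.
have ee := dag_ge de; have i0 := dag_pos de.
have cE : worklist_cost ((e, B, i) :: l) = (2 * i - 1 + worklist_cost l)%N by rewrite /worklist_cost big_cons.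
have sE : worklist_set ((e, B, i) :: l) = B :|: worklist_set l by rewrite /worklist_set big_cons.
rewrite sE in fA; rewrite cE in crd.
apply: wp_seq; apply: wp_blk; [rewrite /=; clear -crd i0; lia| |].
  run1; run1; rewrite R17 R1 R17' he; by run.
rewrite [size _]/= !(R17, R1, R17', he) addn1.
apply: wp_seq; apply: wp_if => [//|/=|/=|/=]; first by clear -crd i0; lia.
  move=> lnz; case: de lnz ee i0 {he cE sE} fA crd => {e B i} [e _ _ ->|e v _ _ ->|e A1 A2 i j lo hi d1 d2] // lnz ee i0 fA crd.
  have j1 := dag_pos d1; have j2 := dag_pos d2.
  apply: wp_blk; [rewrite /=; clear -crd i0 j1 j2; lia|by run|].
  rewrite [size _]/= R1.
  apply: wp_blk; [rewrite /=; clear -crd i0 j1 j2; lia|by run|].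
  rewrite [size [:: _]]/= R3 !addn1.
  split; first by rewrite /=; clear -crd i0 j1 j2; lia.
  set h2 := upd _ _ _.
  have fr a : (a < H + size l)%N -> h2 a = h a.
    move=> al; rewrite /h2 !updE.
    by do 2 (case: eqP => [ea|_]; first by exfalso; clear -ea al; lia).
  exists [:: (h e.+1, A2, j), (h e, A1, i) & l]; split => //=.
  - by split; [clear; lia|clear; lia].
  - split.
    + by rewrite /h2 updE addnS eqxx.
    + by apply: dag_frame d2 (leqnn _) _ => a ha; apply: fr; clear -ha; lia.
    split.
    + by rewrite /h2 !updE eqxx; case: eqP => // ea; exfalso; clear -ea; lia.
    + by apply: dag_frame d1 (leqnn _) _ => a ha; apply: fr; clear -ha; lia.
    by apply: worklist_frame wl _ eH => a ha; apply: fr; clear -ha; lia.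
  - move=> v; have vn := ltn_ord v; have flv := flE v; rewrite fr; last by clear -flv eE iE eH vn; lia.
    have [<- z] := fA v; split => //.
    rewrite /worklist_set !big_cons /= !in_setU; congr (_ || _).
    by rewrite orbA; congr (_ || _); apply: orbC.
  - by rewrite /worklist_cost !big_cons /= -/(worklist_cost l); clear -crd i0 j1 j2; lia.
case: de ee i0 {he cE sE} fA crd => {e B i} [e _ _ e1 e2|e v _ _ e1 e2|e A1 A2 i j lo hi d1 d2] // ee i0 fA crd le.
- apply: wp_blk; [rewrite /=; clear -crd i0; lia| |].
    by run1; apply: ex_cons => //=; rewrite e2 /=; apply: ex_nil.
  apply: wp_blk; [rewrite /=; clear -crd i0; lia|by run|].
  rewrite [size [:: _]]/= R3.
  split; first by rewrite /=; clear -crd i0; lia.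
  exists l; split => //=.
  + by split => //; apply/eqP/eqP; clear; lia.
  + by move=> v; have := fA v; rewrite set0U.
  + by clear -crd i0; lia.
- have flv := flE v; have vn := ltn_ord v.
  apply: wp_blk; [rewrite /=; clear -crd i0; lia| |].
    by run1; rewrite e2; run.
  apply: wp_blk; [rewrite /=; clear -crd i0; lia|by run|].
  rewrite [size [:: _]]/= R3.
  split; first by rewrite /=; clear -crd i0; lia.
  exists l; split => //=.
  + by split => //; apply/eqP/eqP; clear; lia.
  + apply: worklist_frame wl _ eH => a ha; rewrite updE; case: eqP => // ea.
    by exfalso; clear -ea ha flv eE iE vn; lia.
  + move=> u; have flu := flE u; have [z1 z2] := fA u; rewrite updE.
    have vA : v \in A by have [<- _] := fA v; rewrite !in_setU in_set1 eqxx orbT.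
    have [->|uv] := eqVneq u v; first by rewrite eqxx vA.
    have -> : (flag n u == flag n v) = false.
      by apply/negbTE; apply: contra uv => /eqP ef; apply/eqP/val_inj; clear -flu flv ef => /=; lia.
    by split; [rewrite -z1 in_setU in_set1 (negbTE uv)|exact: z2].
  + by clear -crd i0; lia.
(* A union entry holds heap addresses, so its first field cannot be 0. *)
by exfalso; have := dag_ge d1; rewrite le; clear -eE iE; lia.
Qed.

Lemma write_output_spec r0 h0 x0 y0 cr :
  r0 0%N = n.+1 -> (20 * n.+1 + 20 <= cr)%N ->
  wp write_output (@St R r0 h0 x0 y0) cr (fun s' _ =>
    rx s' = x0 /\ forall v : 'I_n.+1, mrg (rn s') (hn s') (n.+2 + v)%N = h0 (flag n v)).
Proof.
move=> r00 crb.
have flE v : flag n v = (2 * n.+1 + 34 + 2 * v)%N by [].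
apply: wp_seq; apply: wp_blk; [rewrite /=; clear -crb; lia|by run|].
rewrite [size _]/= r00.
pose Inv (s' : st R) (cr' : nat) := exists a : nat,
  [/\ rn s' 0 = a /\ (0 < a <= 2 * n.+1)%N, (rn s' 1 == 0%N) = (a == 1%N), rx s' = x0,
     (forall v : 'I_n.+1, hn s' (flag n v) = h0 (flag n v)) /\
     (forall v : 'I_n.+1, (a < n.+2 + v)%N -> mrg (rn s') (hn s') (n.+2 + v)%N = h0 (flag n v)) &
     (10 * a + 1 <= cr')%N].
apply: (wp_while (Inv := Inv)) => //; last first.
  exists (n.+1 + n.+1)%N; split => //=.
  - by split => //; clear; lia.
  - by apply/eqP/eqP; clear; lia.
  - by split => // v; have := ltn_ord v; clear; lia.
  - by clear -crb; lia.
case=> r h x y cr' [a [/= [R0 /andP[a0 an]] R1 -> [fl out] crd]].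
split; first by clear -crd; lia.
split.
  move=> e; move: R1; rewrite e eqxx => /esym/eqP a1; split => // v.
  by apply: out; rewrite a1; clear; lia.
move=> nz; rewrite (negbTE nz) in R1.
have a1 : (1 < a)%N by move/esym/eqP: R1; clear -a0; lia.
set v0 := h (32 + a + a)%N.
(* The target cell may be a register or lie in the heap; this states the effect of a round on the
   joined memory, common to both cases. *)
have key (r' : nat -> nat) h' : (forall b, (1 < b)%N -> mrg r' h' b = if b == a then v0 else mrg r h b) ->
   h' = h \/ h' = upd h a v0 -> r' 0%N = (a - 1)%N -> r' 1%N = (a - 1 - 1)%N ->
   (0 < cr'.-1 - 8)%N /\ Inv (St r' h' x0 y) (cr'.-1 - 8).-1.
  move=> mE hE r0' r1'; split; first by clear -crd a1; lia.
  (* All flags lie above [2 * n.+1], the largest address written. *)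
  have hfl v : h' (flag n v) = h (flag n v).
    case: hE => -> //; rewrite updE; have := flE v; case: eqP => // ea fv; exfalso; clear -ea an fv; lia.
  exists (a - 1)%N; split => /=.
  - by split; [|clear -a1 an; lia].
  - by rewrite r1'; clear -a1; lia.
  - by [].
  - split=> v; first by rewrite hfl fl.
    move=> av; rewrite mE; last by clear; lia.
    case: eqP => [ea|ne]; last by apply: out; clear -av ne; lia.
    by rewrite -fl flE /v0 -ea; congr h; clear; lia.
  - by clear -crd a1; lia.
have nE : nregs = 32%N by [].
have a0f : (0 == a)%N = false by clear -a1; lia.
have sz : (8 <= cr'.-1)%N by clear -crd a1; lia.
have [alt|age] := ltnP a nregs.
  apply: wp_blk; [exact: sz| |].
    run1; run1; run1; run1; apply: ex_cons => //; rewrite /= R0 alt -/v0.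
    by set rr := rset _ a _; run.
  apply: key => /=; last 2 first.
  - by rewrite rsetE a0f /= R0.
  - by rewrite rsetE a0f /= R0.
  - move=> b b1; rewrite /mrg !rsetE; have [->|ba] := eqVneq b a.
      rewrite alt; repeat (case: eqP => [ea|_]; first by exfalso; clear -ea a1; lia).
      by rewrite ?eqxx.
    by case: ltnP => // bK; repeat (case: eqP => [ea|_]; first by exfalso; clear -ea b1 a1; lia).
  - by left.
apply: wp_blk; [exact: sz|by run|].
rewrite /= R0 -/v0; apply: key => //=; last by right.
move=> b b1; rewrite /mrg !rsetE updE; case: ltnP => // bK.
  have -> : (b == a) = false by clear -bK age; lia.
  by repeat (case: eqP => [ea|_]; first by exfalso; clear -ea b1; lia).
Qed.

End Output.

(** * The whole algorithm *)

Definition tour_program : cmd :=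
  Seq relocate_input (Seq init_all (Seq merge_all (Seq mark_solution write_output))).

Section Program.
Variables (R : realType) (n : nat) (par : 'I_n.+1 -> 'I_n.+1) (w pi p : 'I_n.+1 -> R).
Hypothesis tree : is_rooted_tree par.
Hypothesis w0 : forall v, 0 <= w v.
Hypothesis pi01 : forall v, 0 < pi v <= 1.
Let init := init_config par w pi p.

Lemma init_real (v : 'I_n.+1) k : (k < 3)%N ->
  rmem init (3 * v + k)%N = if k == 0%N then w v else if k == 1%N then pi v else p v.
Proof.
move=> k3; have vn := ltn_ord v; rewrite /init /=.
have -> : (3 * v + k < 3 * n.+1)%N by clear -vn k3; lia.
rewrite mulnC divnMDl // modnMDl divn_small // modn_small // addn0.
by rewrite inord_val.
Qed.

Lemma init_nat (c : 'I_n.+1) : nmem init c.+1 = par c.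
Proof. by rewrite /init /= ltnS leq_ord inord_val. Qed.

Lemma tour_program_spec : wp tour_program (St (nmem init) (nmem init) (rmem init) (rmem init))
  (1300 * n.+1 ^ 2) (fun s _ => exists S : {set 'I_n.+1},
  [/\ rx s 0 = value par w pi p [set~ ord0] S,
   forall v : 'I_n.+1, (mrg (rn s) (hn s) (n.+2 + v)%N != 0%N) = (v \in S) &
   forall S', value par w pi p [set~ ord0] S' <= value par w pi p [set~ ord0] S]).
Proof.
set M := n.+1; have M0 : (0 < M)%N by [].
pose L4 := (20 * M + 20)%N; pose L3 := (L4 + 40 * M + 20)%N.
pose L2 := (L3 + 660 * M ^ 2 + (20 * M + 20) * M + 10)%N.
pose L1 := (L2 + (5 * M + 80) * M + 10)%N.
apply: wp_seq; apply: wp_conseq.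
  apply: (@relocate_input_spec _ _ _ _ L1 n) => //.
  (* The parts add up to [685 * M ^ 2 + 220 * M + 360], at most [1265 * M ^ 2]. *)
  by rewrite /L1 /L2 /L3 /L4 -/M; clear -M0; nia.
move=> s cr [[R0 R1 R2 R3] [R4 R5 R6 R7 R8] X10 [hN hX] c1].
have cs : consts par w pi p s (entries n).
  split => //.
  - move=> c c0; have cn := ltn_ord c; rewrite addSnnS hN ?init_nat //.
    by move: c0; rewrite -val_eqE /=; clear -cn; lia.
  - move=> v; have vn := ltn_ord v; rewrite hX; last by clear -vn; lia.
    by rewrite -[(3 * v)%N]addn0 init_real.
  - move=> v; have vn := ltn_ord v; rewrite -addnS -[(3 * v).+1%N]addn1 hX; last by clear -vn; lia.
    by rewrite init_real.
  - move=> v; have vn := ltn_ord v;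
    have -> : ((inputs n + 3 * v).+2 = inputs n + (3 * v + 2))%N by rewrite addnA addn2.
    rewrite hX; last by clear -vn; lia.
    by rewrite init_real.
apply: wp_seq; apply: wp_conseq; first exact: (init_all_spec tree pi01 (L := L2) cs c1).
move=> {s cr R0 R1 R2 R3 R4 R5 R6 R7 R8 X10 hN hX c1 cs} s cr [H [mg c2]].
apply: wp_seq; apply: wp_conseq; first exact (@merge_all_spec R n par w pi p tree pi01 w0 s cr L3 H mg c2).
move=> {s cr H mg c2} [r h x y] cr [H [mg c3]].
have n0 : ord0 \notin [set~ ord0 : 'I_n.+1] by rewrite !inE eqxx.
have [P [k [F [/= eP eE [lo hi] oc dg]]]] := mg_node mg n0.
have /andP[k0 _] := oc_k oc.
have [q qB d] := dg 0%N k0.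
rewrite (blob_full tree) in oc qB; rewrite muln0 addn0 in d.
rewrite /= addn0 in eP.
have cs := mg_consts mg; have fl := mg_flag mg.
have R0 := cs_0 cs; have R1 := cs_1 cs; have R3 := cs_3 cs; have R6 := cs_6 cs.
rewrite /= in R0 R1 R3 R6 fl.
have qM : (q <= M)%N by rewrite cardsT card_ord in qB.
apply: wp_seq; apply: wp_conseq.
  apply: (@mark_solution_spec _ _ r h x y _ L4 H P (F 0%N) q) => //.
  - exact: cs_H cs.
  - by clear -k0 hi; lia.
  - by move: c3; rewrite /L3; clear -qM; lia.
move=> [r' h' x' y'] cr' [/= R0' X0 mk c4].
apply: wp_conseq; first by apply: (write_output_spec (n := n)); [rewrite R0'|exact: c4].
move=> s cr'' [eX out]; exists (F 0%N).
have DE : [set~ ord0] = [set: 'I_n.+1] :\ ord0 by apply/setP => v; rewrite !inE andbT.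
split.
- by rewrite eX X0 DE -(oc_a oc k0) muln0 addn0.
- by move=> v; rewrite out mk.
- move=> S'; rewrite DE -(oc_a oc k0); exact: opt_chain_best oc _ (subsetT _).
Qed.

End Program.

Theorem theorem1 :
  exists (prog : seq instr) (C : nat),
  forall (R : realType) (n : nat) (par : 'I_n.+1 -> 'I_n.+1)
         (w pi p : 'I_n.+1 -> R),
    is_rooted_tree par ->
    (forall v, 0 <= w v) ->
    (forall v, 0 < pi v <= 1) ->
    exists t : nat,
      (t <= C * n.+1 ^ 2)%N /\
      let c := exec prog t (init_config par w pi p) in
      halted prog c /\
      G par w pi p (out_set n c) 0 = out_value c /\
      (forall S : {set 'I_n.+1},
          G par w pi p S 0 <= G par w pi p (out_set n c) 0).
Proof.
exists (compile 0 tour_program), 1300%N => R n par w pi p tree w0 pi01.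
have [t [s [cr [runs_s tc [S [eX out best]]]]]] := @tour_program_spec R n par w pi p tree w0 pi01.
exists t; split; first exact: leq_trans (leq_addr _ _) tc.
(* Registers and heap are two windows on one memory, so both may start as the whole input
   function. *)
have ini : init_config par w pi p =
    conf 0 (St (nmem (init_config par w pi p)) (nmem (init_config par w pi p))
      (rmem (init_config par w pi p)) (rmem (init_config par w pi p))).
  by rewrite /conf /=; congr Config; apply/funext => a; rewrite /mrg if_same.
have := runs_s [::] [::]; rewrite cats0 cat0s -ini => -> /=.
have -> : out_set n (conf (0 + csize tour_program) s) = S.
  by apply/setP => v; rewrite inE -out.
split; first by rewrite /halted -[size _]/(size (compile 0 tour_program)) size_compile.
by split=> [|S']; rewrite !profit_value.
Qed.
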